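(* Let $B$ be a Boolean ring with $|B|\ge 8$, and let $V$ be an $\mathbb{F}_2$-vector space. Then $$\mathrm{HH}^{k,m}(B_*\sqcap V_*,\,B_*\sqcap V_* )=0$$ for every integer $m<0$ and every integer $k\ge 0$ such that $k\neq 1-m$.
   Context: A ring $B$ (commutative, with unit) is Boolean if $x^2=x$ for all $x\in B$. Its associated Boolean graded algebra is the graded $\mathbb{F}_2$-algebra $B_*=\bigoplus_{n\ge0}B_n$ with $B_0=\mathbb{F}_2$ and $B_n=B$ for $n\ge1$, where for $m,n\geq 1$ the multiplication $B_m\times B_n\to B_{m+n}$ is the multiplication of $B$. For an $\mathbb{F}_2$-vector space $V$, the associated dual algebra is the graded $\mathbb{F}_2$-algebra $V_*$ with $V_0=\mathbb{F}_2$, $V_1=V$ and $V_j=0$ for $j\ge2$. For non-negatively graded $\mathbb{F}_2$-algebras $P,Q$ with $P_0=Q_0=\mathbb{F}_2$, the connected sum $P\sqcap Q$ is the graded algebra with $(P\sqcap Q)_0=\mathbb{F}_2$, $(P\sqcap Q)_i=P_i\oplus Q_i$ for $i>0$, with the multiplications of $P$ and $Q$ and with all products of a positive-degree element of $P$ and a positive-degree element of $Q$ (in either order) equal to zero. Graded Hochschild cohomology: for a graded $\mathbb{F}_2$-algebra $Q$, a graded $Q$-bimodule $M$ and $s\in\mathbb{Z}$, let $M[s]$ be the graded bimodule with $M[s]_n=M_{n+s}$. Then $\mathrm{HH}^{n,s}(Q,M)$ is the $n$-th cohomology of the cochain complex whose $n$-th term is the space of degree-preserving $\mathbb{F}_2$-linear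 maps $Q^{\otimes n}\to M[s]$ (tensor products over $\mathbb{F}_2$), with differential $$(d f)(a_1\otimes\cdots\otimes a_{n+1})=a_1f(a_2\otimes\cdots\otimes a_{n+1})+\sum_{i=1}^n f(a_1\otimes\cdots\otimes a_ia_{i+1}\otimes\cdots\otimes a_{n+1})+f(a_1\otimes\cdots\otimes a_n)a_{n+1}.$$ *)

(* Defs.v *)
From HB Require Import structures.
From mathcomp Require Import all_boot all_order all_algebra.
From mathcomp Require Import ring.

Set Implicit Arguments.
Unset Strict Implicit.
Unset Printing Implicit Defensive.

Import Order.TTheory GRing.Theory Num.Theory.
Local Open Scope ring_scope.

(** ** Graded vector spaces, algebras and bimodules over F_2 *)

(* A Z-grading M = \bigoplus_i M_i is given by its projections: [gcomp i x] is
   the component of x in M_i.  By [gcomp_sum] every x is the sum of finitely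
   many components; [gcompK] then makes this decomposition unique. *)
Record grading (M : lmodType 'F_2) := Grading {
  gcomp : int -> M -> M;
  gcomp_linear : forall i, linear (gcomp i);
  gcompK : forall i j x, gcomp i (gcomp j x) = if i == j then gcomp j x else 0;
  gcomp_sum : forall x, exists2 s : seq int, uniq s & x = \sum_(i <- s) gcomp i x
}.

HB.instance Definition _ (M : lmodType 'F_2) (G : grading M) (i : int) :=
  GRing.isLinear.Build 'F_2 M M *:%R (gcomp G i) (gcomp_linear G i).

Definition homog (M : lmodType 'F_2) (G : grading M) (i : int) (x : M) : Prop :=
  gcomp G i x = x.

Record gradedAlgebra := GradedAlgebra {
  ga_sort :> algType 'F_2;
  ga_grading : grading ga_sort;
  ga_homog1 : homog ga_grading 0 1;
  ga_homogM : forall i j (x y : ga_sort),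
    homog ga_grading i x -> homog ga_grading j y -> homog ga_grading (i + j) (x * y)
}.

Record gradedBimodule (Q : gradedAlgebra) := GradedBimodule {
  gb_sort :> lmodType 'F_2;
  lact : Q -> gb_sort -> gb_sort;
  ract : gb_sort -> Q -> gb_sort;
  lact_linearl : forall x, linear (lact^~ x);
  lact_linearr : forall a, linear (lact a);
  ract_linearl : forall a, linear (ract^~ a);
  ract_linearr : forall x, linear (ract x);
  lact1 : forall x, lact 1 x = x;
  lactM : forall a b x, lact (a * b) x = lact a (lact b x);
  ract1 : forall x, ract x 1 = x;
  ractM : forall x a b, ract x (a * b) = ract (ract x a) b;
  lractA : forall a x b, ract (lact a x) b = lact a (ract x b);
  gb_grading : grading gb_sort;
  lact_homog : forall i j a x, homog (ga_grading Q) i a ->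
    homog gb_grading j x -> homog gb_grading (i + j) (lact a x);
  ract_homog : forall i j x a, homog gb_grading i x ->
    homog (ga_grading Q) j a -> homog gb_grading (i + j) (ract x a)
}.

Section Shift.
Variables (M : lmodType 'F_2) (G : grading M) (s : int).

Let scomp (n : int) := gcomp G (n + s).

Fact scomp_linear i : linear (scomp i).
Proof. exact: gcomp_linear. Qed.

Fact scompK i j x : scomp i (scomp j x) = if i == j then scomp j x else 0.
Proof. by rewrite /scomp gcompK (inj_eq (addIr s)). Qed.

Fact scomp_sum x : exists2 r : seq int, uniq r & x = \sum_(i <- r) scomp i x.
Proof.
have [r ur xE] := gcomp_sum G x; exists [seq i - s | i <- r].
  by rewrite map_inj_uniq //; apply: addIr.
by rewrite big_map {1}xE; apply: eq_bigr => i _; rewrite /scomp subrK.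
Qed.

Definition shift_grading : grading M := Grading scomp_linear scompK scomp_sum.

End Shift.

Lemma shift_homogE (M : lmodType 'F_2) (G : grading M) (s n : int) (x : M) :
  homog (shift_grading G s) n x = homog G (n + s) x.
Proof. by []. Qed.

Section ShiftBimodule.
Variables (Q : gradedAlgebra) (M : gradedBimodule Q) (s : int).

Fact shift_lact_homog i j (a : Q) (x : M) : homog (ga_grading Q) i a ->
  homog (shift_grading (gb_grading M) s) j x ->
  homog (shift_grading (gb_grading M) s) (i + j) (lact a x).
Proof. by rewrite !shift_homogE -addrA; apply: lact_homog. Qed.

Fact shift_ract_homog i j (x : M) (a : Q) :
  homog (shift_grading (gb_grading M) s) i x -> homog (ga_grading Q) j a ->
  homog (shift_grading (gb_grading M) s) (i + j) (ract x a).
Proof. by rewrite !shift_homogE addrAC; apply: ract_homog. Qed.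

(* The bimodule M[s], with M[s]_n = M_(n + s). *)
Definition shift_bimodule : gradedBimodule Q :=
  GradedBimodule (@lact_linearl _ M) (@lact_linearr _ M) (@ract_linearl _ M)
    (@ract_linearr _ M) (@lact1 _ M) (@lactM _ M) (@ract1 _ M) (@ractM _ M)
    (@lractA _ M) shift_lact_homog shift_ract_homog.

End ShiftBimodule.

Section RegularBimodule.
Variable Q : gradedAlgebra.

Fact regular_linearl (x : Q) : linear (fun a : Q => a * x).
Proof. by move=> c a b; rewrite mulrDl scalerAl. Qed.

Fact regular_linearr (a : Q) : linear (fun x : Q => a * x).
Proof. by move=> c x y; rewrite mulrDr scalerAr. Qed.

Fact regular_ractM (x a b : Q) : x * (a * b) = x * a * b.
Proof. exact: mulrA. Qed.

Fact regular_lactM (a b x : Q) : a * b * x = a * (b * x).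
Proof. by rewrite mulrA. Qed.

Fact regular_lractA (a x b : Q) : a * x * b = a * (x * b).
Proof. by rewrite mulrA. Qed.

Definition regular_bimodule : gradedBimodule Q :=
  @GradedBimodule Q Q *%R *%R regular_linearl regular_linearr
    regular_linearl regular_linearr (@mul1r Q) regular_lactM (@mulr1 Q)
    regular_ractM regular_lractA (ga_grading Q) (@ga_homogM Q) (@ga_homogM Q).

End RegularBimodule.

(** ** Graded Hochschild cohomology *)

Section Hochschild.
Variable Q : gradedAlgebra.

Definition set_arg n (a : {ffun 'I_n -> Q}) (i : 'I_n) (x : Q) : {ffun 'I_n -> Q} :=
  [ffun j => if j == i then x else a j].

(* F_2-linear maps out of the n-fold tensor power of Q are represented, via the
   universal property, by n-ary multilinear maps. *)
Definition multilinear (M : lmodType 'F_2) n (f : {ffun 'I_n -> Q} -> M) : Prop :=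
  forall (a : {ffun 'I_n -> Q}) (i : 'I_n), linear (fun x => f (set_arg a i x)).

(* The degree of a_1 \otimes ... \otimes a_n is the sum of the degrees. *)
Definition degree_preserving (M : gradedBimodule Q) n
    (f : {ffun 'I_n -> Q} -> M) : Prop :=
  forall (e : 'I_n -> int) (a : {ffun 'I_n -> Q}),
    (forall i, homog (ga_grading Q) (e i) (a i)) ->
    homog (gb_grading M) (\sum_i e i) (f a).

Definition cochain (M : gradedBimodule Q) n (f : {ffun 'I_n -> Q} -> M) : Prop :=
  multilinear f /\ degree_preserving f.

Definition drop_first n (a : {ffun 'I_n.+1 -> Q}) : {ffun 'I_n -> Q} :=
  [ffun j => a (lift ord0 j)].

Definition drop_last n (a : {ffun 'I_n.+1 -> Q}) : {ffun 'I_n -> Q} :=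
  [ffun j => a (widen_ord (leqnSn n) j)].

(* The arguments are numbered from 0: this is
   a_0, ..., a_(i-1), a_i * a_(i+1), a_(i+2), ..., a_n. *)
Definition merge_at n (i : 'I_n) (a : {ffun 'I_n.+1 -> Q}) : {ffun 'I_n -> Q} :=
  [ffun j : 'I_n =>
     if (j < i)%N then a (widen_ord (leqnSn n) j)
     else if j == i then a (widen_ord (leqnSn n) j) * a (lift ord0 j)
     else a (lift ord0 j)].

Definition hdiff (M : gradedBimodule Q) n (f : {ffun 'I_n -> Q} -> M) :
    {ffun 'I_n.+1 -> Q} -> M :=
  fun a => lact (a ord0) (f (drop_first a))
           + \sum_(i < n) f (merge_at i a)
           + ract (f (drop_last a)) (a ord_max).

Definition cocycle (M : gradedBimodule Q) n (f : {ffun 'I_n -> Q} -> M) : Prop :=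
  cochain f /\ forall a, hdiff f a = 0.

Definition coboundary (M : gradedBimodule Q) n : ({ffun 'I_n -> Q} -> M) -> Prop :=
  match n with
  | 0 => fun f => forall a, f a = 0
  | n'.+1 => fun f => exists2 g : {ffun 'I_n' -> Q} -> M,
                        cochain g & forall a, f a = hdiff g a
  end.

End Hochschild.

(* HH^{n,s}(Q, M) = 0: every n-cocycle with values in M[s] is a coboundary. *)
Definition HH_vanishes (Q : gradedAlgebra) (M : gradedBimodule Q) (n : nat) (s : int) : Prop :=
  forall f : {ffun 'I_n -> Q} -> shift_bimodule M s, cocycle f -> coboundary f.

(** ** Non-negatively graded algebras P with P_0 = F_2, and connected sums *)

(* [aug x] is the degree 0 component of x, as an element of P_0 = F_2. *)
Record connectedAlgebra := ConnectedAlgebra {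
  ca_alg :> gradedAlgebra;
  aug : ca_alg -> 'F_2;
  gcomp_neg : forall (n : nat) (x : ca_alg), gcomp (ga_grading ca_alg) (Negz n) x = 0;
  gcomp0 : forall x : ca_alg, gcomp (ga_grading ca_alg) 0 x = (aug x)%:A
}.


Lemma gcomp_finite (M : lmodType 'F_2) (G : grading M) (x : M) (s : seq int) :
  uniq s -> x = \sum_(i <- s) gcomp G i x ->
  forall r : seq int, uniq r -> {subset s <= r} -> x = \sum_(i <- r) gcomp G i x.
Proof.
move=> us xE r ur sr.
have z i : i \notin s -> gcomp G i x = 0.
  move=> nis; rewrite xE linear_sum big1_seq //= => j js.
  by rewrite gcompK; case: eqP => // ij; rewrite ij js in nis.
rewrite (bigID (mem s)) /= [X in _ + X]big1 ?addr0; last by move=> i; apply: z.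
rewrite -big_filter {1}xE; apply: perm_big; apply: uniq_perm => //.
  exact: filter_uniq.
by move=> i; rewrite mem_filter; case: (boolP (i \in s)) => // /sr ->.
Qed.

Section ConnectedTheory.
Variable P : connectedAlgebra.

Lemma scale1_inj : injective (fun c : 'F_2 => c%:A : P).
Proof. exact: (fmorph_inj (in_alg P)). Qed.

Fact aug_linear : linear_for *%R (@aug P).
Proof.
by move=> c x y; apply: scale1_inj; rewrite /= -gcomp0 linearP /= !gcomp0 scalerDl scalerA.
Qed.

HB.instance Definition _ := GRing.isLinear.Build 'F_2 P 'F_2 *%R (@aug P) aug_linear.

Lemma aug1 : aug (1 : P) = 1.
Proof. by apply: scale1_inj; rewrite -gcomp0 scale1r; apply: ga_homog1. Qed.

Lemma aug_gcomp (i : int) (x : P) :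
  aug (gcomp (ga_grading P) i x) = if i == 0 then aug x else 0.
Proof.
apply: scale1_inj; rewrite -gcomp0 gcompK eq_sym; case: eqP => [->|_].
  by rewrite gcomp0.
by rewrite scale0r.
Qed.

Lemma homog_gcomp (i : int) (x : P) : homog (ga_grading P) i (gcomp (ga_grading P) i x).
Proof. by rewrite /homog gcompK eqxx. Qed.

Lemma augM (x y : P) : aug (x * y) = aug x * aug y.
Proof.
have [s us xE] := gcomp_sum (ga_grading P) x.
have [r ur yE] := gcomp_sum (ga_grading P) y.
pose t := undup (0 :: s ++ r); have ut : uniq t by apply: undup_uniq.
have t0 : 0 \in t by rewrite mem_undup inE eqxx.
have {us}xE : x = \sum_(i <- t) gcomp (ga_grading P) i x.
  apply: (gcomp_finite us xE) => // i iS.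
  by rewrite mem_undup inE mem_cat iS orbT.
have {ur}yE : y = \sum_(i <- t) gcomp (ga_grading P) i y.
  apply: (gcomp_finite ur yE) => // i iS.
  by rewrite mem_undup inE mem_cat iS !orbT.
have augMg i j : aug (gcomp (ga_grading P) i x * gcomp (ga_grading P) j y) =
    (if i == 0 then aug x else 0) * (if j == 0 then aug y else 0).
  case: i => [i|i]; last by rewrite gcomp_neg !mul0r linear0.
  case: j => [j|j]; last by rewrite gcomp_neg !mulr0 linear0.
  have h := ga_homogM (homog_gcomp i x) (homog_gcomp j y).
  rewrite -[X in aug X]h aug_gcomp.
  case: i {h} => [|i]; case: j => [|j]; rewrite ?mul0r ?mulr0 //=.
  by rewrite !gcomp0 -scalerAl mul1r scalerA linearZ /= aug1 mulr1.
rewrite {1}xE {1}yE mulr_suml linear_sum (bigD1_seq 0) //= [X in _ + X]big1 ?addr0.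
  rewrite mulr_sumr linear_sum (bigD1_seq 0) //= [X in _ + X]big1 ?addr0.
    by rewrite augMg eqxx.
  by move=> j /negPf j0; rewrite augMg j0 mulr0.
move=> i /negPf i0; rewrite mulr_sumr linear_sum big1 // => j _.
by rewrite /= augMg i0 mul0r.
Qed.

End ConnectedTheory.

Section ConnectedSum.
Variables P Q : connectedAlgebra.

Definition connsum_pred : {pred (P * Q)%type} := [pred x | aug x.1 == aug x.2].

Fact connsum_subalg : subalg_closed connsum_pred.
Proof.
split=> [|c x y|x y]; rewrite !inE /=; first by rewrite !aug1.
- by move=> /eqP xE /eqP yE; rewrite !linearP /= xE yE.
- by move=> /eqP xE /eqP yE; rewrite !augM xE yE.
Qed.

HB.instance Definition _ :=
  GRing.isSubalgClosed.Build 'F_2 (P * Q)%type connsum_pred connsum_subalg.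

(* The carrier of the connected sum consists of the pairs (p, q) of elements of
   P and Q with the same component in F_2 = P_0 = Q_0, so that its degree 0 part
   is F_2 and its degree i part is P_i * Q_i for i > 0.  The multiplication is
   componentwise; in particular (p, 0) * (0, q) = 0. *)
Definition connsum_type := {x : (P * Q)%type | x \in connsum_pred}.

HB.instance Definition _ := SubChoice.on connsum_type.
HB.instance Definition _ := [SubChoice_isSubAlgebra of connsum_type by <:].

Fact connsum_comp_subproof (i : int) (x : connsum_type) :
  (gcomp (ga_grading P) i (val x).1, gcomp (ga_grading Q) i (val x).2)
    \in connsum_pred.
Proof. by rewrite inE /= !aug_gcomp (eqP (valP x)). Qed.

Definition connsum_comp (i : int) (x : connsum_type) : connsum_type :=
  Sub (gcomp (ga_grading P) i (val x).1, gcomp (ga_grading Q) i (val x).2)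
      (connsum_comp_subproof i x).

Fact connsum_comp_linear i : linear (connsum_comp i).
Proof. by move=> c x y; apply: val_inj; rewrite /= !linearP. Qed.

Fact connsum_compK i j x :
  connsum_comp i (connsum_comp j x) = if i == j then connsum_comp j x else 0.
Proof. by apply: val_inj; rewrite (fun_if val) /= !gcompK; case: eqP. Qed.

Fact connsum_comp_sum x :
  exists2 s : seq int, uniq s & x = \sum_(i <- s) connsum_comp i x.
Proof.
have [s us xE] := gcomp_sum (ga_grading P) (val x).1.
have [r ur yE] := gcomp_sum (ga_grading Q) (val x).2.
exists (undup (s ++ r)); first exact: undup_uniq.
apply: val_inj; rewrite linear_sum /=.
rewrite [RHS]surjective_pairing !(raddf_sum fst) (raddf_sum snd) /=.
rewrite [LHS]surjective_pairing; congr pair.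
  apply: (gcomp_finite us xE); rewrite ?undup_uniq // => i iS.
  by rewrite mem_undup mem_cat iS.
apply: (gcomp_finite ur yE); rewrite ?undup_uniq // => i iS.
by rewrite mem_undup mem_cat iS orbT.
Qed.

Definition connsum_grading : grading connsum_type :=
  Grading connsum_comp_linear connsum_compK connsum_comp_sum.

Lemma connsum_homogP i (x : connsum_type) : homog connsum_grading i x <->
  homog (ga_grading P) i (val x).1 /\ homog (ga_grading Q) i (val x).2.
Proof.
split; first by move=> h; split; rewrite /homog -[in RHS]h.
move=> [h1 h2]; apply: val_inj; rewrite /= h1 h2.
by rewrite -surjective_pairing.
Qed.

Fact connsum_homog1 : homog connsum_grading 0 1.
Proof. by apply/connsum_homogP; split; apply: ga_homog1. Qed.

Fact connsum_homogM i j (x y : connsum_type) : homog connsum_grading i x ->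
  homog connsum_grading j y -> homog connsum_grading (i + j) (x * y).
Proof.
move=> /connsum_homogP[x1 x2] /connsum_homogP[y1 y2].
by apply/connsum_homogP; split; apply: ga_homogM.
Qed.

Definition connsum_graded : gradedAlgebra :=
  GradedAlgebra connsum_homog1 connsum_homogM.

Fact connsum_neg (n : nat) (x : connsum_graded) :
  gcomp (ga_grading connsum_graded) (Negz n) x = 0.
Proof. by apply: val_inj; rewrite /= !gcomp_neg. Qed.

Fact connsum0 (x : connsum_graded) :
  gcomp (ga_grading connsum_graded) 0 x = (aug (val x).1)%:A.
Proof. by apply: val_inj; rewrite /= !gcomp0 (eqP (valP x)). Qed.

Definition connsum : connectedAlgebra := ConnectedAlgebra connsum_neg connsum0.

End ConnectedSum.

(** ** The Boolean graded algebra B_* *)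

Definition boolean (B : pzSemiRingType) : Prop := forall x : B, x ^+ 2 = x.

Lemma boolean_addxx (B : pzRingType) : boolean B -> forall x : B, x + x = 0.
Proof.
move=> hB x; have := hB (x + x).
rewrite expr2 mulrDl !mulrDr -!expr2 hB => /eqP.
by rewrite -subr_eq0 addrK => /eqP.
Qed.

Section BoolAlgAux.
Variables (R : comNzRingType) (p q r t : R).

Fact mulA_aux (a b c ab bc : nat) :
  p *+ bc = p *+ b *+ c -> r *+ ab = r *+ a *+ b ->
  (r *+ b + q *+ c + q * r * t) *+ a + p *+ bc
    + p * (r *+ b + q *+ c + q * r * t) * t
  = r *+ ab + (q *+ a + p *+ b + p * q * t) *+ c
    + (q *+ a + p *+ b + p * q * t) * r * t.
Proof. by move=> -> ->; ring. Qed.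

Fact mulDl_aux (a b c ab : nat) : r *+ ab = r *+ a + r *+ b ->
  r *+ ab + (p + q) *+ c + (p + q) * r * t
  = r *+ a + p *+ c + p * r * t + (r *+ b + q *+ c + q * r * t).
Proof. by move=> ->; ring. Qed.

Fact scalerAl_aux (a b c ca : nat) : q *+ ca = q *+ c *+ a ->
  (q *+ a + p *+ b + p * q * t) *+ c
  = q *+ ca + p *+ c *+ b + p *+ c * q * t.
Proof. by move=> ->; ring. Qed.

End BoolAlgAux.

(* An element (c, p) stands for the sum of c in B_0 = F_2 and of the
   coefficients p`_n of p, placed in B_(n+1) = B. *)
Definition boolAlg (B : comNzRingType) of boolean B : Type := ('F_2 * {poly B})%type.

Section BoolAlg.
Variables (B : comNzRingType) (hB : boolean B).
Local Notation T := (boolAlg hB).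

HB.instance Definition _ := GRing.Zmodule.copy T ('F_2 * {poly B})%type.

Lemma boolAlg_polyxx (p : {poly B}) : p + p = 0.
Proof. by apply/polyP => i; rewrite coefD coef0 boolean_addxx. Qed.

Lemma F2P (c : 'F_2) : c = 0 \/ c = 1.
Proof. by case: c => [[|[|[]]] // i]; [left|right]; apply: val_inj. Qed.

Definition boolAlg_scale (c : 'F_2) (x : T) : T := (c * x.1, x.2 *+ c).

Definition boolAlg_one : T := (1, 0).

(* The product of p`_i in degree i + 1 and q`_j in degree j + 1 lies in degree
   i + j + 2, hence the factor 'X. *)
Definition boolAlg_mul (x y : T) : T :=
  (x.1 * y.1, y.2 *+ x.1 + x.2 *+ y.1 + x.2 * y.2 * 'X).

Lemma mulrnF2D (p : {poly B}) (c d : 'F_2) : p *+ (c + d)%R = p *+ c + p *+ d.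
Proof.
by case: (F2P c) (F2P d) => -> [] ->; rewrite ?add0r ?addr0 ?mulr0n ?add0r ?addr0 // !mulr1n boolAlg_polyxx.
Qed.

Lemma mulrnF2M (p : {poly B}) (c d : 'F_2) : p *+ (c * d)%R = p *+ c *+ d.
Proof. by case: (F2P c) (F2P d) => -> [] ->; rewrite ?mul0r ?mulr0 ?mul1r ?mul0rn. Qed.

Fact boolAlg_scalerA c d x :
  boolAlg_scale c (boolAlg_scale d x) = boolAlg_scale (c * d) x.
Proof.
congr pair; first exact: mulrA.
by rewrite [c * d]mulrC; apply/esym/mulrnF2M.
Qed.

Fact boolAlg_scale1r : left_id 1 boolAlg_scale.
Proof. by move=> [c p]; congr pair; rewrite /= ?mul1r. Qed.

Fact boolAlg_scalerDr : right_distributive boolAlg_scale +%R.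
Proof. by move=> c x y; congr pair; rewrite /= ?mulrDr // mulrnDl. Qed.

Fact boolAlg_scalerDl x : {morph boolAlg_scale^~ x : c d / c + d}.
Proof. by move=> c d; congr pair; rewrite /= ?mulrDl // mulrnF2D. Qed.

HB.instance Definition _ := GRing.Zmodule_isLmodule.Build 'F_2 T
  boolAlg_scalerA boolAlg_scale1r boolAlg_scalerDr boolAlg_scalerDl.

Fact boolAlg_mulC : commutative boolAlg_mul.
Proof.
by move=> x y; congr pair; rewrite /= ?[x.1 * _]mulrC // [x.2 * _]mulrC [y.2 *+ _ + _]addrC.
Qed.

Fact boolAlg_mulA : associative boolAlg_mul.
Proof.
move=> [a p] [b q] [c r]; congr pair; first exact: mulrA.
by apply: mulA_aux; apply: mulrnF2M.
Qed.

Fact boolAlg_mul1l : left_id boolAlg_one boolAlg_mul.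
Proof. by move=> [c p]; congr pair; rewrite /= ?mul1r // mul0rn !mul0r !addr0. Qed.

Fact boolAlg_mulDl : left_distributive boolAlg_mul +%R.
Proof.
move=> [a p] [b q] [c r]; congr pair; first exact: mulrDl.
by apply: mulDl_aux; apply: mulrnF2D.
Qed.

Fact boolAlg_one_neq0 : boolAlg_one != 0.
Proof. by []. Qed.

HB.instance Definition _ := GRing.Zmodule_isComNzRing.Build T
  boolAlg_mulA boolAlg_mulC boolAlg_mul1l boolAlg_mulDl boolAlg_one_neq0.

Fact boolAlg_scalerAl (c : 'F_2) (x y : T) : c *: (x * y) = (c *: x) * y.
Proof.
case: x y => [a p] [b q]; congr pair; first exact: mulrA.
by apply: scalerAl_aux; apply: mulrnF2M.
Qed.

HB.instance Definition _ := GRing.Lmodule_isLalgebra.Build 'F_2 T boolAlg_scalerAl.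
HB.instance Definition _ := GRing.Lalgebra_isComAlgebra.Build 'F_2 T.

Definition boolAlg_comp (i : int) (x : T) : T :=
  match i with
  | Posz 0 => (x.1, 0)
  | Posz n.+1 => (0, x.2`_n *: 'X^n)
  | Negz _ => 0
  end.

Fact boolAlg_comp_linear i : linear (boolAlg_comp i).
Proof.
move=> c x y; case: i => [[|n]|n] /=; last by rewrite scaler0 addr0.
- by congr pair; rewrite /= mul0rn addr0.
- by congr pair; rewrite /= ?mulr0 ?addr0 // coefD coefMn scalerDl scalerMnl.
Qed.

Fact boolAlg_compK i j x :
  boolAlg_comp i (boolAlg_comp j x) = if i == j then boolAlg_comp j x else 0.
Proof.
case: i j => [[|i]|i] [[|j]|j] //=; try by rewrite ?coef0 ?scale0r //; case: ifP.
rewrite coefZ coefXn eqz_nat eqSS; case: eqP => [->|_]; first by rewrite mulr1.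
by rewrite mulr0 scale0r.
Qed.

Fact boolAlg_comp_sum x :
  exists2 s : seq int, uniq s & x = \sum_(i <- s) boolAlg_comp i x.
Proof.
exists (map Posz (iota 0 (size x.2).+1)).
  by rewrite map_inj_uniq ?iota_uniq // => i j [].
rewrite big_map /= big_cons (iotaDl 1 0) big_map /=.
have sumE (s : seq nat) : \sum_(i <- s) boolAlg_comp (1 + i)%N x =
    ((0, \sum_(i <- s) x.2`_i *: 'X^i) : T).
  elim: s => [|i s IHs]; first by rewrite !big_nil.
  by rewrite !big_cons IHs; congr pair; rewrite /= addr0.
rewrite sumE -[size _]subn0 -/(index_iota 0 _) big_mkord -poly_def coefK.
by case: x {sumE} => c p; congr pair; rewrite /= ?addr0 ?add0r.
Qed.

Definition boolAlg_grading : grading T :=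
  Grading boolAlg_comp_linear boolAlg_compK boolAlg_comp_sum.

Fact boolAlg_homog1 : homog boolAlg_grading 0 1.
Proof. by []. Qed.

Fact boolAlg_homogM i j (x y : T) : homog boolAlg_grading i x ->
  homog boolAlg_grading j y -> homog boolAlg_grading (i + j) (x * y).
Proof.
rewrite /homog.
case: i => [[|i]|i] <-; last by rewrite mul0r linear0.
all: case: j => [[|j]|j] <-; last by rewrite mulr0 linear0.
- by congr pair; rewrite /= !mul0rn mul0r mul0r !addr0.
- congr pair; rewrite /= ?mulr0 // mulr0n mul0r mul0r !addr0.
  by rewrite coefMn coefZ coefXn eqxx mulr1 scalerMnl.
- rewrite addr0; congr pair; rewrite /= ?mul0r // mulr0n mulr0 mul0r addr0 add0r.
  by rewrite coefMn coefZ coefXn eqxx mulr1 scalerMnl.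
- rewrite -PoszD addSn addnS; congr pair; rewrite /= ?mul0r //.
  rewrite !mulr0n !add0r -scalerAl -scalerAr scalerA -exprD -scalerAl -exprSr.
  by rewrite coefZ coefXn eqxx mulr1.
Qed.

Definition boolAlg_graded : gradedAlgebra :=
  GradedAlgebra boolAlg_homog1 boolAlg_homogM.

Fact boolAlg_neg (n : nat) (x : boolAlg_graded) :
  gcomp (ga_grading boolAlg_graded) (Negz n) x = 0.
Proof. by []. Qed.

Fact boolAlg0 (x : boolAlg_graded) :
  gcomp (ga_grading boolAlg_graded) 0 x = x.1%:A.
Proof. by congr pair; rewrite /= ?mulr1 // mul0rn. Qed.

Definition boolean_algebra : connectedAlgebra := ConnectedAlgebra boolAlg_neg boolAlg0.

End BoolAlg.

(** ** The dual algebra V_* *)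

(* An element (c, v) stands for the sum of c in V_0 = F_2 and v in V_1 = V. *)
Definition dualAlg (V : lmodType 'F_2) : Type := ('F_2 * V)%type.

Section DualAlg.
Variable V : lmodType 'F_2.
Local Notation T := (dualAlg V).

HB.instance Definition _ := GRing.Lmodule.copy T (('F_2)^o * V)%type.

Definition dualAlg_one : T := (1, 0).

Definition dualAlg_mul (x y : T) : T := (x.1 * y.1, x.1 *: y.2 + y.1 *: x.2).

Fact dualAlg_mulC : commutative dualAlg_mul.
Proof. by move=> x y; congr pair; rewrite /= ?[x.1 * _]mulrC // addrC. Qed.

Fact dualAlg_mulA : associative dualAlg_mul.
Proof.
move=> x y z; congr pair; rewrite /= ?mulrA // !scalerDr !scalerA addrA.
by rewrite [z.1 * x.1]mulrC [z.1 * y.1]mulrC.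
Qed.

Fact dualAlg_mul1l : left_id dualAlg_one dualAlg_mul.
Proof. by move=> [c v]; congr pair; rewrite /= ?mul1r // scale1r scaler0 addr0. Qed.

Fact dualAlg_mulDl : left_distributive dualAlg_mul +%R.
Proof. by move=> x y z; congr pair; rewrite /= ?mulrDl // scalerDl scalerDr addrACA. Qed.

Fact dualAlg_one_neq0 : dualAlg_one != 0.
Proof. by []. Qed.

HB.instance Definition _ := GRing.Zmodule_isComNzRing.Build T
  dualAlg_mulA dualAlg_mulC dualAlg_mul1l dualAlg_mulDl dualAlg_one_neq0.

Fact dualAlg_scalerAl (c : 'F_2) (x y : T) : c *: (x * y) = (c *: x) * y.
Proof.
congr pair; rewrite /= ?[LHS]mulrA // scalerDr !scalerA.
by rewrite [c * y.1]mulrC.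
Qed.

HB.instance Definition _ := GRing.Lmodule_isLalgebra.Build 'F_2 T dualAlg_scalerAl.
HB.instance Definition _ := GRing.Lalgebra_isComAlgebra.Build 'F_2 T.

Definition dualAlg_comp (i : int) (x : T) : T :=
  match i with
  | Posz 0 => (x.1, 0)
  | Posz 1 => (0, x.2)
  | _ => 0
  end.

Fact dualAlg_comp_linear i : linear (dualAlg_comp i).
Proof.
move=> c x y; case: i => [[|[|n]]|n] /=; try by rewrite scaler0 addr0.
- by congr pair; rewrite /= scaler0 addr0.
- by congr pair; rewrite /= scaler0 addr0.
Qed.

Fact dualAlg_compK i j x :
  dualAlg_comp i (dualAlg_comp j x) = if i == j then dualAlg_comp j x else 0.
Proof. by case: i j => [[|[|i]]|i] [[|[|j]]|j] //=; case: ifP. Qed.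

Fact dualAlg_comp_sum x :
  exists2 s : seq int, uniq s & x = \sum_(i <- s) dualAlg_comp i x.
Proof.
exists [:: 0; 1] => //; rewrite !big_cons big_nil addr0; case: x => c v.
by congr pair; rewrite /= ?addr0 ?add0r.
Qed.

Definition dualAlg_grading : grading T :=
  Grading dualAlg_comp_linear dualAlg_compK dualAlg_comp_sum.

Fact dualAlg_homog1 : homog dualAlg_grading 0 1.
Proof. by []. Qed.

Fact dualAlg_homogM i j (x y : T) : homog dualAlg_grading i x ->
  homog dualAlg_grading j y -> homog dualAlg_grading (i + j) (x * y).
Proof.
rewrite /homog.
case: i => [[|[|i]]|i] <-; try by rewrite mul0r linear0.
all: case: j => [[|[|j]]|j] <-; try by rewrite mulr0 linear0.
- by congr pair; rewrite /= !scaler0 addr0.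
- by congr pair; rewrite /= ?mulr0 // scaler0 addr0.
- by congr pair; rewrite /= ?mul0r // scaler0 add0r.
- by congr pair; rewrite /= ?mul0r // !scale0r addr0.
Qed.

Definition dualAlg_graded : gradedAlgebra :=
  GradedAlgebra dualAlg_homog1 dualAlg_homogM.

Fact dualAlg_neg (n : nat) (x : dualAlg_graded) :
  gcomp (ga_grading dualAlg_graded) (Negz n) x = 0.
Proof. by []. Qed.

Fact dualAlg0 (x : dualAlg_graded) :
  gcomp (ga_grading dualAlg_graded) 0 x = x.1%:A.
Proof. by congr pair; rewrite /= ?scaler0 // [RHS]mulr1. Qed.

Definition dual_algebra : connectedAlgebra := ConnectedAlgebra dualAlg_neg dualAlg0.

End DualAlg.

(* Main.v *)
Require Import Defs.
From HB Require Import structures.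
From mathcomp Require Import all_boot all_order all_algebra.
From mathcomp Require Import boolp classical_sets functions.
From mathcomp Require Import ring zify.

Set Implicit Arguments.
Unset Strict Implicit.
Unset Printing Implicit Defensive.
Import GRing.Theory.
Local Open Scope ring_scope.

(* Write A for the connected sum, R for its augmentation ideal and t for the
   unit of B placed in degree 1.  By commutativity, a k-cochain with values in
   A[m] is the same as an A-bilinear function F of two outer coefficients and k
   inner arguments, and its differential is the sum of all merges of adjacent
   entries.  Up to coboundaries F vanishes when an inner argument is 1.

   If k + m <= 0: moving powers of t to the left gives homotopies after which F
   vanishes on adjacent inner arguments t, t x with x in B[t].  Powers of t can
   then be carried to the coefficients, so F is determined by its values on
   A_1^k (A is Koszul), and these lie in degree k + m.  In degree 0 they are
   scalars; inserting e in B outside {0, 1, w, 1 + w}, which exists as |B| > 4,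
   into the cocycle equation shows that they are 0.

   If k + m >= 2, then k >= 3.  Put t = 1: F becomes a cocycle of R with values
   in a B-module M, and such cocycles are coboundaries when k >= 2.  Indeed, the
   atoms e of a finite Boolean subalgebra give a contraction
   s |-> \sum_e e F(e, s) valid for first arguments in that subalgebra.  A limit
   over all finite subalgebras exists only in the double dual of M; modulo M it
   is a cocycle of one degree less, and induction applies, starting from the
   fact that a derivation R -> N into a B-module is deg times a constant.  A
   primitive over t = 1 is finally made homogeneous. *)

(** * Sums of merges *)

(** Keeping the outer coefficients in the argument list turns both actions into merges, so a
    homotopy may carry powers of t into a coefficient just as into an argument. The excluded case k
    + m = 1 differs as follows. On A_1^k a cochain takes values in A_(k+m). For k + m <= 0 these are
    at most scalars. For k + m >= 2 they lie in B t^(k+m), so nothing is lost at t = 1, and a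
    primitive, whose values on A_1^(k-1) have degree k + m - 1 >= 1, has all of B at its disposal.
    For k + m = 1 the values may have a component in V, and a primitive would have to be
    scalar-valued on A_1^(k-1). For k + m >= 2 the obstacle is that B may be infinite. The
    contraction works only while [ev] of the first argument stays in a given finite subalgebra; the
    limit over these subalgebras is taken of elements of F_2, hence after pairing with functionals,
    and this is what produces the double dual. Its quotient by M is just another B-module, so the
    induction runs over all B-modules at once, although only M = B is used in the end. *)

Section Merges.
Variables (T : Type) (mul : T -> T -> T) (W : zmodType).
Implicit Types (F G : seq T -> W) (s p : seq T).

(** The bar differential, without signs because every target in use has characteristic 2. *)
Fixpoint mid F s : W :=
  match s with
  | x :: (y :: s') as r => F (mul x y :: s') + mid (fun q => F (x :: q)) r
  | _ => 0
  end.

Lemma mid_cons F x y s :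
  mid F (x :: y :: s) = F (mul x y :: s) + mid (fun q => F (x :: q)) (y :: s).
Proof. reflexivity. Qed.

(** Two neighbours lie either both in [rcons p x] or both in [x :: s], so cutting at an entry sorts
    the merges. *)
Lemma mid_cat F p x s :
  mid F (p ++ x :: s) =
  mid (fun q => F (q ++ s)) (rcons p x) + mid (fun q => F (p ++ q)) (x :: s).
Proof.
elim: p F => [|a p IHp] F; first by rewrite add0r.
case: p IHp => [|b p] IHp; first by rewrite cat1s mid_cons [mid _ (rcons _ _)]/= addr0.
rewrite !cat_cons mid_cons -cat_cons (IHp (fun q => F (a :: q))) addrA !rcons_cons [in RHS]mid_cons.
by congr (_ + _ + _); rewrite -rcons_cons cat_rcons.
Qed.

Lemma mid_rcons F s y z :
  mid F (rcons (rcons s y) z) =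
  mid (fun q => F (rcons q z)) (rcons s y) + F (rcons s (mul y z)).
Proof.
rewrite -(cats1 (rcons s y)) cat_rcons mid_cat /= addr0 cats1.
by congr (mid _ _ + _); apply/funext => q; rewrite cats1.
Qed.

(** Cutting at [a] and at [x] isolates the two merges that involve [b]. *)
Lemma mid_expand F p a b x s :
  mid F (p ++ a :: b :: x :: s) =
  mid (fun q => F (q ++ b :: x :: s)) (rcons p a)
  + F (p ++ mul a b :: x :: s) + F (p ++ a :: mul b x :: s)
  + mid (fun q => F (p ++ a :: b :: q)) (x :: s).
Proof. by rewrite mid_cat !mid_cons !addrA. Qed.

Lemma eq_mid F G s : (forall q, (size q).+1 = size s -> F q = G q) -> mid F s = mid G s.
Proof.
elim: s F G => [|x [|y s] IHs] F G FG //; rewrite !mid_cons FG //.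
congr (_ + _); apply: IHs => q sq; by apply: FG; rewrite /= sq.
Qed.

Lemma mid0 s : mid (fun=> 0) s = 0.
Proof. by elim: s => [|x [|y s] IHs] //; rewrite mid_cons IHs addr0. Qed.

Lemma mid_eq0 F s : (forall q, (size q).+1 = size s -> F q = 0) -> mid F s = 0.
Proof. by move=> F0; rewrite -(mid0 s); apply: eq_mid. Qed.

Lemma midD F G s : mid (fun q => F q + G q) s = mid F s + mid G s.
Proof.
elim: s F G => [|x [|y s] IHs] F G; rewrite ?addr0 //.
by rewrite !mid_cons IHs addrACA.
Qed.

Lemma midN F s : mid (fun q => - F q) s = - mid F s.
Proof.
elim: s F => [|x [|y s] IHs] F; rewrite ?oppr0 //.
by rewrite !mid_cons IHs opprD.
Qed.

Lemma midB F G s : mid (fun q => F q - G q) s = mid F s - mid G s.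
Proof. by rewrite midD midN. Qed.

Lemma mid_sum (I : Type) (r : seq I) (F : I -> seq T -> W) s :
  mid (fun q => \sum_(i <- r) F i q) s = \sum_(i <- r) mid (F i) s.
Proof.
elim: r => [|i r IHr]; first by rewrite big_nil; apply: mid_eq0 => q; rewrite big_nil.
by rewrite big_cons -IHr -midD; apply: eq_mid => q; rewrite big_cons.
Qed.

(** This is d d = 0: disjoint merges occur in both orders, overlapping ones agree by associativity,
    and in characteristic 2 all terms cancel in pairs. *)
Lemma mid_mid F s : associative mul -> (forall w : W, w + w = 0) -> mid (mid F) s = 0.
Proof.
move=> mulA W2; elim: s F => [|x [|y [|z s]] IHs] F //; first by rewrite /= !addr0.
rewrite mid_cons.
have -> : mid (fun q => mid F (x :: q)) (y :: z :: s) =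
    mid (fun q => F (if q is u :: q' then mul x u :: q' else [::])) (y :: z :: s)
    + mid (mid (fun q => F (x :: q))) (y :: z :: s).
  by rewrite -midD; apply: eq_mid => -[|u q].
by rewrite IHs addr0 !mid_cons mulA addrACA W2 add0r W2.
Qed.

End Merges.

Lemma mid_morph (T : Type) (mul : T -> T -> T) (W W' : zmodType) (h : W -> W')
    (F : seq T -> W) s : {morph h : x y / x + y} ->
  h (mid mul F s) = mid mul (fun q => h (F q)) s.
Proof.
move=> hD; have h0 : h 0 = 0.
  by apply: (addrI (h 0)); rewrite -hD !addr0.
by elim: s F => [|x [|y s] IHs] F //; rewrite !mid_cons hD IHs.
Qed.

(** * Functions additive in each of n arguments *)

Section Multiadditive.
Variables (T W : zmodType) (mul : T -> T -> T).
Implicit Types (F G : seq T -> W) (s p : seq T).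

Definition multiadd n F := forall p x y s, (size p + (size s).+1)%N = n ->
  F (p ++ (x + y) :: s) = F (p ++ x :: s) + F (p ++ y :: s).

Lemma multiadd_cons n F x : multiadd n.+1 F -> multiadd n (fun q => F (x :: q)).
Proof. by move=> aF p y z s ns; rewrite -cat_cons aF // addSn ns. Qed.

Lemma multiadd0 n F p s : multiadd n F -> (size p + (size s).+1)%N = n ->
  F (p ++ 0 :: s) = 0.
Proof.
by move=> aF ns; apply: (addrI (F (p ++ 0 :: s))); rewrite -aF // !addr0.
Qed.

Lemma multiadd_sum (I : Type) (r : seq I) (P : pred I) (E : I -> T) n F p s :
  multiadd n F -> (size p + (size s).+1)%N = n ->
  F (p ++ (\sum_(i <- r | P i) E i) :: s) = \sum_(i <- r | P i) F (p ++ E i :: s).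
Proof.
move=> aF ns; apply: (big_morph (fun x => F (p ++ x :: s))) => [x y|].
  exact: aF.
exact: multiadd0 ns.
Qed.

Lemma multiaddD n F G : multiadd n F -> multiadd n G -> multiadd n (fun s => F s + G s).
Proof. by move=> aF aG p x y s ns; rewrite aF // aG // addrACA. Qed.

Lemma multiaddB n F G : multiadd n F -> multiadd n G -> multiadd n (fun s => F s - G s).
Proof. by move=> aF aG p x y s ns; rewrite aF // aG // opprD addrACA. Qed.

Hypotheses (mulDl : left_distributive mul +%R) (mulDr : right_distributive mul +%R).

Lemma multiadd_mid n F : multiadd n F -> multiadd n.+1 (mid mul F).
Proof.
move=> aF p x y s; elim: p n F aF => [|a p IHp] n F aF.
  case: s => [|z s] [ns]; first by rewrite /= addr0.
  rewrite !cat0s !mid_cons !mulDl (aF [::]) // addrACA -midD; congr (_ + _).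
  by apply: eq_mid => q [sq]; rewrite (aF [::]) //= sq.
case: p IHp => [|b p] IHp; move=> [ns].
  rewrite !cat1s !mid_cons mulDr (aF [::]) // addrACA; congr (_ + _).
  case: n aF ns => // n aF ns.
  exact: (IHp n (fun q => F (a :: q)) (multiadd_cons a aF) ns).
rewrite !cat_cons !mid_cons -!cat_cons aF // addrACA; congr (_ + _).
case: n aF ns => // n aF ns.
exact: (IHp n (fun q => F (a :: q)) (multiadd_cons a aF) ns).
Qed.

End Multiadditive.

(** * Double duals of modules over a Boolean ring *)

(** A Zorn-maximal subgroup C meeting U only in 0 is a complement of U, and [r] is the projection
    onto C along U. *)
Lemma boolean_complement (W : zmodType) (U : W -> Prop) :
  (forall w : W, w + w = 0) -> U 0 -> (forall x y, U x -> U y -> U (x + y)) ->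
  exists r : W -> W, [/\ {morph r : x y / x + y}, forall x, r (r x) = r x
    & forall x, r x = 0 <-> U x].
Proof.
move=> W2 U0 UD.
have WN (w : W) : - w = w by apply: (addrI w); rewrite subrr W2.
(* The union of the empty chain has to satisfy [P], so [P] cannot ask for 0 in C; hence the
   alternatives [C c \/ c = 0] below. *)
pose P (C : set W) := (forall x y, C x -> C y -> C (x + y)) /\ (forall x, C x -> U x -> x = 0).
have [|C [[CD CU] Cmax]] := @Zorn_bigcup W P.
  move=> F FP Ftot; split=> [x y [X FX Xx] [Y FY Yy]|x [X FX Xx]]; last exact: (FP X FX).2.
  have [XY|YX] := Ftot _ _ FX FY.
    by exists Y => //; apply: (FP Y FY).1 => //; apply: XY.
  by exists X => //; apply: (FP X FX).1 => //; apply: YX.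
have dec w : exists c, (C c \/ c = 0) /\ U (w + c).
  apply: contrapT => nw.
  (* If [w] were outside U + C, adjoining it to C would contradict maximality. *)
  pose C' := [set y | (exists2 c, C c \/ c = 0 & y = c \/ y = c + w)]%classic.
  have CD0 c c' : C c \/ c = 0 -> C c' \/ c' = 0 -> C (c + c') \/ c + c' = 0.
    by move=> [Cc|->] [Cc'|->]; rewrite ?add0r ?addr0; auto.
  apply: (Cmax C').
    split=> [c Cc|CC]; first by exists c; left.
    apply: nw; exists w; rewrite W2; split=> //; left; apply: CC.
    by exists 0; right; rewrite ?add0r.
  split=> [x y [c Cc xE] [c' Cc' yE]|x [c Cc xE] Ux].
    exists (c + c'); first exact: CD0.
    case: xE yE => -> [] ->; rewrite ?(addrAC c w) ?addrA; auto.
    by rewrite -addrA W2 addr0; left.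
  case: xE => xE; last by case: nw; exists c; rewrite addrC -xE.
  by move: Ux; rewrite xE; case: Cc => [Cc|->] //; apply: CU.
have [r rP] := choice dec.
have rE x c : C c \/ c = 0 -> U (x + c) -> r x = c.
  move=> Cc Uc; have [Cr Ur] := rP x.
  have rcU : U (r x + c) by have := UD _ _ Ur Uc; rewrite addrACA W2 add0r.
  apply/eqP; rewrite -subr_eq0 WN; apply/eqP.
  case: Cr Cc rcU => [Cr|->] [Cc|->]; rewrite ?add0r ?addr0 // => ?; by apply: CU; auto.
exists r; split=> [x y|x|x].
- have [Cx Ux] := rP x; have [Cy Uy] := rP y; apply: rE.
    by case: Cx => [Cx|->]; case: Cy => [Cy|->]; rewrite ?add0r ?addr0; auto.
  by rewrite addrACA; apply: UD.
- by apply: rE; rewrite ?W2 //; have [] := rP x.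
- by split=> [x0|Ux]; [have [_] := rP x; rewrite x0 addr0 | apply: rE; rewrite ?addr0; auto].
Qed.

(** The projection [r] kills U but not [w]. The projection [s] obtained from the subgroup {0, r w}
    has exactly that kernel, so z + s z is always 0 or r w; for z = r x this is the coefficient to
    read off. *)
Lemma boolean_separation (W : zmodType) (U : W -> Prop) (w : W) :
  (forall x : W, x + x = 0) -> U 0 -> (forall x y, U x -> U y -> U (x + y)) -> ~ U w ->
  exists l : W -> 'F_2, [/\ {morph l : x y / x + y}, forall u, U u -> l u = 0 & l w = 1].
Proof.
move=> W2 U0 UD Uw; have [r [rD rr rU]] := boolean_complement W2 U0 UD.
have WN (x : W) : - x = x by apply: (addrI x); rewrite subrr W2.
have rw0 : r w != 0 by apply/eqP => /rU.
have [||s [sD ss sU]] := @boolean_complement W (fun x => x = 0 \/ x = r w) W2.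
- by left.
- by move=> x y [->|->] [->|->]; rewrite ?add0r ?addr0 ?W2; auto.
pose y x := r x + s (r x).
have yD : {morph y : a b / a + b} by move=> a b; rewrite /y rD sD addrACA.
have yE x : y x = 0 \/ y x = r w by apply/sU; rewrite /y sD ss W2.
exists (fun x => (y x == r w)%:R); split=> [a b|u /rU ru|].
- rewrite yD; case: (yE a) (yE b) => -> [] ->; rewrite ?add0r ?addr0 ?W2 ?eqxx //=.
  + by rewrite eq_sym (negPf rw0) addr0.
  + by rewrite eq_sym (negPf rw0) add0r.
  + by rewrite eq_sym (negPf rw0) addr0.
  + by rewrite eq_sym (negPf rw0); apply: val_inj.
- have -> : y u = 0 by rewrite /y ru add0r; apply/sU; left.
  by rewrite (_ : (0 == r w) = false) //; apply/negbTE; rewrite eq_sym.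
- have -> : y w = r w by rewrite /y (sU (r w)).2 ?addr0 //; right.
  by rewrite eqxx.
Qed.

Section Dual.
Variable M : zmodType.

Definition additive_pred : {pred M -> 'F_2} := fun l => `[< {morph l : x y / x + y} >].

Fact additive_zmod_closed : zmod_closed additive_pred.
Proof.
split=> [|l l' /asboolP lD /asboolP lD']; apply/asboolP => x y.
  by rewrite /= addr0.
by rewrite -[_ (x + y)]/(l (x + y) - l' (x + y)) lD lD' opprD addrACA.
Qed.

HB.instance Definition _ := GRing.isZmodClosed.Build (M -> 'F_2) additive_pred additive_zmod_closed.

Definition dual := {l : M -> 'F_2 | l \in additive_pred}.
HB.instance Definition _ := SubChoice.on dual.
HB.instance Definition _ := [SubChoice_isSubZmodule of dual by <:].

Lemma dualD (l : dual) : {morph val l : x y / x + y}.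
Proof. by apply/asboolP; apply: (valP l). Qed.

Definition Dual (l : M -> 'F_2) (lD : {morph l : x y / x + y}) : dual :=
  exist _ l (asboolT lD).

Lemma dualP (l l' : dual) : (forall x, val l x = val l' x) -> l = l'.
Proof. by move=> ll'; apply: val_inj; apply/funext. Qed.

End Dual.

Section BDual.
Variables (B : comNzRingType) (M : lmodType B).

Definition bdual : Type := dual M.
HB.instance Definition _ := GRing.Zmodule.on bdual.

Definition bdual_scale (b : B) (l : bdual) : bdual :=
  @Dual M (fun x => val l (b *: x)) (fun x y => etrans (congr1 (val l) (scalerDr b x y)) (dualD l _ _)).

Fact bdual_scaleA a b l : bdual_scale a (bdual_scale b l) = bdual_scale (a * b) l.
Proof. by apply: dualP => x; rewrite /= scalerA mulrC. Qed.
Fact bdual_scale1 : left_id 1 bdual_scale.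
Proof. by move=> l; apply: dualP => x; rewrite /= scale1r. Qed.
Fact bdual_scaleDr : right_distributive bdual_scale +%R.
Proof. by move=> a l l'; apply: dualP. Qed.
Fact bdual_scaleDl l : {morph bdual_scale^~ l : a b / a + b}.
Proof. by move=> a b; apply: dualP => x; rewrite /= scalerDl dualD. Qed.

HB.instance Definition _ := GRing.Zmodule_isLmodule.Build B bdual
  bdual_scaleA bdual_scale1 bdual_scaleDr bdual_scaleDl.

End BDual.

Definition bidual (B : comNzRingType) (M : lmodType B) (x : M) : bdual (bdual M) :=
  @Dual (bdual M) (fun l => val l x) (fun l l' => erefl).

Lemma bidualD (B : comNzRingType) (M : lmodType B) : {morph @bidual B M : x y / x + y}.
Proof. by move=> x y; apply: dualP => l; rewrite /= dualD. Qed.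

Lemma bidualZ (B : comNzRingType) (M : lmodType B) b (x : M) : bidual (b *: x) = b *: bidual x.
Proof. by apply: dualP. Qed.

Lemma bidual_inj (B : comNzRingType) (M : lmodType B) : (forall x : M, x + x = 0) ->
  injective (@bidual B M).
Proof.
move=> M2 x y xy; apply: contrapT => nxy.
have [|||l [lD l0 l1]] := @boolean_separation M (fun z => z = 0) (x + y) M2.
- by [].
- by move=> _ _ -> ->; rewrite addr0.
- by move=> xy0; apply: nxy; apply: (addIr y); rewrite M2.
have := congr1 (fun m : bdual (bdual M) => val m (Dual lD)) xy.
rewrite /= => lxy; move: l1; rewrite lD lxy.
by case: (F2P (l y)) => ->; rewrite ?addr0.
Qed.

(** * Cohomology of the augmentation ideal with coefficients in a B-module *)

Section AugmentationIdeal.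
Variables (B : comNzRingType) (hB : boolean B) (V : zmodType).

(* (p, v) stands for t p + v: the coefficient of 'X^i in p has degree i + 1. *)
Definition aideal : Type := ({poly B} * V)%type.
HB.instance Definition _ := GRing.Zmodule.copy aideal ({poly B} * V)%type.
Local Notation R := aideal.

(** The factor 'X is the second of the two factors t left out of the arguments; V multiplies to 0
    with everything. *)
Definition rmul (x y : R) : R := (x.1 * y.1 * 'X, 0).
Definition tR : R := (1, 0).

Lemma rmulA : associative rmul.
Proof. by move=> x y z; rewrite /rmul /=; congr pair; ring. Qed.

Lemma rmulDl : left_distributive rmul +%R.
Proof. by move=> x y z; congr pair; rewrite /= ?mulrDl ?addr0. Qed.

Lemma rmulDr : right_distributive rmul +%R.
Proof. by move=> x y z; congr pair; rewrite /= ?mulrDr ?mulrDl ?addr0. Qed.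

Definition ev (x : R) : B := x.1.[1].

Lemma evD : {morph ev : x y / x + y}.
Proof. by move=> x y; rewrite /ev hornerD. Qed.

Lemma evM x y : ev (rmul x y) = ev x * ev y.
Proof. by rewrite /ev /= !hornerE. Qed.

Lemma ev_t : ev tR = 1.
Proof. by rewrite /ev hornerE. Qed.

Lemma boolean_scale2 (M : lmodType B) (x : M) : x + x = 0.
Proof. by rewrite -[x]scale1r -scalerDl boolean_addxx // scale0r. Qed.

Section Hochschild.
Variable M : lmodType B.
Implicit Types (F G : seq R -> M) (s : seq R) (x y z : R).

Local Notation rmid := (@mid R rmul M).

(* The ideal acts on B-modules through ev: V acts by 0 and t by 1. *)
Definition hd F s : M :=
  if s is x :: s' then ev x *: F s' + rmid F s + ev (last x s') *: F (belast x s')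
  else 0.

Let lpart F s := if s is x :: s' then ev x *: F s' else 0.
Let rpart F s := if s is x :: s' then ev (last x s') *: F (belast x s') else 0.

Let hdE F : hd F = fun s => lpart F s + rmid F s + rpart F s.
Proof. by apply/funext => -[|x s] //=; rewrite !addr0. Qed.

Let rpart_rcons F s z : rpart F (rcons s z) = ev z *: F s.
Proof. by case: s => [|x s] //=; rewrite last_rcons belast_rcons. Qed.

Lemma hdD F G s : hd (fun q => F q + G q) s = hd F s + hd G s.
Proof.
case: s => [|x s]; first by rewrite /= addr0.
by rewrite /hd midD !scalerDr (AC (2*2*2) ((1*3*5)*(2*4*6))).
Qed.

Lemma hdN F s : hd (fun q => - F q) s = - hd F s.
Proof.
case: s => [|x s]; first by rewrite /= oppr0.
by rewrite /hd midN !scalerN !opprD.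
Qed.

Lemma hdB F G s : hd (fun q => F q - G q) s = hd F s - hd G s.
Proof. by rewrite hdD hdN. Qed.

Lemma hd_cons F x y s : hd F (x :: y :: s) =
  ev x *: F (y :: s) + F (rmul x y :: s) + rmid (fun q => F (x :: q)) (y :: s)
  + ev (last y s) *: F (x :: belast y s).
Proof. by rewrite /hd mid_cons !addrA. Qed.

(** Double merges cancel by [mid_mid]. On each side the double action cancels against the terms
    mixing that action with merges, because [ev] is multiplicative, and the actions on the two sides
    commute. *)
Lemma hd_hd F s : (1 < size s)%N -> hd (hd F) s = 0.
Proof.
move=> s1; rewrite !hdE !midD.
have M2 := @boolean_scale2 M.
have lD : lpart (fun q => lpart F q + rmid F q + rpart F q) s =
    lpart (lpart F) s + lpart (rmid F) s + lpart (rpart F) s.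
  by case: s {s1} => [|x s]; rewrite /= ?addr0 // !scalerDr.
have rD : rpart (fun q => lpart F q + rmid F q + rpart F q) s =
    rpart (lpart F) s + rpart (rmid F) s + rpart (rpart F) s.
  by case: s {s1 lD} => [|x s]; rewrite /= ?addr0 // !scalerDr.
have L : lpart (lpart F) s + rmid (lpart F) s + lpart (rmid F) s = 0.
  case: s s1 {lD rD} => [|x [|y s]] // _.
  rewrite mid_cons /= evM scalerA addrA M2 add0r.
  rewrite -/(mid _ (fun q => ev x *: F q) (y :: s)) -/(mid _ F (y :: s)).
  by rewrite -mid_morph ?M2 // => a b; rewrite scalerDr.
have Rr : rpart (rpart F) s + rmid (rpart F) s + rpart (rmid F) s = 0.
  case/lastP: s s1 {lD rD L} => [|s z] //; case/lastP: s => [|s y] // _.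
  rewrite mid_rcons !rpart_rcons evM scalerA [ev z * _]mulrC.
  rewrite [X in _ + (X + _)](_ : _ = ev z *: rmid F (rcons s y)); last first.
    by rewrite (mid_morph _ _ _ (scalerDr _)); apply: eq_mid => q _; rewrite rpart_rcons.
  by rewrite addrCA M2 addr0 M2.
have LR : lpart (rpart F) s + rpart (lpart F) s = 0.
  by case: s s1 {lD rD L Rr} => [|x [|y s]] // _; rewrite /= !scalerA mulrC M2.
rewrite lD rD mid_mid //; last exact: rmulA.
rewrite addr0.
by rewrite (AC (3*2*3) ((1*4*2)*(8*5*7)*(3*6))) /= L Rr LR !addr0.
Qed.

Lemma multiadd_hd n F : multiadd n F -> multiadd n.+1 (hd F).
Proof.
move=> aF; rewrite hdE.
have aL : multiadd n.+1 (lpart F).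
  move=> [|a p] x y s [ns] /=; last by rewrite aF // scalerDr.
  by rewrite evD scalerDl.
have aR : multiadd n.+1 (rpart F).
  move=> p x y s; case/lastP: s => [|s z]; first by rewrite !cats1 !rpart_rcons evD scalerDl.
  rewrite -!rcons_cons -!rcons_cat !rpart_rcons size_rcons addnS => -[ns].
  by rewrite aF // scalerDr.
apply: multiaddD aR; apply: multiaddD aL _.
by apply: multiadd_mid aF; [apply: rmulDl | apply: rmulDr].
Qed.

(** Division by t^(l+1), keeping only what remains in positive degree; therefore [l.+1] coefficients
    are dropped and not l. *)
Definition shiftR l (x : R) : R := (drop_poly l.+1 x.1, 0).

Lemma shiftRD l : {morph shiftR l : x y / x + y}.
Proof. by move=> x y; congr pair; rewrite /= ?drop_polyD ?addr0. Qed.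

Lemma shiftR_t l : shiftR l tR = 0.
Proof. by congr pair; rewrite drop_poly_eq0 // size_poly1. Qed.

Lemma shiftRS l x : shiftR l.+1 (rmul tR x) = shiftR l x.
Proof.
congr pair; apply/polyP => i.
by rewrite /= mul1r !coef_drop_poly coefMX !addnS.
Qed.

Lemma shiftR0 x : shiftR 0 (rmul tR x) = (x.1, 0).
Proof.
congr pair; apply/polyP => i.
by rewrite /= mul1r !coef_drop_poly coefMX addnS /= addn0.
Qed.

Lemma shiftR_sum (W : zmodType) (H : nat -> R -> W) n x : (forall l, H l 0 = 0) ->
  (size x.1 <= n)%N ->
  \sum_(l < size x.1) H l (shiftR l x) = \sum_(l < n) H l (shiftR l x).
Proof.
move=> H0 xn; rewrite (big_ord_widen n (fun l => H l (shiftR l x)) xn) big_mkcond.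
apply: eq_bigr => l _; case: ltnP => // lx.
by rewrite /shiftR drop_poly_eq0 ?H0 // leqW.
Qed.

(* The telescoping of F(t, x, s) over the powers of t dividing x: subtracting
   its coboundary makes F vanish when the first argument is t. *)
Definition tfill F (s : seq R) : M :=
  if s is x :: s' then
    F (tR :: ((0, x.2) : R) :: s') + \sum_(l < size x.1) F (tR :: shiftR l x :: s')
  else 0.

Lemma multiadd_tfill k F : multiadd k.+2 F -> multiadd k.+1 (tfill F).
Proof.
move=> aF [|a p] x y s [ns].
  rewrite !cat0s /tfill; have F0 (l : nat) : F (tR :: (0 : R) :: s) = 0.
    by apply: (multiadd0 (p := [:: tR]) aF); rewrite /= ns.
  pose n := maxn (size (x + y).1) (maxn (size x.1) (size y.1)).
  rewrite !(@shiftR_sum _ (fun l z => F (tR :: z :: s)) n) ?leq_max ?leqnn ?orbT //.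
  rewrite addrACA; congr (_ + _).
    rewrite -(aF [:: tR]) /= ?ns //; congr (F (_ :: _ :: _)).
    by congr pair; rewrite addr0.
  rewrite -big_split /=; apply: eq_bigr => l _.
  by rewrite shiftRD (aF [:: tR]) /= ?ns.
rewrite !cat_cons /= addrACA -big_split /=; congr (_ + _).
  by rewrite (aF [:: tR, _ & p]) //= !addSn ns.
by apply: eq_bigr => l _; rewrite (aF [:: tR, _ & p]) //= !addSn ns.
Qed.

Lemma tfill_t k F q : multiadd k.+2 F -> size q = k -> tfill F (tR :: q) = 0.
Proof.
move=> aF sq; have F0 : F (tR :: (0 : R) :: q) = 0.
  by apply: (multiadd0 (p := [:: tR]) aF); rewrite /= sq.
rewrite /tfill F0 add0r big1 // => l _; by rewrite shiftR_t.
Qed.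

Lemma hd_tfill k F y s : multiadd k.+2 F -> size s = k ->
  hd (tfill F) (tR :: y :: s) = F (tR :: y :: s).
Proof.
move=> aF sk; rewrite hd_cons ev_t scale1r.
have F0 (l : nat) : F (tR :: (0 : R) :: s) = 0.
  by apply: (multiadd0 (p := [:: tR]) aF); rewrite /= sk.
rewrite mid_eq0 => [|q [sq]]; last by rewrite (tfill_t aF) // sq.
rewrite (tfill_t aF) ?size_belast // scaler0 !addr0 /tfill.
rewrite -[(0, (rmul tR y).2)]/(0 : R) F0 // add0r.
have yX : (size (rmul tR y).1 <= (size y.1).+1)%N.
  by rewrite /= mul1r; have [->|y0] := eqVneq y.1 0; rewrite ?mul0r ?size_poly0 // size_mulX.
rewrite (@shiftR_sum _ (fun l z => F (tR :: z :: s)) _ (rmul tR y) F0 yX).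
rewrite big_ord_recl shiftR0 addrACA.
rewrite [X in _ + X](_ : _ = 0) ?addr0; last first.
  rewrite -[RHS](boolean_scale2 (\sum_(l < size y.1) F [:: tR, shiftR l y & s])).
  by congr (_ + _); apply: eq_bigr => l _; rewrite shiftRS.
rewrite -(aF [:: tR]) /= ?sk //; case: y {yX} => p v.
by congr (F (_ :: _ :: _)); congr pair; rewrite /= ?add0r ?addr0.
Qed.

Definition constR (b : B) : R := (b%:P, 0).

(** * Cocycles vanishing when the first argument is t, and their contraction by atoms *)

Section TNormal.
Variables (k : nat) (F : seq R -> M).
Hypotheses (aF : multiadd k.+2 F) (cF : forall s, size s = k.+3 -> hd F s = 0).
Hypothesis tF : forall y s, size s = k -> F (tR :: y :: s) = 0.

Lemma tnormal_t y s : size s = k.+1 -> F (rmul tR y :: s) = F (y :: s).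
Proof.
move=> sk; have := cF (s := [:: tR, y & s]); rewrite /= sk => /(_ erefl).
rewrite -/(hd F [:: tR, y & s]) hd_cons ev_t scale1r.
have -> : F (tR :: belast y s) = 0 by case: s sk => // z s [sk] /=; rewrite tF ?size_belast.
rewrite scaler0 addr0 mid_eq0 => [|[|z q]]; last first.
- by rewrite /= sk => -[qk]; apply: tF.
- by rewrite /= sk.
rewrite addr0 => /(congr1 (+%R (F (y :: s)))).
by rewrite addrA boolean_scale2 add0r addr0.
Qed.

(** By [tnormal_t], multiplying the first argument by t changes nothing. So an element v of V counts
    as t v = 0, and every power of t counts as t. *)
Lemma tnormal_ev x s : size s = k.+1 -> F (x :: s) = F (constR (ev x) :: s).
Proof.
move=> sk; have a1 (y z : R) : F ((y + z : R) :: s) = F (y :: s) + F (z :: s).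
  by rewrite (@aF [::]) // /= sk.
have F0 : F ((0 : R) :: s) = 0 by apply: (multiadd0 (p := [::]) aF); rewrite /= sk.
case: x => p v; have -> : (p, v) = ((p, 0) : R) + ((0, v) : R).
  by congr pair; rewrite /= ?addr0 ?add0r.
rewrite a1 -[F ((0, v) :: s)]tnormal_t // [rmul tR (0, v)](_ : _ = 0); last first.
  by congr pair; rewrite /= mulr0 mul0r.
rewrite F0 addr0 evD [ev (0, v)]/ev horner0 addr0 {v}.
elim/poly_ind: p => [|p c IHp].
  by rewrite /ev horner0 /constR polyC0.
have -> : (p * 'X + c%:P, 0) = rmul tR (p, 0) + constR c :> R.
  by congr pair; rewrite /= ?mul1r ?addr0.
rewrite a1 tnormal_t // IHp -a1; congr (F (_ :: _)); congr pair.
  by rewrite /= evD evM ev_t mul1r polyCD [ev (constR c)]/ev hornerC.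
by rewrite /= addr0.
Qed.

(** The atoms of the Boolean subalgebra generated by [L], possibly together with zeros, which
    contribute nothing to the sums below. *)
Fixpoint atoms (L : seq B) : seq B :=
  if L is b :: L' then [seq b * e | e <- atoms L'] ++ [seq (1 - b) * e | e <- atoms L']
  else [:: 1].

Lemma sum_atoms L : \sum_(e <- atoms L) e = 1.
Proof.
elim: L => [|b L IHL] /=; first by rewrite big_seq1.
by rewrite big_cat !big_map -!mulr_sumr IHL !mulr1 /= addrCA subrr addr0.
Qed.

Lemma atoms_mul L b e : b \in L -> e \in atoms L -> b * e = 0 \/ b * e = e.
Proof.
elim: L e => // c L IHL e; rewrite inE => bcL /=; rewrite mem_cat.
have cc : c * c = c by rewrite -expr2 hB.
have [->|bc] := eqVneq b c.
  case/orP => /mapP[a _ ->]; rewrite mulrA; first by right; rewrite cc.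
  by left; rewrite mulrBr mulr1 cc subrr mul0r.
move: bcL; rewrite (negPf bc) => /= bL.
by case/orP => /mapP[a aL ->]; rewrite mulrCA; case: (IHL _ bL aL) => ->; rewrite ?mulr0; auto.
Qed.

Definition hcon L (s : seq R) : M := \sum_(e <- atoms L) e *: F (constR e :: s).

(** Multiply the cocycle equation at (e t, x, s) by e and sum over the atoms e. As [ev x * e] is 0
    or e, the merge of e t with x gives e times [ev x] times F (e t, s), which is the left action
    term of the differential; this uses that [L] contains [ev x]. *)
Lemma hd_hcon L x s : size s = k.+1 -> ev x \in L -> hd (hcon L) (x :: s) = F (x :: s).
Proof.
move=> sk xL.
have -> : hd (hcon L) (x :: s) = \sum_(e <- atoms L) e *: (ev x *: F (constR e :: s)
   + rmid (fun q => F (constR e :: q)) (x :: s)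
   + ev (last x s) *: F (constR e :: belast x s)).
  rewrite /hd /hcon mid_sum !scaler_sumr -!big_split; apply: eq_bigr => e _.
  rewrite !scalerDr !scalerA mulrC [_ * e]mulrC; congr (_ + _ + _).
  by rewrite (mid_morph _ _ _ (scalerDr _)).
rewrite -[RHS]scale1r -(sum_atoms L) scaler_suml !big_seq; apply: eq_bigr => e eL.
have := cF (s := [:: constR e, x & s]); rewrite /= sk => /(_ erefl).
rewrite -/(hd F [:: constR e, x & s]) hd_cons [F (rmul _ _ :: s)]tnormal_ev //.
rewrite evM [ev (constR e)]/ev hornerC => /(congr1 (fun z : M => e *: z)).
rewrite scaler0 -!addrA !scalerDr scalerA -expr2 hB => /(congr1 (+%R (e *: F (x :: s)))).
rewrite addrA boolean_scale2 add0r addr0 => <-; congr (_ + _).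
rewrite scalerA; have [ex|ex] := atoms_mul xL eL; rewrite [e * _]mulrC ex.
  by rewrite scale0r /constR polyC0 (multiadd0 (p := [::]) aF) ?scaler0 //= sk.
by [].
Qed.

End TNormal.

End Hochschild.
End AugmentationIdeal.

(** * Quotients of B-modules by the kernel of an additive projection *)

Section ProjectionQuotient.
Variables (B : comNzRingType) (N : lmodType B) (r : N -> N).
Hypotheses (rD : {morph r : x y / x + y}) (rr : forall x, r (r x) = r x)
  (rZ : forall b x, r x = 0 -> r (b *: x) = 0).

Let r0 : r 0 = 0.
Proof. by apply: (addrI (r 0)); rewrite -rD !addr0. Qed.

Let rN x : r (- x) = - r x.
Proof. by apply/eqP; rewrite -addr_eq0 -rD addNr r0. Qed.

Definition fixed_pred (_ : {morph r : x y / x + y}) : {pred N} := fun x => r x == x.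

Fact fixed_zmod_closed : zmod_closed (fixed_pred rD).
Proof.
split=> [|x y /eqP rx /eqP ry]; apply/eqP; first exact: r0.
by rewrite rD rN rx ry.
Qed.

HB.instance Definition _ := GRing.isZmodClosed.Build N (fixed_pred rD) fixed_zmod_closed.

(* The quotient of N by the kernel of the projection r, realised on the image
   of r with the action transported along r. *)
Definition projquo (_ : forall x, r (r x) = r x)
  (_ : forall b x, r x = 0 -> r (b *: x) = 0) : Type := {x : N | x \in fixed_pred rD}.
Local Notation Q := (projquo rr rZ).

HB.instance Definition _ := SubChoice.on Q.
HB.instance Definition _ := [SubChoice_isSubZmodule of Q by <:].

Fact projquo_subproof x : r x \in fixed_pred rD.
Proof. by apply/eqP; apply: rr. Qed.

Definition projquo_pi (x : N) : Q := exist _ (r x) (projquo_subproof x).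

Lemma projquo_piD : {morph projquo_pi : x y / x + y}.
Proof. by move=> x y; apply: val_inj; rewrite /= rD. Qed.

Lemma projquo_valK (x : Q) : projquo_pi (val x) = x.
Proof. by apply: val_inj => /=; apply/eqP; apply: (valP x). Qed.

Definition projquo_scale (b : B) (x : Q) : Q := projquo_pi (b *: val x).

Let rZr b x : r (b *: r x) = r (b *: x).
Proof.
apply/eqP; rewrite -subr_eq0 -rN -rD -scalerBr; apply/eqP/rZ.
by rewrite rD rN rr subrr.
Qed.

Fact projquo_scaleA a b x : projquo_scale a (projquo_scale b x) = projquo_scale (a * b) x.
Proof. by apply: val_inj; rewrite /= rZr scalerA. Qed.
Fact projquo_scale1 : left_id 1 projquo_scale.
Proof. by move=> x; rewrite /projquo_scale scale1r projquo_valK. Qed.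
Fact projquo_scaleDr : right_distributive projquo_scale +%R.
Proof. by move=> a x y; apply: val_inj; rewrite /= scalerDr rD. Qed.
Fact projquo_scaleDl x : {morph projquo_scale^~ x : a b / a + b}.
Proof. by move=> a b; apply: val_inj; rewrite /= scalerDl rD. Qed.

HB.instance Definition _ := GRing.Zmodule_isLmodule.Build B Q
  projquo_scaleA projquo_scale1 projquo_scaleDr projquo_scaleDl.

Lemma projquo_piZ b x : projquo_pi (b *: x) = b *: projquo_pi x.
Proof. by apply: val_inj; rewrite /= rZr. Qed.

End ProjectionQuotient.

(* An F_2-linear substitute for a limit along an ultrafilter containing, for
   every b, the lists through b. *)
Lemma eventual_limit (T : eqType) :
  exists2 l : (seq T -> 'F_2) -> 'F_2, {morph l : f g / f + g}
    & forall f c b, (forall L, b \in L -> f L = c) -> l f = c.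
Proof.
pose W := seq T -> 'F_2.
have F22 (c : 'F_2) : c + c = 0 by case: (F2P c) => ->; apply: val_inj.
have W2 (f : W) : f + f = 0 by apply/funext => L; apply: F22.
(* [U] consists of the functions that vanish on all sufficiently large lists. It does not contain
   the constant 1, and a functional killing [U] sees only eventual values. *)
pose U (f : W) := exists L0 : seq T, forall L, {subset L0 <= L} -> f L = 0.
have [|f g [L1 f0] [L2 g0]|[L /(_ L)]|l [lD l0 l1]] := @boolean_separation W U (fun=> 1) W2.
- by exists [::].
- exists (L1 ++ L2) => L L12; rewrite -[LHS]/(f L + g L) f0 ?g0 ?addr0 // => x xL.
    by apply: L12; rewrite mem_cat xL orbT.
  by apply: L12; rewrite mem_cat xL.
- by move=> /(_ (fun _ => id)).
exists l; first exact: lD.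
move=> f c b fc.
have lz (g : W) : (forall L, b \in L -> g L = 0) -> l g = 0.
  by move=> g0; apply: l0; exists [:: b] => L bL; apply: g0; apply: bL; rewrite inE.
have [c0|c1] := F2P c; first by rewrite c0; apply: lz => L /fc ->.
apply/eqP; rewrite -subr_eq0 c1 -[X in _ - X]l1 (_ : - l _ = l (fun=> 1)) -?lD.
  apply/eqP; apply: lz => L bL.
  by rewrite -[LHS]/(f L + 1) (fc L bL) c1; apply: val_inj.
by apply/eqP; rewrite eq_sym -addr_eq0 F22.
Qed.

(** * Vanishing of the cohomology of the ideal in degrees at least 2 *)

Section Vanishing.
Variables (B : comNzRingType) (hB : boolean B) (V : zmodType).
Local Notation R := (aideal B V).

Lemma hd_morph (M N : lmodType B) (h : M -> N) (F : seq R -> M) s :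
  {morph h : x y / x + y} -> (forall b x, h (b *: x) = b *: h x) ->
  h (hd F s) = hd (fun q => h (F q)) s.
Proof.
move=> hD hZ; case: s => [|x s].
  by apply: (addrI (h 0)); rewrite -hD !addr0.
by rewrite /hd !hD !hZ (mid_morph _ _ _ hD).
Qed.

Lemma eq_hd (M : lmodType B) (F G : seq R -> M) s :
  (forall q, (size q).+1 = size s -> F q = G q) -> hd F s = hd G s.
Proof.
case: s => // x s FG; rewrite /hd (eq_mid _ FG); congr (_ *: _ + _ + _ *: _).
  exact: FG.
by apply: FG; rewrite size_belast.
Qed.

(** For a given list, [ev] of the first entry eventually belongs to [L], and then [hcon F L] solves
    the equation there. After pairing with a functional its values lie in F_2, where [lim]
    applies. *)
Lemma bidual_contraction (M : lmodType B) k (F : seq R -> M) : multiadd k.+2 F ->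
  (forall s, size s = k.+3 -> hd F s = 0) ->
  (forall y s, size s = k -> F (tR B V :: y :: s) = 0) ->
  exists2 G : seq R -> bdual (bdual M), multiadd k.+1 G &
    forall s, size s = k.+2 -> hd G s = bidual (F s).
Proof.
move=> aF cF tF; have [lim limD limE] := eventual_limit B.
have hD (l : bdual M) s s' s'' : (forall L, hcon F L s = hcon F L s' + hcon F L s'') ->
    lim (fun L => val l (hcon F L s)) =
    lim (fun L => val l (hcon F L s')) + lim (fun L => val l (hcon F L s'')).
  by move=> hs; rewrite -limD; congr (lim _); apply/funext => L; rewrite hs dualD.
pose g s (l : bdual M) := lim (fun L => val l (hcon F L s)).
have gD s : {morph g s : l l' / l + l'} by move=> l l'; rewrite -[RHS]limD.
pose G s : bdual (bdual M) := Dual (gD s).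
exists G.
  move=> p x y s ns; apply: dualP => l; apply: hD => L.
  rewrite -big_split; apply: eq_bigr => e _ /=.
  by rewrite -scalerDr -!cat_cons aF //= addSn ns.
move=> [|x s] // [sk]; apply: dualP => l.
have gE q b : val (b *: G q) l = lim (fun L => val l (b *: hcon F L q)) by [].
have midE : val (mid (@rmul B V) G (x :: s)) l =
    lim (fun L => val l (mid (@rmul B V) (hcon F L) (x :: s))).
  transitivity (mid (@rmul B V) (fun q => g q l) (x :: s)).
    exact: (@mid_morph _ _ (bdual (bdual M)) _ (fun m => val m l)).
  rewrite -(@mid_morph _ _ (seq B -> 'F_2) _ lim (fun q L => val l (hcon F L q))) //.
  congr (lim _); apply/funext => L; rewrite (mid_morph _ _ _ (dualD l)).
  exact: (@mid_morph _ _ (seq B -> 'F_2) _ (fun f => f L)).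
rewrite -[LHS]/(val _ l + val _ l + val _ l) !gE midE.
rewrite -!limD; apply: (limE _ _ (ev x)) => L xL.
by rewrite -(hd_hcon hB aF cF tF sk xL) -[RHS]/(val l (hd _ _)) /hd !dualD.
Qed.

(** The derivation b t^n |-> n b, zero on V; the factor 'X restores the t left out in [aideal]. *)
Definition degR (x : R) : B := (x.1 * 'X)^`().[1].

Lemma degRM x y : degR (rmul x y) = ev x * degR y + ev y * degR x.
Proof.
rewrite /degR /ev /= (_ : _ * 'X = (x.1 * 'X) * (y.1 * 'X)); last by ring.
rewrite derivM hornerD (hornerM (_^`())) (hornerM (_ * 'X)) !hornerMX !mulr1 addrC.
by congr (_ + _); rewrite mulrC.
Qed.

Lemma degRD : {morph degR : x y / x + y}.
Proof. by move=> x y; rewrite /degR mulrDl derivD hornerD. Qed.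

(** As b is idempotent, (b t)(b t) = t (b t). The Leibniz rule gives 0 on the left, being twice one
    term, and f (b t) + b f (t) on the right, whence f (b t) = b f (t). Next, t v = 0 gives f (v) =
    0, and multiplication by t settles the higher powers. *)
Lemma derivation_degR (M : lmodType B) (f : R -> M) : {morph f : x y / x + y} ->
  (forall x y, f (rmul x y) = ev x *: f y + ev y *: f x) ->
  forall x, f x = degR x *: f (tR B V).
Proof.
move=> fD fM; have f0 : f 0 = 0 by apply: (addrI (f 0)); rewrite -fD !addr0.
have M2 := @boolean_scale2 _ hB M.
have ft x : f (rmul (tR B V) x) = f x + ev x *: f (tR B V) by rewrite fM ev_t scale1r.
have fb b : f (constR V b) = b *: f (tR B V).
  have := ft (constR V b); have -> : rmul (tR B V) (constR V b) =
      rmul (constR V b) (constR V b).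
    by congr pair; rewrite /= -polyCM mul1r -expr2 hB.
  rewrite fM M2 /ev hornerC => /(congr1 (+%R (f (constR V b)))).
  by rewrite addr0 addrA M2 add0r.
case=> p v; have -> : (p, v) = ((p, 0) : R) + ((0, v) : R).
  by congr pair; rewrite /= ?addr0 ?add0r.
have -> : f ((p, 0) + (0, v)) = f (p, 0).
  have := ft (0, v); rewrite [rmul _ _](_ : _ = 0); last by congr pair; rewrite /= mulr0 mul0r.
  by rewrite f0 /ev horner0 scale0r addr0 fD => <-; rewrite addr0.
rewrite degRD {2}/degR mul0r deriv0 horner0 addr0 {v}.
elim/poly_ind: p => [|p c IHp]; first by rewrite f0 /degR mul0r deriv0 horner0 scale0r.
have -> : (p * 'X + c%:P, 0) = rmul (tR B V) (p, 0) + constR V c :> R.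
  by congr pair; rewrite /= ?mul1r ?addr0.
rewrite fD ft IHp fb degRD degRM ev_t mul1r !scalerDl; congr (_ + _ *: _ + _ *: _).
  by rewrite /degR mul1r derivX hornerC mulr1.
by rewrite /degR derivM derivC derivX !hornerE.
Qed.

Lemma dual0 (M : zmodType) (l : dual M) : val l 0 = 0.
Proof. by apply: (addrI (val l 0)); rewrite -dualD !addr0. Qed.

(* G below is a primitive of F in the double dual of M; a lift E of the image of
   G in the quotient by M which is itself a cocycle corrects G to one in M. *)
Lemma bidual_descent k (M : lmodType B) (F : seq R -> M) : multiadd k.+2 F ->
  (forall s, size s = k.+3 -> hd F s = 0) ->
  (forall (N : lmodType B) (r : N -> N) (G : seq R -> N), {morph r : x y / x + y} ->
     (forall x, r (r x) = r x) -> (forall b x, r x = 0 -> r (b *: x) = 0) ->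
     multiadd k.+1 G -> (forall s, size s = k.+2 -> r (hd G s) = 0) ->
     exists2 E : seq R -> N, multiadd k.+1 E &
       (forall s, size s = k.+2 -> hd E s = 0) /\
       (forall s, size s = k.+1 -> r (G s) = r (E s))) ->
  exists2 G : seq R -> M, multiadd k.+1 G & forall s, size s = k.+2 -> F s = hd G s.
Proof.
move=> aF cF lift; pose F' s := F s - hd (tfill F) s.
have aT : multiadd k.+1 (tfill F) by apply: multiadd_tfill.
have aF' : multiadd k.+2 F' by apply: multiaddB aF _; apply: multiadd_hd.
have cF' s : size s = k.+3 -> hd F' s = 0.
  by move=> sn; rewrite hdB cF // (hd_hd hB) ?subrr // sn.
have tF y s : size s = k -> F' (tR B V :: y :: s) = 0.
  by move=> sk; rewrite /F' (hd_tfill hB y aF sk) subrr.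
have [G aG GE] := bidual_contraction aF' cF' tF.
have M2 := @boolean_scale2 _ hB M.
have jinj := bidual_inj M2.
have [||r [rD rr r0]] := @boolean_complement _ (fun x => exists m : M, x = bidual m)
  (@boolean_scale2 _ hB (bdual (bdual M))).
- by exists 0; apply: dualP => l; rewrite /= dual0.
- by move=> _ _ [m ->] [m' ->]; exists (m + m'); rewrite bidualD.
have rZ b x : r x = 0 -> r (b *: x) = 0.
  by move=> /r0[m ->]; apply/r0; exists (b *: m); rewrite bidualZ.
have [|E aE [cE GEr]] := lift _ r G rD rr rZ aG.
  by move=> s sk; apply/r0; exists (F' s); apply: GE.
have r00 : r 0 = 0 by apply: (addrI (r 0)); rewrite -rD !addr0.
have rN x : r (- x) = - r x by apply/eqP; rewrite -addr_eq0 -rD addNr r00.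
have ex s : exists m : M, size s = k.+1 -> G s - E s = bidual m.
  have [sk|sk] := eqVneq (size s) k.+1; last by exists 0 => /eqP; rewrite (negPf sk).
  have /r0[m mE] : r (G s - E s) = 0 by rewrite rD rN GEr // subrr.
  by exists m.
have [g gE] := choice ex.
have ag : multiadd k.+1 g.
  move=> p x y s ns; apply: jinj; rewrite bidualD -!gE ?size_cat //=.
  by rewrite aG // aE // opprD addrACA.
exists (fun s => g s + tfill F s); first exact: multiaddD.
move=> s sk; rewrite hdD; apply: (addIr (- hd (tfill F) s)); rewrite addrK.
apply: jinj; rewrite -[F s - _]/(F' s) -GE // (hd_morph _ _ (@bidualD B M) (@bidualZ B M)).
transitivity (hd (fun q => G q - E q) s); first by rewrite hdB cE // subr0.
by apply: eq_hd => q; rewrite sk => -[/gE].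
Qed.

(** The module is generalised in the induction because [bidual_descent] replaces it by a quotient of
    its double dual while lowering the degree by one. *)
Theorem HH_aideal_vanish k (M : lmodType B) (F : seq R -> M) : multiadd k.+2 F ->
  (forall s, size s = k.+3 -> hd F s = 0) ->
  exists2 G : seq R -> M, multiadd k.+1 G & forall s, size s = k.+2 -> F s = hd G s.
Proof.
elim: k M F => [|k IHk] M F aF cF; apply: (bidual_descent aF cF) => N r G rD rr rZ aG cG.
- pose p := projquo_pi rD rr rZ.
  (* In the quotient [G] becomes a derivation, so it is [degR] times its value at t; the same
     formula in [N] is a derivation lifting it. *)
  pose E s : N := degR (head 0 s) *: G [:: tR B V].
  have aE : multiadd 1 E.
    by move=> [|a [|c q]] x y [|b s] // _; rewrite /E /= degRD scalerDl.
  exists E => //; split.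
    move=> [|x [|y [|z s]]] // _; rewrite hd_cons /= addr0 /E /= degRM scalerDl !scalerA.
    by rewrite addrA (boolean_scale2 hB) add0r (boolean_scale2 hB).
  move=> [|x [|z s]] // _.
  have pD : {morph (fun z => p (G [:: z])) : x y / x + y}.
    by move=> a b; rewrite (aG [::]) // /p projquo_piD.
  have pM a b : p (G [:: rmul a b]) = ev a *: p (G [:: b]) + ev b *: p (G [:: a]).
    have := cG [:: a; b] erefl; rewrite hd_cons /= addr0 => h.
    have /(congr1 (+%R (p (G [:: rmul a b])))) : p (ev a *: G [:: b] + G [:: rmul a b] + ev b *: G [:: a]) = 0.
      by apply: val_inj.
    rewrite /p !projquo_piD !projquo_piZ addr0 => <-.
    by rewrite [_ + p (G [:: rmul a b])]addrC !addrA (boolean_scale2 hB) add0r.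
  have := derivation_degR pD pM x; rewrite -projquo_piZ => /(congr1 val).
  by [].
pose p := projquo_pi rD rr rZ.
have [||eta aeta etaE] := IHk _ (fun s => p (G s)).
- by move=> q x y s ns; rewrite aG // /p projquo_piD.
- move=> s sk; rewrite -(hd_morph _ _ (projquo_piD rD rr rZ) (projquo_piZ rD rr rZ)).
  by apply: val_inj; rewrite /= cG // (_ : \val 0 = 0).
(* The primitive found in the quotient is lifted as a mere cochain; the coboundary of the lift is
   automatically a cocycle. *)
pose e s : N := val (eta s).
have ae : multiadd k.+1 e by move=> q x y s ns; rewrite /e aeta.
exists (hd e); first exact: multiadd_hd.
split=> [s sk|s sk]; first by rewrite (hd_hd hB) // sk.
have /(congr1 val) := etaE s sk; rewrite /= => ->.
transitivity (val (p (hd e s))); last by [].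
rewrite /p (hd_morph _ _ (projquo_piD rD rr rZ) (projquo_piZ rD rr rZ)).
by apply: congr1; apply: eq_hd => q _; rewrite /e projquo_valK.
Qed.

End Vanishing.

(** * Cochains as bimodule maps from the bar resolution *)

Lemma mid_index (T W : zmodType) (mul : T -> T -> T) (F : seq T -> W) s :
  mid mul F s = \sum_(i < (size s).-1)
    F (take i s ++ mul (nth 0 s i) (nth 0 s i.+1) :: drop i.+2 s).
Proof.
elim: s F => [|x [|y s] IHs] F; rewrite ?big_ord0 //.
rewrite mid_cons IHs big_ord_recl /= drop0; congr (_ + _).
Qed.

Section BarCochains.
Variables (Q : gradedAlgebra) (m : int).
Hypothesis QC : commutative (@GRing.mul Q).
Local Notation M := (regular_bimodule Q).
Local Notation homogQ := (homog (ga_grading Q)).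
Implicit Types (F G : seq Q -> Q) (s p q : seq Q).

Fixpoint homogs (es : seq int) (s : seq Q) : Prop :=
  match es, s with
  | [::], [::] => True
  | e :: es', x :: s' => homogQ e x /\ homogs es' s'
  | _, _ => False
  end.

Lemma homogs_cat es1 es2 s1 s2 : homogs es1 s1 -> homogs es2 s2 -> homogs (es1 ++ es2) (s1 ++ s2).
Proof. by elim: es1 s1 => [|e es1 IHes] [|x s1] //= [xe /IHes h] /h. Qed.

Lemma homogs_nth es s : homogs es s ->
  size es = size s /\ forall i, homogQ (nth 0 es i) (nth 0 s i).
Proof.
elim: es s => [|e es IHes] [|x s] //= => [_|[xe /IHes[-> hs]]].
  by split=> // i; rewrite !nth_nil /homog linear0.
by split=> // -[|i]; [apply: xe | apply: hs].
Qed.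

Definition bar_degree (d : int) n F := forall es s, size s = n -> homogs es s ->
  homogQ (\sum_(e <- es) e + d) (F s).

(* An n-cochain of Q with values in Q[m], seen as a bimodule map from the bar
   resolution: the first and the last of the n + 2 entries are coefficients. *)
Record bar_cochain n F : Prop := BarCochain {
  bar_add : multiadd n.+2 F;
  bar_head : forall c a s, size s = n.+1 -> F (c * a :: s) = c * F (a :: s);
  bar_last : forall c b s, size s = n.+1 -> F (rcons s (c * b)) = c * F (rcons s b);
  bar_deg : bar_degree m n.+2 F
}.

Local Notation qmid := (@mid Q *%R Q).

Lemma algF2_addxx (x : Q) : x + x = 0.
Proof. by rewrite -[x]scale1r -scalerDl (_ : 1 + 1 = 0) ?scale0r //; apply: val_inj. Qed.

Lemma algF2_oppr (x : Q) : - x = x.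
Proof. by apply: (addrI x); rewrite subrr algF2_addxx. Qed.

Lemma algF2_eq (x y : Q) : x + y = 0 -> x = y.
Proof. by move/eqP; rewrite addr_eq0 algF2_oppr => /eqP. Qed.

Lemma homogD i x y : homogQ i x -> homogQ i y -> homogQ i (x + y).
Proof. by rewrite /homog => xi yi; rewrite linearD /= xi yi. Qed.

Lemma homog0 i : homogQ i 0.
Proof. by rewrite /homog linear0. Qed.

Lemma bar_degree_mid d n F : bar_degree d n F -> bar_degree d n.+1 (qmid F).
Proof.
move=> dF es s; elim: s n d es F dF => [|x [|y s] IHs] n d es F dF //.
  by move=> _ _; apply: homog0.
case: es => [|e [|e' es]] //= => [_ []//|sn [xe [ye h]]].
apply: homogD.
  have /= := dF (e + e' :: es) (x * y :: s); rewrite !big_cons !addrA; apply.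
    by case: sn.
  by split=> //; apply: ga_homogM.
case: n sn dF => // n [sn] dF.
rewrite big_cons addrAC addrC [e + d]addrC.
apply: (IHs n (d + e) (e' :: es) (fun q => F (x :: q))) => //; last by rewrite /= sn.
move=> es' q qn h'; have := dF (e :: es') (x :: q); rewrite big_cons /= qn.
by rewrite [e + _]addrC addrAC -addrA; apply.
Qed.

Lemma bar_mid n F : bar_cochain n F -> bar_cochain n.+1 (qmid F).
Proof.
case=> aF hF lF dF; split; last exact: bar_degree_mid.
- by apply: multiadd_mid aF; [apply: mulrDl | apply: mulrDr].
- move=> c a [|y s] // [sn]; rewrite !mid_cons -mulrA hF // mulrDr; congr (_ + _).
  rewrite (mid_morph _ _ _ (mulrDr c)); apply: eq_mid => q [qs].
  by rewrite hF // qs sn.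
- move=> c b s; case/lastP: s => [|s y] //; rewrite size_rcons => -[sn].
  rewrite !mid_rcons mulrA [y * c]QC -mulrA lF // mulrDr; congr (_ + _).
  rewrite (mid_morph _ _ _ (mulrDr c)); apply: eq_mid => q.
  by rewrite size_rcons => -[qs]; rewrite lF // qs sn.
Qed.

Lemma bar_sub n F G : bar_cochain n F -> bar_cochain n G -> bar_cochain n (fun s => F s - G s).
Proof.
case=> aF hF lF dF [aG hG lG dG]; split.
- exact: multiaddB.
- by move=> c a s sn; rewrite hF // hG // mulrBr.
- by move=> c b s sn; rewrite lF // lG // mulrBr.
- by move=> es s sn h; rewrite algF2_oppr; apply: homogD; [apply: dF | apply: dG].
Qed.

Definition bar_of n (f : {ffun 'I_n -> Q} -> shift_bimodule M m) (s : seq Q) : Q :=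
  nth 0 s 0 * (f [ffun i : 'I_n => nth 0 s i.+1] : Q) * nth 0 s n.+1.

Lemma nth_merge s i j (x : Q) : (i < size s)%N ->
  nth 0 (take i s ++ x :: drop i.+2 s) j =
  if (j < i)%N then nth 0 s j else if j == i then x else nth 0 s j.+1.
Proof.
move=> si; rewrite nth_cat size_take si; case: ltngtP => [ji|ij|->].
- by rewrite nth_take.
- have -> : (j - i = (j - i).-1.+1)%N by rewrite prednK // subn_gt0.
  by rewrite /= nth_drop; congr nth; rewrite -subn1; lia.
- by rewrite subnn.
Qed.

(** Merging an outer coefficient with its neighbour gives an action term of [hdiff]; the inner
    merges give its middle sum. *)
Lemma mid_bar_of n (f : {ffun 'I_n -> Q} -> shift_bimodule M m) s : size s = n.+3 ->
  qmid (bar_of f) s =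
  nth 0 s 0 * (hdiff f [ffun i : 'I_n.+1 => nth 0 s i.+1] : Q) * nth 0 s n.+2.
Proof.
move=> sn; rewrite mid_index sn /= big_ord_recl big_ord_recr /= /hdiff.
rewrite !mulrDr !mulrDl addrA; congr (_ + _ + _).
- rewrite /bar_of !nth_merge ?sn //= !ffunE /= mulrA; congr (_ * _ * _).
  by congr (f _ : Q); apply/ffunP => i; rewrite !ffunE /= nth_merge ?sn.
- rewrite mulr_sumr mulr_suml; apply: eq_bigr => i _.
  have iS : (i.+1 < size s)%N by rewrite sn; have := ltn_ord i; lia.
  rewrite /bar_of /= /bump leq0n add1n !nth_merge // ltn0Sn eqSS !ltnS.
  have -> : (n < i)%N = false by have := ltn_ord i; lia.
  have -> : (n == i :> nat) = false by have := ltn_ord i; lia.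
  congr (_ * _ * _); congr (f _ : Q); apply/ffunP => j; rewrite !ffunE nth_merge // ltnS eqSS.
  by rewrite /= /bump leq0n add1n -(inj_eq val_inj j i) /=; case: eqP => // ->.
rewrite /= /bump leq0n add1n /bar_of !nth_merge ?sn //= ltnn eqxx.
rewrite -!mulrA; congr (_ * _); rewrite ffunE; congr (_ * _).
by congr (f _ : Q); apply/ffunP => i; rewrite !ffunE nth_merge ?sn // ltnS ltn_ord.
Qed.

Lemma add_linear (U W : lmodType 'F_2) (f : U -> W) : {morph f : x y / x + y} -> linear f.
Proof.
move=> fD c x y; rewrite fD; congr (_ + _).
have f0 : f 0 = 0 by apply: (addrI (f 0)); rewrite -fD !addr0.
by case: (F2P c) => ->; rewrite ?scale0r ?scale1r.
Qed.

Lemma bar_of_cochain n (f : {ffun 'I_n -> Q} -> shift_bimodule M m) :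
  cochain f -> bar_cochain n (bar_of f).
Proof.
move=> [fL fD]; split.
- move=> p x y s ns; rewrite /bar_of.
  have [p0|p0] := posnP (size p).
    by case: p p0 ns => // _ ns /=; rewrite -mulrA mulrDl -!mulrA; congr (_ * _ + _ * _).
  have nthE j z : (p ++ z :: s)`_j = if j == size p then z else (p ++ 0 :: s)`_j.
    rewrite !nth_cat; case: ltngtP => // [pj|->]; last by rewrite subnn.
    by rewrite -subn_gt0 in pj; case: (j - _)%N pj.
  have [pn|pn] := eqVneq (size p) n.+1.
    rewrite !(nthE _ (x + y)) !(nthE _ x) !(nthE _ y) pn eqxx /=.
    suff h z : [ffun i : 'I_n => (p ++ z :: s)`_i.+1] = [ffun i : 'I_n => (p ++ 0 :: s)`_i.+1].
      by rewrite (h (x + y)) (h x) (h y) mulrDr.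
    apply/ffunP => i; rewrite !ffunE nthE pn eqSS.
    by have -> : (i == n :> nat) = false by have := ltn_ord i; lia.
  have jn : ((size p).-1 < n)%N by lia.
  pose a := [ffun i : 'I_n => (p ++ 0 :: s)`_i.+1].
  have aE z : [ffun i : 'I_n => (p ++ z :: s)`_i.+1] = set_arg a (Ordinal jn) z.
    apply/ffunP => i; rewrite !ffunE nthE -(inj_eq val_inj i) /=.
    by rewrite -{1}(prednK p0) eqSS.
  rewrite (aE (x + y)) (aE x) (aE y) !(nthE _ (x + y)) !(nthE _ x) !(nthE _ y).
  rewrite ![_ == size p]eq_sym (negPf pn) eqn0Ngt p0 /=.
  have := fL a (Ordinal jn) 1 x y; rewrite !scale1r => ->.
  by rewrite mulrDr mulrDl.
- by move=> c a s _; rewrite /bar_of /= -!mulrA; congr (_ * (_ * _)).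
- move=> c b s sn; rewrite /bar_of !nth_rcons sn ltnn eqxx /= mulrA [_ * c]QC -mulrA.
  congr (_ * (_ * _ * _)); congr (f _ : Q); apply/ffunP => i.
  by rewrite !ffunE !nth_rcons sn ltnS ltn_ord.
- move=> es s sn h.
  have [en hn] := homogs_nth h; rewrite sn in en.
  have hf : homogQ (\sum_(i < n) nth 0 es i.+1 + m) (f [ffun i : 'I_n => nth 0 s i.+1]).
    by apply: fD => i; rewrite ffunE; apply: hn.
  have -> : \sum_(e <- es) e + m =
      nth 0 es 0 + (\sum_(i < n) nth 0 es i.+1 + m) + nth 0 es n.+1.
    rewrite (big_nth 0) en big_mkord big_ord_recl big_ord_recr /= /bump leq0n add1n.
    by under eq_bigr do rewrite add1n; ring.
  exact: ga_homogM (ga_homogM (hn 0%N) hf) (hn n.+1).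
Qed.

Lemma bar_ofK n G : bar_cochain n G -> forall s, size s = n.+2 ->
  G s = nth 0 s 0 * G (1 :: rcons (take n (behead s)) 1) * nth 0 s n.+1.
Proof.
case=> aG hG lG dG [|a s] // [sn]; case/lastP: s sn => [|s b] //.
rewrite size_rcons => -[sn]; rewrite /= -{2}cats1 take_size_cat // nth_rcons sn ltnn eqxx.
rewrite -{1}[a]mulr1 hG ?size_rcons ?sn // -mulrA; congr (_ * _).
by rewrite -!rcons_cons -{1}[b]mulr1 lG /= ?sn // QC.
Qed.

(** By [bar_ofK] a bar cochain is determined by its values with both coefficients 1, which
    translates cocycles and primitives back and forth. There are no cochains below n = 0, hence the
    separate clause. *)
Theorem bar_vanishes n :
  (forall F, bar_cochain n F -> (forall s, size s = n.+3 -> qmid F s = 0) ->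
     if n is n'.+1 then exists2 G, bar_cochain n' G &
       forall s, size s = n.+2 -> F s = qmid G s
     else forall s, size s = 2%N -> F s = 0) ->
  HH_vanishes M n m.
Proof.
move=> Fcob f [/bar_of_cochain bf df].
have fE a : f a = bar_of f (1 :: rcons [seq a i | i <- enum 'I_n] 1).
  rewrite /bar_of /= mul1r nth_rcons size_map size_enum_ord ltnn eqxx mulr1.
  congr (f _); apply/ffunP => i; rewrite ffunE nth_rcons size_map size_enum_ord ltn_ord.
  by rewrite (nth_map i) ?size_enum_ord // nth_ord_enum.
have /(Fcob _ bf) : forall s, size s = n.+3 -> qmid (bar_of f) s = 0.
  by move=> s sn; rewrite mid_bar_of // df mulr0 mul0r.
case: n f bf df fE {Fcob} => [|n] f bf df fE.
  by move=> f0 a; rewrite fE f0 //= size_rcons size_map size_enum_ord.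
case=> G bG GE; pose g (a : {ffun 'I_n -> Q}) : shift_bimodule M m :=
  G (1 :: rcons [seq a i | i <- enum 'I_n] 1).
have GgE s : size s = n.+2 -> G s = bar_of g s.
  move=> sn; rewrite (bar_ofK bG sn) /bar_of /g; congr (_ * G (_ :: rcons _ _) * _).
  apply: (@eq_from_nth _ 0) => [|i].
    by rewrite size_map size_enum_ord size_takel // size_behead sn.
  rewrite size_takel ?size_behead ?sn // => i_n.
  rewrite nth_take // (nth_map (Ordinal i_n)) ?size_enum_ord // ffunE nth_behead.
  by congr nth; rewrite nth_enum_ord.
exists g.
  case: bG => aG hG lG dG; split.
    move=> a i; apply: add_linear => x y; rewrite /g.
    pose l := [seq a j | j <- enum 'I_n].
    have lE z : [seq (set_arg a i z) j | j <- enum 'I_n] = take i l ++ z :: drop i.+1 l.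
      apply: (@eq_from_nth _ 0) => [|j].
        rewrite size_map size_enum_ord size_cat /= size_take size_drop.
        by rewrite size_map size_enum_ord ltn_ord; have := ltn_ord i; lia.
      rewrite size_map size_enum_ord => jn.
      have lj : l`_j = a (nth (Ordinal jn) (enum 'I_n) j).
        by rewrite /l (nth_map (Ordinal jn)) ?size_enum_ord.
      rewrite (nth_map (Ordinal jn)) ?size_enum_ord // ffunE nth_cat size_take.
      rewrite size_map size_enum_ord ltn_ord -(inj_eq val_inj) /= nth_enum_ord //.
      case: ltngtP => [ji|ij|->].
      - by rewrite nth_take // lj.
      - have -> : (j - i = (j - i.+1).+1)%N by lia.
        by rewrite /= nth_drop subnKC // lj.
      - by rewrite subnn.
    rewrite !lE !rcons_cat !rcons_cons -!cat_cons aG //= size_rcons size_take size_drop.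
    by rewrite size_map size_enum_ord ltn_ord; have := ltn_ord i; lia.
  move=> e a h; have := dG (0 :: rcons [seq e i | i <- enum 'I_n] 0)
    (1 :: rcons [seq a i | i <- enum 'I_n] 1).
  rewrite big_cons -(cats1 [seq e i | i <- enum 'I_n]) big_cat big_seq1 /= add0r addr0 big_map.
  rewrite big_enum; apply.
    by rewrite /= size_rcons size_map size_enum_ord.
  have h1 : homogs [:: 0] [:: 1] by split=> //; apply: ga_homog1.
  apply: (@homogs_cat [:: 0] _ [:: 1] _ h1); rewrite -cats1; apply: homogs_cat => //.
  by elim: (enum 'I_n) => [|i l IHl] //=; split.
move=> a; rewrite fE GE; last by rewrite /= size_rcons size_map size_enum_ord.
rewrite (@eq_mid _ _ _ _ (bar_of g)) => [|q]; last first.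
  by rewrite /= size_rcons size_map size_enum_ord => -[/GgE].
rewrite mid_bar_of; last by rewrite /= size_rcons size_map size_enum_ord.
rewrite mul1r /= nth_rcons size_map size_enum_ord ltnn eqxx mulr1.
congr (hdiff g _); apply/ffunP => i; rewrite ffunE nth_rcons size_map size_enum_ord ltn_ord.
by rewrite (nth_map i) ?size_enum_ord // nth_ord_enum.
Qed.

Lemma homogs_take j es s : homogs es s -> homogs (take j es) (take j s).
Proof.
by elim: j es s => [|j IHj] [|e es] [|x s] //= [xe h]; split=> //; apply: IHj.
Qed.

Lemma homogs_drop j es s : homogs es s -> homogs (drop j es) (drop j s).
Proof. by elim: j es s => [|j IHj] [|e es] [|x s] //= [xe h]; apply: IHj. Qed.

(** * Normalisation: cocycles vanishing on inner units *)

Lemma bar0 n : bar_cochain n (fun=> 0).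
Proof.
split=> [p x y s _|c a s _|c b s _|es s _ _]; rewrite ?addr0 ?mulr0 //.
exact: homog0.
Qed.

Lemma bar_cocycle_sub n F G : (forall s, size s = n.+3 -> qmid F s = 0) ->
  forall s, size s = n.+3 -> qmid (fun q => F q - qmid G q) s = 0.
Proof.
by move=> cF s sn; rewrite midB cF // mid_mid ?subrr //; [apply: mulrA | apply: algF2_addxx].
Qed.

Definition unit_fill j F s := F (take j s ++ 1 :: drop j s).

(** The first and the last position hold coefficients, so [p] and [q] are required to be
    nonempty. *)
Definition normal_upto j n F := forall p q, (0 < size p <= j)%N -> (0 < size q)%N ->
  (size p + (size q).+1)%N = n.+2 -> F (p ++ 1 :: q) = 0.

Lemma unit_fill_cat j F p q : size p = j -> unit_fill j F (p ++ q) = F (p ++ 1 :: q).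
Proof. by move=> pj; rewrite /unit_fill take_size_cat // drop_size_cat. Qed.

Lemma size_fill j s x : size (take j s ++ x :: drop j s) = (size s).+1.
Proof. by rewrite size_cat /= addnS -size_cat cat_take_drop. Qed.

Lemma bar_unit_fill j n F : (0 < j <= n.+1)%N -> bar_cochain n.+1 F ->
  bar_cochain n (unit_fill j F).
Proof.
case: j => // j; rewrite ltnS => /= jn [aF hF lF dF]; split.
- move=> p x y s ns; rewrite /unit_fill.
  have [jp|pj] := leqP j.+1 (size p).
    have h z : F (take j.+1 (p ++ z :: s) ++ 1 :: drop j.+1 (p ++ z :: s)) =
        F ((take j.+1 p ++ 1 :: drop j.+1 p) ++ z :: s).
      rewrite takel_cat // drop_cat -catA; move: jp; rewrite leq_eqVlt => /orP[/eqP jp|->] //.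
      by rewrite jp ltnn subnn drop0 drop_size.
    by rewrite !h aF // size_cat /= size_takel // size_drop !addnS subnKC //;
      move: ns; rewrite addnS => -[<-].
  have h z : F (take j.+1 (p ++ z :: s) ++ 1 :: drop j.+1 (p ++ z :: s)) =
      F (p ++ z :: (take (j - size p) s ++ 1 :: drop (j - size p) s)).
    have jp : (j.+1 < size p)%N = false by lia.
    by rewrite take_cat drop_cat jp subSn // -catA.
  by rewrite !h aF // size_fill; move: ns; rewrite !addnS => -[<-].
- move=> c a s sn; by rewrite /unit_fill /= hF // size_fill sn.
- move=> c b s sn.
  have h z : unit_fill j.+1 F (rcons s z) = F (rcons (take j.+1 s ++ 1 :: drop j.+1 s) z).
    rewrite /unit_fill -!cats1 takel_cat ?sn // drop_cat sn -catA; congr (F (_ ++ _ :: _)).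
    case: ltnP => // nj; have -> : j = n by apply/eqP; rewrite eqn_leq -ltnS jn.
    by rewrite subnn drop0 drop_oversize ?sn.
  by rewrite !h lF // size_fill sn.
- move=> es s sn h; have := dF (take j.+1 es ++ 0 :: drop j.+1 es)
    (take j.+1 s ++ 1 :: drop j.+1 s).
  rewrite size_fill sn big_cat big_cons /= add0r -big_cat cat_take_drop; apply => //.
  apply: homogs_cat; first exact: homogs_take.
  by split; [apply: ga_homog1 | apply: homogs_drop].
Qed.

Lemma mid_unit (G : seq Q -> Q) p a b q : qmid G (p ++ a :: 1 :: b :: q) =
  qmid (fun s => G (s ++ 1 :: b :: q)) (rcons p a)
  + qmid (fun s => G (p ++ a :: 1 :: s)) (b :: q).
Proof. by rewrite mid_expand mulr1 mul1r -[X in X + _]addrA algF2_addxx addr0. Qed.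

Lemma unit_fill_normal j n F p q : normal_upto j.-1 n F -> (0 < size p < j)%N ->
  (0 < size q)%N -> (size p + (size q).+1)%N = n.+1 -> unit_fill j F (p ++ 1 :: q) = 0.
Proof.
move=> nF /andP[p0 pj] q0 ns; rewrite /unit_fill take_cat drop_cat ltnNge (ltnW pj) /=.
have -> : (j - size p = (j - size p).-1.+1)%N by rewrite prednK // subn_gt0.
rewrite /= -catA /=; set l := _ ++ 1 :: _; apply: nF; rewrite ?p0 /=.
- by rewrite -ltnS prednK // (leq_ltn_trans _ pj).
- by rewrite size_fill.
- by rewrite size_fill addnS ns.
Qed.

(** The two merges of the given 1 with its neighbours cancel. If it stands before position j, all
    other terms contain a 1 where they vanish. If it stands at j, the cocycle equation at the list
    with this 1 doubled identifies the other terms with [F]. *)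
Lemma unit_fill_stage j n F : (0 < j <= n.+1)%N -> normal_upto j.-1 n.+1 F ->
  (forall s, size s = n.+4 -> qmid F s = 0) ->
  normal_upto j n.+1 (fun s => F s - qmid (unit_fill j F) s).
Proof.
move=> /andP[j0 jn] nF cF p q /andP[p0 pj] q0 ns.
case/lastP: p p0 pj ns => // p a _; case: q q0 => // b q _.
rewrite size_rcons cat_rcons mid_unit => pj ns.
have u0 u w : (0 < size u < j)%N -> (0 < size w)%N -> (size u + (size w).+1)%N = n.+2 ->
    unit_fill j F (u ++ 1 :: w) = 0 by apply: unit_fill_normal.
have first0 (G : seq Q -> Q) k : ((size p).+1 <= k)%N ->
    (forall u, (0 < size u < k)%N -> size u = size p -> G u = 0) -> qmid G (rcons p a) = 0.
  move=> pk G0; case: p {pj ns} pk G0 => [//|c p] pk G0; apply: mid_eq0 => u.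
  by rewrite size_rcons => -[up]; apply: G0; rewrite up.
rewrite (first0 _ _ pj) ?add0r => [|u uj up]; last by
  apply: u0 => //; rewrite up; case: ns.
move: pj; rewrite leq_eqVlt => /orP[/eqP pj|pj].
  have pa : size (rcons p a) = j by rewrite size_rcons.
  have -> : qmid (fun s => unit_fill j F (p ++ [:: a, 1 & s])) (b :: q) =
      qmid (fun s => F (p ++ [:: a, 1, 1 & s])) (b :: q).
    by apply: eq_mid => s _; rewrite -!(cat_rcons a) unit_fill_cat.
  have := cF (p ++ [:: a, 1, 1, b & q]); rewrite mid_unit mid_cons mul1r.
  rewrite (first0 _ j) ?add0r ?pj // => [|u uj up]; last first.
    apply: nF; rewrite ?up //; last by rewrite /= -ns /= addSn !addnS.
    by move: uj; rewrite up -pj.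
  move=> h; rewrite -[RHS]h; last by move: ns; rewrite !size_cat /= !addnS !addSn => -[->].
  by rewrite algF2_oppr.
have pa : (0 < size (rcons p a) < j)%N by rewrite size_rcons.
rewrite -cat_rcons nF ?sub0r //; last first.
- by rewrite size_rcons.
- by rewrite size_rcons /= -ltnS prednK.
case: q ns => [|c q] ns; first exact: oppr0.
rewrite mid_eq0 ?oppr0 // => s [sq]; rewrite -cat_rcons.
by apply: u0; rewrite ?pa // sq // size_rcons; move: ns; rewrite /= !addnS => -[<-].
Qed.

Lemma bar_normalise n F : bar_cochain n F -> (forall s, size s = n.+3 -> qmid F s = 0) ->
  if n is n'.+1 then exists2 G, bar_cochain n' G & normal_upto n n (fun s => F s - qmid G s)
  else True.
Proof.
case: n => // n bF cF.
suff /(_ n.+1 (leqnn _)) : forall j, (j <= n.+1)%N ->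
  exists2 G, bar_cochain n G & normal_upto j n.+1 (fun s => F s - qmid G s) by [].
elim=> [_|j IHj jn].
  exists (fun=> 0); first exact: bar0.
  by move=> p q; rewrite leqNgt; case: (size p).
have [G bG nG] := IHj (ltnW jn).
have bF' : bar_cochain n.+1 (fun s => F s - qmid G s) by apply: bar_sub bF _; apply: bar_mid.
have cF' := bar_cocycle_sub G cF.
exists (fun s => G s - unit_fill j.+1 (fun s => F s - qmid G s) s).
  by apply: bar_sub bG _; apply: bar_unit_fill bF'.
have := @unit_fill_stage j.+1 n _ jn nG cF'.
move=> h p q pj q0 ns; rewrite midB opprB addrA addrAC -[X in _ + X]algF2_oppr.
exact: h.
Qed.

End BarCochains.

(** * Elements of the connected sum *)

Section ConnectedSumElements.
Variables (B : comNzRingType) (hB : boolean B) (V : lmodType 'F_2).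
Local Notation A := (ca_alg (connsum (boolean_algebra hB) (dual_algebra V))).
Local Notation R := (aideal B V).
Local Notation homogA := (homog (ga_grading A)).

Fact posi_subproof (r : R) :
  ((0, r.1), (0, r.2)) \in @connsum_pred (boolean_algebra hB) (dual_algebra V).
Proof. by rewrite inE. Qed.

Definition posi (r : R) : A := exist _ ((0, r.1), (0, r.2)) (posi_subproof r).

Definition posp (a : A) : R := ((val a).1.2, (val a).2.2).
Definition unitp (a : A) : 'F_2 := (val a).1.1.

Lemma connsum_eq (a b : A) : unitp a = unitp b -> posp a = posp b -> a = b.
Proof.
have valE (c : A) : val c = ((unitp c, (posp c).1), (unitp c, (posp c).2)).
  case: c => -[[c1 c2] [c3 c4]] cP; have /= /eqP c13 := cP.
  by rewrite /unitp /posp /=; congr (_, (_, _)).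
by move=> ab pab; apply: val_inj; rewrite !valE ab pab.
Qed.

Lemma connsumC : commutative (@GRing.mul A).
Proof.
move=> a b; apply: val_inj; rewrite -[LHS]/(val a * val b) -[RHS]/(val b * val a).
by congr pair; apply: mulrC.
Qed.

Lemma posiD : {morph posi : x y / x + y}.
Proof. by move=> x y; apply: val_inj; rewrite /=; congr pair; congr pair; rewrite /= addr0. Qed.

Lemma posi0 : posi 0 = 0.
Proof. by apply: (addrI (posi 0)); rewrite -posiD !addr0. Qed.

Lemma posiM x y : posi x * posi y = posi (rmul x y).
Proof.
apply: val_inj; rewrite -[LHS]/(val (posi x) * val (posi y)) /=.
congr pair; congr pair; rewrite /= ?mulr0 //.
  by rewrite !mulr0n !add0r.
by rewrite !scale0r addr0.
Qed.

Lemma pospD : {morph posp : x y / x + y}.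
Proof. by []. Qed.

Lemma posp0 : posp 0 = 0. Proof. by []. Qed.
Lemma posp1 : posp 1 = 0. Proof. by []. Qed.

Lemma unitpD : {morph unitp : x y / x + y}.
Proof. by []. Qed.

Lemma posiK : cancel posi posp.
Proof. by case. Qed.

Lemma unitp_posi r : unitp (posi r) = 0.
Proof. by []. Qed.

Lemma unitp_alg (c : 'F_2) : unitp (c%:A) = c.
Proof. by rewrite -[LHS]/(c * 1) mulr1. Qed.

Lemma posp_alg (c : 'F_2) : posp (c%:A) = 0.
Proof. by case: (F2P c) => ->; rewrite ?scale0r ?scale1r. Qed.

Lemma connsum_eta a : a = (unitp a)%:A + posi (posp a).
Proof.
apply: connsum_eq; first by rewrite unitpD unitp_alg unitp_posi addr0.
by rewrite pospD posp_alg posiK add0r.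
Qed.

Definition mono n (r : R) : Prop := r.1 = r.1`_n *: 'X^n /\ (n = 0%N \/ r.2 = 0).

Lemma homog_posiP n r : homogA (Posz n.+1) (posi r) <-> mono n r.
Proof.
split.
  move=> /connsum_homogP[/= h1 h2]; split.
    by have := congr1 (fun x : boolAlg hB => x.2) h1.
  case: n h1 h2 => [|n] h1 h2; [by left | right].
  by have := congr1 (fun x : dualAlg V => x.2) h2.
move=> [r1 r2]; apply/connsum_homogP; split.
  by congr pair; rewrite /= -r1.
by case: n r1 r2 => [|n] r1 [//|r2] //; congr pair; rewrite /= r2.
Qed.

Lemma homog_posP n a : homogA (Posz n.+1) a -> a = posi (posp a) /\ mono n (posp a).
Proof.
move=> h; suff aE : a = posi (posp a) by split=> //; apply/homog_posiP; rewrite -aE.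
apply: connsum_eq => //; rewrite ?posiK //.
have /connsum_homogP[h1 _] := h.
by have := congr1 (fun x : boolAlg hB => x.1) h1.
Qed.

Lemma homog_0P a : homogA 0 a -> a = (unitp a)%:A.
Proof.
move=> /connsum_homogP[h1 h2]; apply: connsum_eq; rewrite ?unitp_alg // posp_alg.
congr pair; [have := congr1 (fun x : boolAlg hB => x.2) h1 |
  have := congr1 (fun x : dualAlg V => x.2) h2]; exact: esym.
Qed.

Lemma homog_negP n a : homogA (Negz n) a -> a = 0.
Proof. by rewrite /homog gcomp_neg. Qed.

End ConnectedSumElements.

(** * Non-positive total degree *)

(* lia does not identify the instances of size at the convertible carriers
   produced by canonical structure inference. *)
Ltac size_lia :=
  cbn [size] in *; rewrite -?cats1 ?size_cat /=;
  repeat match goal with H : context [size (_ ++ _)] |- _ => rewrite size_cat /= in H end;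
  repeat match goal with
  | |- context [@size ?T ?s] => is_var s; let k := fresh "k" in set (k := @size T s) in *;
      repeat match goal with
      | |- context [@size ?U s] => change (@size U s) with k
      | H : context [@size ?U s] |- _ => change (@size U s) with k in H
      end; clearbody k
  | H : context [@size ?T ?s] |- _ => is_var s; let k := fresh "k" in set (k := @size T s) in *;
      repeat match goal with
      | H' : context [@size ?U s] |- _ => change (@size U s) with k in H'
      end; clearbody k
  end; lia.

Lemma seq_split (T : Type) (s : seq T) i : (i < size s)%N ->
  exists p x q, s = p ++ x :: q /\ size p = i.
Proof.
elim: s i => // x s IHs [_|i /IHs[p [y [q [-> pi]]]]]; first by exists [::], x, s.
by exists (x :: p), y, q; rewrite /= pi.
Qed.

Lemma mid_rcons_eq0 (T : Type) (mul : T -> T -> T) (W : zmodType) (G : seq T -> W) p a :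
  (forall u, (0 < size u)%N -> size u = size p -> G u = 0) -> mid mul G (rcons p a) = 0.
Proof.
case: p => [//|c p] G0; apply: mid_eq0 => u.
by rewrite size_rcons => -[up]; apply: G0; rewrite up.
Qed.

Section LowDegree.
Variables (B : comNzRingType) (hB : boolean B) (V : lmodType 'F_2) (m : int).
Local Notation A := (ca_alg (connsum (boolean_algebra hB) (dual_algebra V))).
Local Notation R := (aideal B V).
Local Notation homogA := (homog (ga_grading A)).
Local Notation amid := (@mid A *%R A).
Implicit Types (F : seq A -> A) (p q s : seq A) (a b : A) (x y : {poly B}).

Let iot (r : R) : A := posi hB r.
Let tA : A := iot (tR B V).
Let tpart x : A := iot (x, 0).

Let tpart_t : tA = tpart 1. Proof. by []. Qed.

Let tpart_mul x a : exists y, tpart x * a = tpart y.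
Proof.
rewrite [a]connsum_eta mulrDr -scalerAr mulr1 /tpart /iot posiM.
have [->|->] := F2P (unitp a).
  by rewrite scale0r add0r; eexists; rewrite /rmul.
by rewrite scale1r -posiD; eexists; rewrite /rmul; congr (posi hB (_, _)); rewrite addr0.
Qed.

Let tA_tpart x : tA * tpart x = tpart ('X * x).
Proof. by rewrite /tA /tpart /iot posiM; congr (posi hB (_, _)); rewrite /= mul1r mulrC. Qed.

Let tAX_tpart l x : tA ^+ l * tpart x = tpart ('X^l * x).
Proof.
elim: l => [|l IHl]; first by rewrite !expr0 !mul1r.
by rewrite exprS -mulrA IHl tA_tpart mulrA -exprS.
Qed.

Definition shA l a : A := iot (shiftR l (posp a)).

Lemma shA_tpart l a : shA l a = tpart (drop_poly l.+1 (posp a).1).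
Proof. by []. Qed.

Lemma homog_tA : homogA 1 tA.
Proof.
apply/homog_posiP; split; last by left.
by rewrite /= coef1 expr0 scale1r.
Qed.

Lemma homog_tAX l : homogA (Posz l) (tA ^+ l).
Proof.
elim: l => [|l IHl]; first exact: ga_homog1.
by rewrite exprS; apply: (ga_homogM homog_tA IHl).
Qed.

Lemma shA_tA l : shA l tA = 0.
Proof. by rewrite /shA posiK shiftR_t /iot posi0. Qed.

(** Transfers powers of t from [b] to its left neighbour [a]: term l divides [b] by t^(l+1), leaves
    one t as an argument of its own and multiplies [a] by t^l, so the total degree is unchanged. *)
Definition slide i F s : A :=
  if drop i s is a :: b :: q then
    \sum_(l < size (posp b).1) F (take i s ++ [:: tA ^+ l * a, tA, shA l b & q])
  else 0.

Lemma slide_cat i F p a b q : size p = i -> slide i F (p ++ a :: b :: q) =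
  \sum_(l < size (posp b).1) F (p ++ [:: tA ^+ l * a, tA, shA l b & q]).
Proof. by move=> pi; rewrite /slide drop_size_cat // take_size_cat. Qed.

Section Add.
Variables (n : nat) (F : seq A -> A).
Hypothesis bF : bar_cochain m n F.

Lemma barD p a b q : (size p + (size q).+1)%N = n.+2 ->
  F (p ++ (a + b) :: q) = F (p ++ a :: q) + F (p ++ b :: q).
Proof. exact: (bar_add bF). Qed.

Lemma bar_0 p q : (size p + (size q).+1)%N = n.+2 -> F (p ++ 0 :: q) = 0.
Proof. exact: (multiadd0 (bar_add bF)). Qed.

(** The number of terms depends on [b]; with a common bound [N], additivity in [b] can be checked
    term by term. *)
Lemma slide_bound N p a b q : (size p + (size q).+3)%N = n.+2 -> (size (posp b).1 <= N)%N ->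
  slide (size p) F (p ++ a :: b :: q) =
  \sum_(l < N) F (p ++ [:: tA ^+ l * a, tA, shA l b & q]).
Proof.
move=> sn bN; rewrite slide_cat //.
apply: (shiftR_sum (H := fun l r => F (p ++ [:: tA ^+ l * a, tA, iot r & q]))) => // l.
rewrite /iot posi0; have := @bar_0 (p ++ [:: tA ^+ l * a; tA]) q.
by rewrite -catA; apply; size_lia.
Qed.

End Add.

Lemma bar_slide i n F : (i < n)%N -> bar_cochain m n.+1 F -> bar_cochain m n (slide i F).
Proof.
move=> i_n bF; split.
- move=> p a b s ns; have [ip|pi|pi] := ltngtP (size p) i.
  + have [|s1 [c [s2 [sE s1i]]]] := @seq_split _ s (i - (size p).+1); first by size_lia.
    subst s; case: s2 ns => [|d q] ns; first by exfalso; size_lia.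
    have sli z : slide i F (p ++ z :: s1 ++ [:: c, d & q]) =
        \sum_(l < size (posp d).1) F (p ++ z :: (s1 ++ [:: tA ^+ l * c, tA, shA l d & q])).
      rewrite -cat_cons catA slide_cat; last by size_lia.
      by apply: eq_bigr => l _; rewrite -catA.
    rewrite !sli -big_split; apply: eq_bigr => l _; apply: (barD bF); size_lia.
  + have [|s1 [c [s2 [sE s1i]]]] := @seq_split _ p i; first by size_lia.
    subst p; case: s2 ns pi => [|d q] ns pi.
      rewrite -!catA /= -s1i.
      pose N := maxn (size (posp (a + b)).1) (maxn (size (posp a).1) (size (posp b).1)).
      rewrite !(slide_bound bF (N := N)) ?leq_max ?leqnn ?orbT //; try size_lia.
      rewrite -big_split; apply: eq_bigr => l _.
      rewrite /shA pospD shiftRD /iot posiD.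
      have := @barD _ _ bF (s1 ++ [:: tA ^+ l * c; tA]) (iot (shiftR l (posp a))) (iot (shiftR l (posp b))) s.
      by rewrite -!catA; apply; size_lia.
    have sli z : slide i F ((s1 ++ [:: c, d & q]) ++ z :: s) =
        \sum_(l < size (posp d).1) F ((s1 ++ [:: tA ^+ l * c, tA, shA l d & q]) ++ z :: s).
      rewrite -catA slide_cat //.
      by apply: eq_bigr => l _; rewrite -catA.
    rewrite !sli -big_split; apply: eq_bigr => l _; apply: (barD bF); size_lia.
  + case: s ns => [|d q] ns; first by exfalso; size_lia.
    rewrite !slide_cat // -big_split; apply: eq_bigr => l _.
    by rewrite mulrDr; apply: (barD bF); size_lia.
- move=> c a s sn; have [i0|i0] := posnP i.
    subst i; case: s sn => [|d q] sn; first by exfalso; size_lia.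
    rewrite !(slide_cat _ (p := [::])) // mulr_sumr; apply: eq_bigr => l _.
    have -> : tA ^+ l * (c * a) = c * (tA ^+ l * a).
      by rewrite mulrA [_ * c]connsumC -mulrA.
    by apply: (bar_head bF); size_lia.
  have [|s1 [d [s2 [sE s1i]]]] := @seq_split _ s i.-1; first by size_lia.
  subst s; case: s2 sn => [|e q] sn; first by exfalso; size_lia.
  have sli z : slide i F (z :: s1 ++ [:: d, e & q]) =
      \sum_(l < size (posp e).1) F (z :: (s1 ++ [:: tA ^+ l * d, tA, shA l e & q])).
    by rewrite -cat_cons slide_cat //=; size_lia.
  rewrite !sli mulr_sumr; apply: eq_bigr => l _.
  by apply: (bar_head bF); size_lia.
- move=> c b s sn; have [|s1 [d [s2 [sE s1i]]]] := @seq_split _ s i; first by size_lia.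
  subst s; case: s2 sn => [|e q] sn; first by exfalso; size_lia.
  have sli z : slide i F (rcons (s1 ++ [:: d, e & q]) z) =
      \sum_(l < size (posp e).1) F (rcons (s1 ++ [:: tA ^+ l * d, tA, shA l e & q]) z).
    rewrite -cats1 -catA /= slide_cat //; apply: eq_bigr => l _.
    by rewrite -cats1 -catA.
  rewrite !sli mulr_sumr; apply: eq_bigr => l _.
  by apply: (bar_last bF); size_lia.
- move=> es s sn h; have [|s1 [d [s2 [sE s1i]]]] := @seq_split _ s i; first by size_lia.
  subst s; case: s2 sn h => [|x q] sn h; first by exfalso; size_lia.
  have [esn _] := homogs_nth h; rewrite size_cat /= in esn.
  have [|es1 [d' [es2 [esE es1i]]]] := @seq_split _ es i; first by size_lia.
  subst es; case: es2 esn h => [|ex eq] esn h; first by exfalso; size_lia.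
  have := homogs_take i h; have := homogs_drop i h.
  rewrite !take_size_cat // !drop_size_cat // => -[hd [hx hq]] h1.
  rewrite slide_cat //; case: ex hx {esn h} => [[|n']|n'] hx.
  + by rewrite (homog_0P hx) posp_alg size_poly0 big_ord0; apply: homog0.
  + have [xE xn] := homog_posP hx.
    have sx : (size (posp x).1 <= n'.+1)%N.
      by rewrite xn.1 (leq_trans (size_scale_leq _ _)) // size_polyXn.
    apply: big_ind => [||l _]; [exact: homog0 | move=> u v; exact: homogD | ].
    (* Dividing degree n' + 1 by t^(l+1) leaves degree n' - l, which is positive only for l < n';
       otherwise [shA l x] is 0. *)
    have [ln|nl] := ltnP l n'; last first.
      rewrite shA_tpart drop_poly_eq0; last first.
        exact: leq_trans sx _.
      rewrite /tpart /iot posi0; have := @bar_0 _ _ bF (s1 ++ [:: tA ^+ l * d; tA]) q.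
      by rewrite -catA => ->; [apply: homog0 | size_lia].
    have := bar_deg bF (es := es1 ++ [:: Posz l + d', 1, Posz (n' - l) & eq])
      (s := s1 ++ [:: tA ^+ l * d, tA, shA l x & q]).
    have -> : \sum_(e <- es1 ++ [:: d', Posz n'.+1 & eq]) e =
        \sum_(e <- es1 ++ [:: Posz l + d', 1, Posz (n' - l) & eq]) e.
      rewrite !big_cat !big_cons /= -subzn ?(ltnW ln) // -addn1 PoszD.
      by move: (\sum_(j <- es1) j) (\sum_(j <- eq) j) => u v; ring.
    apply; first by size_lia.
    apply: homogs_cat => //; split; last split; last split=> //.
    + by apply: ga_homogM => //; apply: homog_tAX.
    + exact: homog_tA.
    + have -> : Posz (n' - l) = Posz (n' - l).-1.+1 by rewrite prednK // subn_gt0.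
      apply/homog_posiP; split; last by right.
      have pE j : (posp x).1`_j = (posp x).1`_n' * (j == n')%:R.
        by rewrite {1}xn.1 coefZ coefXn.
      rewrite -[(shiftR _ _).1]/(drop_poly l.+1 (posp x).1).
      apply/polyP => j; rewrite coefZ coefXn !coef_drop_poly.
      have -> : ((n' - l).-1 + l.+1 = n')%N by lia.
      by rewrite pE; congr (_ * _%:R); congr nat_of_bool; lia.
  + by rewrite (@homog_negP _ hB V _ _ hx) posp0 size_poly0 big_ord0; apply: homog0.
Qed.

Definition killed i n F := forall p x q, size p = i -> (0 < size q)%N ->
  (size p + (size q).+2)%N = n.+2 -> F (p ++ [:: tA, tpart x & q]) = 0.

Section Balanced.
Variables (n j : nat) (F : seq A -> A).
Hypotheses (bF : bar_cochain m n F) (cF : forall s, size s = n.+3 -> amid F s = 0).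
Hypothesis kF : forall i, (0 < i <= j)%N -> killed i n F.

Lemma mid_killed p a x b q : (size p <= j)%N -> (size p + (size q).+4)%N = n.+3 ->
  amid F (p ++ [:: a, tA, tpart x, b & q]) =
  F (p ++ [:: tA * a, tpart x, b & q]) + F (p ++ [:: a, tA * tpart x, b & q])
  + amid (fun s => F (p ++ [:: a, tA & s])) [:: tpart x, b & q].
Proof.
move=> pj ns; rewrite mid_expand mid_rcons_eq0 ?add0r => [|u u0 up].
  by rewrite [a * tA]connsumC.
apply: kF; rewrite ?u0 ?up //=; first by size_lia.
by size_lia.
Qed.

(** In the cocycle equation at (p, a, t, t x, b, q) every term that keeps t followed by a multiple
    of t is killed, which leaves the two merges of t. As [q] is nonempty, the product (t x) b is
    still an inner argument. *)
Lemma balanced p a x b q : ((size p).+1 <= j)%N -> (size p + (size q).+3)%N = n.+2 ->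
  (0 < size q)%N ->
  F (p ++ [:: tA * a, tpart x, b & q]) = F (p ++ [:: a, tA * tpart x, b & q]).
Proof.
move=> pj ns q0.
have := cF (s := p ++ [:: a, tA, tpart x, b & q]); rewrite mid_killed ?(ltnW pj) //; last by size_lia.
have kp y r : (0 < size r)%N -> size r = size q -> F (p ++ [:: a, tA, tpart y & r]) = 0.
  move=> r0 rq; have := @kF (size p).+1 pj (rcons p a) y r.
  by rewrite cat_rcons size_rcons; apply => //; size_lia.
have -> : amid (fun s => F (p ++ [:: a, tA & s])) [:: tpart x, b & q] = 0.
  have [y xy] := tpart_mul x b; rewrite mid_cons xy kp // add0r.
  by apply: mid_eq0 => s [sq]; apply: kp; rewrite sq.
rewrite addr0 => h; apply: algF2_eq; apply: h; size_lia.
Qed.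

Lemma balanced_cat p a x r : ((size p).+1 <= j)%N -> (1 < size r)%N ->
  (size p + (size r).+2)%N = n.+2 ->
  F (p ++ [:: tA * a, tpart x & r]) = F (p ++ [:: a, tA * tpart x & r]).
Proof. by case: r => [|b [|c r]] // pj _ ns; apply: balanced. Qed.

(* In the last inner position the merge of x with the coefficient b survives. *)
Lemma balanced_last p a x b : (size p <= j)%N -> (size p + 3)%N = n.+2 ->
  F (p ++ [:: a; tA * tpart x; b]) = F (p ++ [:: tA * a; tpart x; b])
    + F (p ++ [:: a; tA; tpart x * b]).
Proof.
move=> pj ns; have := cF (s := p ++ [:: a; tA; tpart x; b]); rewrite mid_killed //.
  rewrite mid_cons /= addr0 => h; apply: (@algF2_eq A); rewrite addrA [X in X + _]addrC.
  by apply: h; size_lia.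
by size_lia.
Qed.

Lemma balancedX l p a x b q : ((size p).+1 <= j)%N -> (size p + (size q).+3)%N = n.+2 ->
  (0 < size q)%N ->
  F (p ++ [:: tA ^+ l * a, tpart x, b & q]) = F (p ++ [:: a, tA ^+ l * tpart x, b & q]).
Proof.
move=> pj ns q0; elim: l a => [|l IHl] a; first by rewrite !expr0 !mul1r.
by rewrite exprSr -mulrA IHl tAX_tpart balanced // -tAX_tpart mulrA -exprS exprSr.
Qed.

(** Carrying l of the l + 1 factors to the left leaves the killed pair t, t. *)
Lemma killed_tt l p z q : (0 < size p <= j)%N -> (0 < size q)%N ->
  (size p + (size q).+3)%N = n.+2 -> F (p ++ [:: tA ^+ l.+1, tA, z & q]) = 0.
Proof.
case/lastP: p => [|p a] // pj q0 ns; rewrite size_rcons in pj ns.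
rewrite cat_rcons exprSr; have -> : F (p ++ [:: a, tA ^+ l * tA, tA, z & q]) =
    F (p ++ [:: tA ^+ l * a, tA, tA, z & q]).
  by apply/esym; apply: (@balancedX l p a 1 tA (z :: q)) => //; size_lia.
have := @kF (size p).+1 pj (rcons p (tA ^+ l * a)) 1 (z :: q).
by rewrite cat_rcons size_rcons -!tpart_t; apply => //; size_lia.
Qed.

End Balanced.

(** * One stage of the homotopy that moves t to the left *)

Section Stage.
Variables (n i0 : nat) (F : seq A -> A).
Hypotheses (bF : bar_cochain m n.+1 F) (cF : forall s, size s = n.+4 -> amid F s = 0).
Hypotheses (i0n : (i0 < n)%N) (kF : forall i, (0 < i <= i0)%N -> killed i n.+1 F).
Let G := slide i0 F.

Let slide_after p u a b r : (size p + (size u) = i0)%N ->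
  G (p ++ u ++ [:: a, b & r]) =
  \sum_(l < size (posp b).1) F (p ++ u ++ [:: tA ^+ l * a, tA, shA l b & r]).
Proof.
move=> pu; rewrite /G catA slide_cat ?size_cat //.
by apply: eq_bigr => l _; rewrite catA.
Qed.

(** A pair away from position [i0] is unchanged. At [i0] it becomes t^(l+1), t, treated by
    [killed_tt]; one place earlier, t y absorbs the factor t^l. *)
Lemma slide_killed p y q : (0 < size p <= i0)%N -> (size p + (size q).+2)%N = n.+2 ->
  G (p ++ [:: tA, tpart y & q]) = 0.
Proof.
move=> /andP[p0 pi] ns; have kp x r : (0 < size r)%N -> (size p + (size r).+2 = n.+3)%N ->
    F (p ++ [:: tA, tpart x & r]) = 0.
  by move=> r0 rs; apply: (@kF (size p)) => //; rewrite p0 pi.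
move: pi; rewrite leq_eqVlt => /orP[/eqP pi|].
  have := slide_after (p := p) (u := [::]) tA (tpart y) q; rewrite addn0 => /(_ pi) ->.
  apply: big1 => l _; rewrite -exprSr /=; apply: (killed_tt cF kF); rewrite ?p0 ?pi //; size_lia.
rewrite leq_eqVlt => /orP[/eqP pi|pi].
  case: q ns => [|b q] ns; first by exfalso; size_lia.
  have := slide_after (p := p) (u := [:: tA]) (tpart y) b q; rewrite addn1 => /(_ pi) /= ->.
  by apply: big1 => l _; rewrite tAX_tpart; apply: kp => //; size_lia.
have [|q1 [a [q2 [qE q1i]]]] := @seq_split _ q (i0 - (size p).+2); first by size_lia.
subst q; case: q2 ns => [|b q] ns; first by exfalso; size_lia.
have := slide_after (p := p) (u := [:: tA, tpart y & q1]) a b q; rewrite /= => ->.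
  by apply: big1 => l _; apply: kp; size_lia.
by size_lia.
Qed.

Lemma slide_balanced p c y q : ((size p).+1 <= i0)%N -> (size p + (size q).+2)%N = n.+2 ->
  G (p ++ [:: tA * c, tpart y & q]) = G (p ++ [:: c, tA * tpart y & q]).
Proof.
rewrite leq_eqVlt => /orP[/eqP pi|pi] ns.
  case: q ns => [|b q] ns; first by exfalso; size_lia.
  have sl z w : G (p ++ [:: z, w, b & q]) =
      \sum_(l < size (posp b).1) F (p ++ [:: z, tA ^+ l * w, tA, shA l b & q]).
    by apply: (slide_after (u := [:: z])); rewrite addn1.
  rewrite !sl; apply: eq_bigr => l _ /=.
  rewrite tAX_tpart (balanced_cat cF kF) ?pi //=; last by size_lia.
  by rewrite -tAX_tpart !mulrA -exprS exprSr.
have [|q1 [a [q2 [qE q1i]]]] := @seq_split _ q (i0 - (size p).+2); first by size_lia.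
subst q; case: q2 ns => [|b q] ns; first by exfalso; size_lia.
have sl z w : G (p ++ [:: z, w & q1 ++ [:: a, b & q]]) =
    \sum_(l < size (posp b).1) F (p ++ [:: z, w & q1 ++ [:: tA ^+ l * a, tA, shA l b & q]]).
  by apply: (slide_after (u := [:: z, w & q1])); size_lia.
rewrite !sl.
by apply: eq_bigr => l _; apply: (balanced_cat cF kF); size_lia.
Qed.

Lemma slide_t p a q : size p = i0 -> (size p + (size q).+2)%N = n.+2 ->
  G (p ++ [:: a, tA & q]) = 0.
Proof.
move=> pi ns; rewrite /G slide_cat //; apply: big1 => l _.
rewrite shA_tA.
have := @bar_0 _ _ bF (p ++ [:: tA ^+ l * a; tA]) q.
by rewrite -catA; apply; size_lia.
Qed.

(** Term l + 1 of the second sum equals term l of the first, so only term 0 of the second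
    survives. *)
Lemma slide_telescope p a y q : size p = i0 -> (size p + (size q).+2)%N = n.+2 ->
  G (p ++ [:: tA * a, tpart y & q]) + G (p ++ [:: a, tA * tpart y & q]) =
  F (p ++ [:: a, tA, tpart y & q]).
Proof.
move=> pi ns; have sb a' x N : (size x <= N)%N -> G (p ++ [:: a', tpart x & q]) =
    \sum_(l < N) F (p ++ [:: tA ^+ l * a', tA, tpart (drop_poly l.+1 x) & q]).
  by move=> xN; rewrite /G -pi; apply: (slide_bound bF) => //; size_lia.
have yX : (size ('X * y)%R <= (size y).+1)%N.
  by rewrite mulrC; have [->|y0] := eqVneq y 0; rewrite ?mul0r ?size_poly0 // size_mulX.
rewrite tA_tpart (sb _ _ _ (leqnn _)) (sb _ _ _ yX) big_ord_recl expr0 mul1r addrCA.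
have drX k : drop_poly k.+1 ('X * y) = drop_poly k y.
  by apply/polyP => j; rewrite !coef_drop_poly coefXM addnS.
rewrite drX drop_poly0l [X in _ + X](_ : _ = 0) ?addr0 //.
rewrite -big_split; apply: big1 => l _ /=; rewrite /bump leq0n add1n drX.
by rewrite mulrA -exprSr; apply: (@algF2_addxx A).
Qed.

(** The two merges of t in [amid G] add up to [F] at position i0 + 1 by [slide_telescope] and cancel
    at earlier positions by [slide_balanced]. The other merges lead to lists on which [G]
    vanishes. *)
Lemma slide_stage i : (0 < i <= i0.+1)%N -> killed i n.+1 (fun s => F s - amid G s).
Proof.
move=> /andP[i_gt0 ii] p x q pi q0 ns.
case/lastP: p pi ns i_gt0 => [<-//|p a]; rewrite size_rcons cat_rcons => pi ns _.
rewrite mid_expand mid_rcons_eq0 ?add0r => [|u u0 up]; last first.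
  by apply: slide_killed; [rewrite u0 up; size_lia | size_lia].
move: ii; rewrite -pi ltnS leq_eqVlt => /orP[/eqP pi0|pi0].
  rewrite [a * tA]connsumC slide_telescope //; last by size_lia.
  rewrite mid_eq0 ?addr0 ?subrr // => s [sq].
  by apply: slide_t => //; size_lia.
have kG y r : (size p + (size r).+3)%N = n.+2 -> G (p ++ [:: a, tA, tpart y & r]) = 0.
  move=> nr; rewrite -cat_rcons; apply: slide_killed; rewrite size_rcons ?pi0 //; size_lia.
rewrite [a * tA]connsumC slide_balanced //; last by size_lia.
rewrite (@algF2_addxx A) add0r -cat_rcons (kF (i := i)) ?size_rcons ?pi //; last first.
- by size_lia.
- by rewrite -pi.
rewrite sub0r; case: q q0 ns => [//|b q] _ ns.
have [y xy] := tpart_mul x b; rewrite mid_cons xy kG ?add0r; last by size_lia.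
by rewrite mid_eq0 ?oppr0 // => s [sq]; apply: kG; size_lia.
Qed.

(** A 1 at position i0 + 1 makes the sum empty. At i0 the term l = 0 keeps the 1, while the others
    contain t^l, t with l > 0. Elsewhere the 1 persists in every term. *)
Lemma slide_normal : normal_upto n.+1 n.+1 F -> normal_upto n n G.
Proof.
move=> nF p q /andP[p0 pn] q0 ns.
have n1 u r : (0 < size u)%N -> (0 < size r)%N -> (size u + (size r).+1)%N = n.+3 ->
    F (u ++ 1 :: r) = 0 by move=> u0 r0 us; apply: nF => //; rewrite u0; size_lia.
have [ip|pi|pi] := ltngtP (size p) i0.
- have [|q1 [a [q2 [qE q1i]]]] := @seq_split _ q (i0 - (size p).+1); first by size_lia.
  subst q; case: q2 q0 ns => [|b q] q0 ns; first by exfalso; size_lia.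
  have := slide_after (p := p) (u := 1 :: q1) a b q; rewrite /= => ->; last by size_lia.
  by apply: big1 => l _; apply: n1 => //; size_lia.
- have [|p1 [a [p2 [pE p1i]]]] := @seq_split _ p i0; first by size_lia.
  subst p; case: p2 p0 pn pi ns => [|b p2] p0 pn pi ns.
    by rewrite -catA /= /G slide_cat // posp1 size_poly0 big_ord0.
  rewrite -catA /= /G slide_cat //; apply: big1 => l _.
  have := n1 (p1 ++ [:: tA ^+ l * a, tA, shA l b & p2]) q; rewrite -catA; apply => //.
    by size_lia.
  by size_lia.
- case: q q0 ns => [//|b q] _ ns; rewrite /G slide_cat //; apply: big1 => -[[|l] lb] _ /=.
    by rewrite expr0 mul1r; apply: n1 => //; size_lia.
  have q0 : (0 < size q)%N by size_lia.
  rewrite mulr1; apply: (killed_tt cF kF) => //; rewrite ?p0 ?pi ?leqnn //.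
  by size_lia.
Qed.

End Stage.

Lemma mid_normal n G : normal_upto n n G -> normal_upto n.+1 n.+1 (amid G).
Proof.
move=> nG p q /andP[p0 pn] q0 ns.
case/lastP: p p0 pn ns => [//|p a] _; rewrite size_rcons cat_rcons => pn ns.
case: q q0 ns => [//|b q] _ ns; rewrite mid_unit mid_rcons_eq0 ?add0r => [|u u0 up].
  case: q ns => [//|c q] ns; apply: mid_eq0 => s [sq]; rewrite -cat_rcons.
  by apply: nG; rewrite ?size_rcons ?sq //; size_lia.
by apply: nG; rewrite ?u0 ?up //; size_lia.
Qed.

Lemma slide_reduction n F : bar_cochain m n.+1 F -> normal_upto n.+1 n.+1 F ->
  (forall s, size s = n.+4 -> amid F s = 0) ->
  exists2 G, bar_cochain m n G &
    let F' s := F s - amid G s in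
    normal_upto n.+1 n.+1 F' /\ forall i, (0 < i <= n)%N -> killed i n.+1 F'.
Proof.
move=> bF nF cF.
suff /(_ n (leqnn _)) : forall i0, (i0 <= n)%N -> exists2 G, bar_cochain m n G &
    let F' s := F s - amid G s in
    normal_upto n.+1 n.+1 F' /\ forall i, (0 < i <= i0)%N -> killed i n.+1 F' by [].
elim=> [_|i0 IH i0n].
  exists (fun=> 0); first exact: bar0.
  split=> [p q pn q0 ns|i]; last by rewrite leqNgt; case: i.
  by rewrite nF // mid0 subrr.
have [G bG [nF' kF']] := IH (ltnW i0n).
have bF' : bar_cochain m n.+1 (fun s => F s - amid G s).
  by apply: bar_sub bF _; apply: bar_mid bG; apply: connsumC.
have cF' := bar_cocycle_sub G cF.
pose H := slide i0 (fun s => F s - amid G s).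
have FE s : F s - amid (fun q => G q - H q) s = F s - amid G s - amid H s.
  by rewrite midB opprB addrA addrAC -[X in _ + X](@algF2_oppr A).
exists (fun s => G s - H s); first by apply: bar_sub bG _; apply: bar_slide.
split=> [p q pn q0 ns|i i_i0 p x q pi q0 ns]; rewrite FE.
  rewrite nF' // sub0r (mid_normal (slide_normal cF' i0n kF' nF')) ?oppr0 //.
exact: (slide_stage bF' cF' i0n kF' i_i0).
Qed.

Lemma homogs_deg1_posi (v : V) : homogA 1 (iot (0, v)).
Proof. by apply/homog_posiP; split; [rewrite /= coef0 scale0r | left]. Qed.

Lemma homog_tpartC (c : B) : homogA 1 (tpart c%:P).
Proof. by apply/homog_posiP; split; [rewrite /= coefC eqxx expr0 alg_polyC | left]. Qed.

(** Arguments are reduced to degree 1 from the right. In the next one the scalar part dies by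
    normalisation, the part of degree 1 is already reduced, and a factor t of the rest is carried to
    the left neighbour, which is still arbitrary. *)
Lemma homogs1_vanish n F : bar_cochain m n F -> normal_upto n n F ->
  (forall s, size s = n.+3 -> amid F s = 0) ->
  (forall i, (0 < i < n)%N -> killed i n F) ->
  (forall s, size s = n -> homogs (nseq n 1) s -> F (1 :: rcons s 1) = 0) ->
  forall s, size s = n.+2 -> F s = 0.
Proof.
move=> bF nF cF kF F1.
suff P i : (i <= n)%N -> forall p q b, size p = i.+1 -> (size q + i = n)%N ->
    homogs (nseq (size q) 1) q -> F (p ++ q ++ [:: b]) = 0.
  move=> s; case/lastP: s => [//|s b]; rewrite size_rcons => -[sn].
  by rewrite -cats1; apply: (P n (leqnn _) s [::] b).
elim: i => [_|i IHi i_n] p q b pi qn hq.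
  case: p pi => [//|a [|//]] _; rewrite (bar_ofK (@connsumC _ hB V) bF) /=; last by size_lia.
  rewrite addn0 in qn; rewrite take_size_cat // F1 ?mulr0 ?mul0r //.
  by rewrite -qn.
case/lastP: p pi => [//|p x]; rewrite size_rcons cat_rcons => -[pi].
have IH (z : A) p' : size p' = i.+1 -> homogA 1 z -> F (p' ++ z :: q ++ [:: b]) = 0.
  by move=> pi' hz; apply: (IHi (ltnW i_n) p' (z :: q) b) => //; size_lia.
have bD (u w : A) p' : size p' = i.+1 -> F (p' ++ (u + w) :: q ++ [:: b]) =
    F (p' ++ u :: q ++ [:: b]) + F (p' ++ w :: q ++ [:: b]).
  by move=> pi'; apply: (barD bF); size_lia.
have b0 p' : size p' = i.+1 -> F (p' ++ 0 :: q ++ [:: b]) = 0.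
  by move=> pi'; apply: (bar_0 bF); size_lia.
rewrite [x]connsum_eta bD // [X in X + _](_ : _ = 0) ?add0r; last first.
  have [->|->] := F2P (unitp x); first by rewrite scale0r b0.
  by rewrite scale1r; apply: nF; rewrite ?pi //; size_lia.
have -> : posi hB (posp x) = iot (0, (posp x).2) + tpart (posp x).1.
  by rewrite -posiD; congr posi; congr pair; rewrite /= ?add0r ?addr0.
rewrite bD // IH ?add0r //; last exact: homogs_deg1_posi.
have kF' i' : (0 < i' <= n.-1)%N -> killed i' n F by move=> i'n; apply: kF; lia.
elim/poly_ind: (posp x).1 p pi => {x} [|f c IHf] p pi.
  by rewrite /tpart /iot posi0 b0.
have -> : tpart (f * 'X + c%:P) = tA * tpart f + tpart c%:P.
  by rewrite tA_tpart mulrC /tpart /iot -posiD; congr (posi hB (_, _)); rewrite addr0.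
rewrite bD // (IH (tpart c%:P)) ?addr0 //; last exact: homog_tpartC.
case/lastP: p pi => [//|p a]; rewrite size_rcons cat_rcons => -[pi].
case: q qn hq IH bD b0 IHf => [|d q] qn hq IH bD b0 IHf.
  (* The extra term of [balanced_last] has t, of degree 1, as its last argument, so induction covers
     it. *)
  rewrite (balanced_last cF kF') //; try size_lia.
  rewrite -!(cat_rcons _ p) IHf ?size_rcons ?pi // add0r.
  apply: (IHi (ltnW i_n) (rcons p a) [:: tA] (tpart f * b)); rewrite ?size_rcons ?pi //.
  by split=> //; apply: homog_tA.
rewrite -(balanced_cat cF kF') //; try size_lia.
by rewrite -(cat_rcons _ p) IHf // size_rcons pi.
Qed.

End LowDegree.

Lemma mid_ind (T : Type) (mul : T -> T -> T) (W : zmodType) (P : W -> Prop) (G : seq T -> W) s :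
  P 0 -> (forall x y, P x -> P y -> P (x + y)) ->
  (forall p a b q, s = p ++ a :: b :: q -> P (G (p ++ mul a b :: q))) -> P (mid mul G s).
Proof.
move=> P0 PD; elim: s G => [|x [|y s] IHs] G PG //; rewrite mid_cons.
apply: PD; first exact: (PG [::]).
by apply: IHs => p a b q sE; apply: (PG (x :: p)); rewrite sE.
Qed.

Lemma homogs_catP (Q : gradedAlgebra) (es : seq int) (s1 s2 : seq Q) : homogs es (s1 ++ s2) ->
  homogs (take (size s1) es) s1 /\ homogs (drop (size s1) es) s2.
Proof.
move=> h; have := homogs_take (size s1) h; have := homogs_drop (size s1) h.
by rewrite take_size_cat // drop_size_cat.
Qed.

(** * Cochains with scalar values on arguments of degree 1 *)

Section LowDegreeVanishing.
Variables (B : comNzRingType) (hB : boolean B) (V : lmodType 'F_2) (m : int).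
Local Notation A := (ca_alg (connsum (boolean_algebra hB) (dual_algebra V))).
Local Notation homogA := (homog (ga_grading A)).
Local Notation amid := (@mid A *%R A).
Local Notation tA := (posi hB (tR B V)).
Local Notation tpart x := (posi hB (x, 0 : V)).
Implicit Types (F : seq A -> A) (p q s : seq A) (a : A).

Definition homogs1 s := homogs (nseq (size s) 1) s.

Lemma homogs1_cat s1 s2 : homogs1 (s1 ++ s2) <-> homogs1 s1 /\ homogs1 s2.
Proof.
rewrite /homogs1 size_cat nseqD; split=> [h|[h1 h2]]; last exact: homogs_cat.
have := homogs_catP h; rewrite take_size_cat ?size_nseq // drop_size_cat ?size_nseq //.
Qed.

Lemma homog1_posi a : homogA 1 a -> a = posi hB (((posp a).1`_0)%:P, (posp a).2).
Proof.
move=> /homog_posP[aE [a1 _]]; rewrite {1}aE {aE}; congr posi.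
by move: a1; rewrite expr0 alg_polyC; case: (posp a) => x v /= ->; rewrite coefC eqxx.
Qed.

Lemma bar_deg1 n F s : bar_cochain m n F -> size s = n -> homogs1 s ->
  homogA (Posz n + m) (F (1 :: rcons s 1)).
Proof.
move=> bF sn hs; have := bar_deg bF (es := 0 :: rcons (nseq n 1) 0) (s := 1 :: rcons s 1).
rewrite /= size_rcons sn => /(_ erefl).
have -> : \sum_(e <- (0 : int) :: rcons (nseq n 1) 0) e = Posz n.
  rewrite big_cons add0r -(cats1 (nseq n 1)) big_cat big_seq1 /= addr0.
  by elim: (n) => [|k IHk]; rewrite ?big_nil //= big_cons IHk -PoszD add1n.
apply; split; first exact: (@ga_homog1 A).
rewrite -(cats1 s) -(cats1 (nseq n 1)); apply: homogs_cat; first by rewrite -sn.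
by split=> //; apply: (@ga_homog1 A).
Qed.

Lemma mul_homog1 a b : homogA 1 a -> homogA 1 b ->
  a * b = tA * tpart ((posp a).1`_0 * (posp b).1`_0)%:P.
Proof.
move=> /homog1_posi aE /homog1_posi bE; rewrite {1}aE {1}bE !posiM; congr posi.
by congr pair; rewrite /= mul1r polyCM.
Qed.

Lemma homog_sc1 (c : B) : homogA 1 (tpart c%:P).
Proof. exact: homog_tpartC. Qed.

Section DegreeZero.
Variables (n : nat) (F : seq A -> A).
Hypotheses (bF : bar_cochain m n F) (nm : Posz n + m = 0).
Hypothesis cF : forall s, size s = n.+3 -> amid F s = 0.
Hypothesis kF : forall i, (0 < i <= n.-1)%N -> killed i n F.

Definition ft s : A := F (1 :: rcons s 1).

Lemma ft_scalar s : size s = n -> homogs1 s -> exists c : 'F_2, ft s = c%:A.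
Proof.
move=> sn hs; exists (unitp (ft s)); apply: homog_0P.
by rewrite -nm; apply: bar_deg1.
Qed.

(* The merge of two elements of degree 1 contributes a multiple of t only, so
   that the cocycle equation can be compared on the component of e. *)
Definition onT a : Prop := exists c : 'F_2, a = c *: tA.

Lemma onTD a b : onT a -> onT b -> onT (a + b).
Proof. by move=> [c ->] [d ->]; exists (c + d); rewrite scalerDl. Qed.

(** The surplus t moves left one argument at a time, since t a with a of degree 1 is again t times
    an element of degree 1. From the coefficient it comes out in front of a scalar. *)
Lemma onT_carry p (c : B) r : homogs1 p -> homogs1 r -> (0 < size r)%N ->
  (size p + (size r).+1)%N = n -> onT (ft (p ++ tA * tpart c%:P :: r)).
Proof.
elim/last_ind: p c r => [|p a IHp] c r hp hr r0 ns; rewrite /ft.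
  have := @balanced_cat _ hB V n n.-1 F cF kF [::] 1 c%:P (rcons r 1).
  rewrite /= => <-; try size_lia.
  have [|//|d dE] := @ft_scalar (tpart c%:P :: r); first by size_lia.
    by split=> //; apply: homog_sc1.
  exists d; have := bar_head bF tA 1 (s := rcons (tpart c%:P :: r) 1); rewrite /= => ->.
    by rewrite -[F _]/(ft (tpart c%:P :: r)) dE -scalerAr mulr1.
  by size_lia.
have [hp' [ha _]] : homogs1 p /\ homogs1 [:: a] by apply/homogs1_cat; rewrite cats1.
rewrite cat_rcons rcons_cat /=.
have := @balanced_cat _ hB V n n.-1 F cF kF (1 :: p) a c%:P (rcons r 1).
rewrite /= => <-; try (rewrite size_rcons in ns; size_lia).
rewrite -rcons_cons -rcons_cons -rcons_cat.
have -> : tA * a = tA * tpart ((posp a).1`_0)%:P.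
  by rewrite (mul_homog1 (homog_tA hB V) ha) posiK -[(tR B V).1]/(1 : {poly B}) coef1 mul1r.
rewrite size_rcons in ns; apply: IHp => //=; last by size_lia.
by split=> //; apply: homog_sc1.
Qed.

Lemma avoid_span (w : B) : (exists f : 'I_8 -> B, injective f) ->
  exists e : B, e \notin [:: 0; 1; w; 1 + w].
Proof.
move=> [f f_inj]; pose L := [:: 0; 1; w; 1 + w].
have /allPn[e _ eL] : ~~ all (mem L) [seq f i | i <- enum 'I_8].
  apply/negP => /allP fL; have := uniq_leq_size (s2 := L) _ fL.
  by rewrite size_map size_enum_ord map_inj_uniq ?enum_uniq // => /(_ isT).
by exists e.
Qed.

Let c0 a : B := (posp a).1`_0.
Let c0D a b : c0 (a + b) = c0 a + c0 b. Proof. by rewrite /c0 pospD coefD. Qed.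
Let c0Z (c : 'F_2) a : c0 (c *: a) = if c == 0 then 0 else c0 a.
Proof. by case: (F2P c) => ->; rewrite ?scale0r ?scale1r //= /c0 posp0 coef0. Qed.
Let c0_posi (x : B) (v : V) : c0 (posi hB (x%:P, v)) = x.
Proof. by rewrite /c0 posiK coefC eqxx. Qed.

Let c00 : c0 0 = 0. Proof. by rewrite /c0 posp0 coef0. Qed.
Let c0_t : c0 tA = 1.
Proof. by rewrite /c0 posiK -[(tR B V).1]/(1 : {poly B}) coef1. Qed.

(** In the cocycle equation at (E, s, u, w), the first term is the scalar [ft (s ++ [:: u; w])]
    times E, whose coefficient is e. All other terms have their degree 1 coefficient in the span of
    1 and [c0 w]: the hypothesis on [c0 u * c0 w] ensures this for the merge of u with w. As e is
    outside the span, the scalar is 0. *)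
Lemma ft_core s u w (hcard : exists f : 'I_8 -> B, injective f) : n = (size s).+2 ->
  homogs1 s -> homogA 1 u -> homogA 1 w -> c0 u * c0 w = 0 \/ c0 u * c0 w = c0 w ->
  ft (s ++ [:: u; w]) = 0.
Proof.
move=> ns hs hu hw uw; have [e] := avoid_span (c0 w) hcard.
rewrite !inE !negb_or => /and4P[e0 e1 ew e1w].
pose E := tpart e%:P; have hE : homogA 1 E by apply: homog_sc1.
have [||c1 f1] := @ft_scalar (s ++ [:: u; w]); first by rewrite size_cat addn2 ns.
  by apply/homogs1_cat.
have : amid F (1 :: E :: s ++ [:: u; w; 1]) = 0.
  by apply: cF; rewrite /= size_cat addn3 -ns.
rewrite mid_cons mul1r.
have -> : F (E :: s ++ [:: u; w; 1]) = c1 *: E.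
  have := bar_head bF E 1 (s := s ++ [:: u; w; 1]); rewrite mulr1 => ->.
    have -> : s ++ [:: u; w; 1] = rcons (s ++ [:: u; w]) 1 by rewrite -cats1 -catA.
    by rewrite -[F _]/(ft (s ++ [:: u; w])) f1 -scalerAr mulr1.
  by rewrite size_cat addn3 ns.
rewrite -[E :: s ++ _]cat_cons mid_expand [amid _ [:: 1]]/= addr0 mulr1.
have hEs : homogs1 (E :: s) by split.
have -> : F (1 :: (E :: s) ++ [:: u; w]) = w * ft ((E :: s) ++ [:: u]).
  have := bar_last bF w 1 (s := 1 :: (E :: s) ++ [:: u]); rewrite mulr1 => <-.
    by rewrite -cats1 /= -catA.
  by rewrite /= size_cat addn1 ns.
have [||c4 ->] := @ft_scalar ((E :: s) ++ [:: u]).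
- by rewrite size_cat addn1 ns.
- by apply/homogs1_cat.
have [Z ZE] : onT (amid (fun q => F (1 :: q ++ [:: w; 1])) (rcons (E :: s) u)).
  apply: mid_ind => [|x y|p a b q pE]; first by exists 0; rewrite scale0r.
  - exact: onTD.
  - have : homogs1 (p ++ [:: a, b & q]) by rewrite -pE -cats1; apply/homogs1_cat.
    move=> /homogs1_cat[hp [ha [hb hq]]]; have := congr1 size pE; rewrite size_rcons size_cat /= => pn.
    have -> : 1 :: (p ++ a * b :: q) ++ [:: w; 1] = 1 :: rcons (p ++ (a * b) :: rcons q w) 1.
      by rewrite -!cats1 -!catA /= -!catA.
    rewrite mul_homog1 //; apply: onT_carry => //.
    + by rewrite -cats1; apply/homogs1_cat.
    + by rewrite size_rcons.
    + by rewrite size_rcons ns; size_lia.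
rewrite ZE.
(* The product [u * w] is the last inner argument. By [balanced_last] one term passes its factor t
   to the left, and in the other t remains while the rest of the product joins the right
   coefficient. *)
have [d [c3 dE]] : exists d c3 : 'F_2,
    F (1 :: (E :: s) ++ [:: u * w; 1]) = d *: tA + c3 *: tpart (c0 u * c0 w)%:P.
  have [p [a [pE pn]]] : exists p a, E :: s = rcons p a /\ size p = size s.
    by exists (belast E s), (last E s); rewrite -lastI size_belast.
  rewrite pE {pE} in hEs *.
  have [hp [ha _]] : homogs1 p /\ homogs1 [:: a] by apply/homogs1_cat; rewrite cats1.
  rewrite mul_homog1 // cat_rcons -cat_cons.
  have -> := @balanced_last _ hB V n n.-1 F cF kF (1 :: p) a (c0 u * c0 w)%:P 1;
    try by rewrite /= ?pn ns ?addn3.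
  have [d dE] : onT (F ((1 :: p) ++ [:: tA * a; tpart (c0 u * c0 w)%:P; 1])).
    rewrite (mul_homog1 (homog_tA hB V) ha).
    have := @onT_carry p ((posp tA).1`_0 * (posp a).1`_0) [:: tpart (c0 u * c0 w)%:P] hp.
    rewrite /ft rcons_cat; apply=> //; first by split=> //; apply: homog_sc1.
    by rewrite addn2 pn.
  have [||c3 c3E] := @ft_scalar (p ++ [:: a; tA]).
  - by rewrite size_cat addn2 pn.
  - by apply/homogs1_cat; split=> //; split=> //; split=> //; apply: homog_tA.
  exists d, c3; rewrite dE; congr (_ + _).
  have := bar_last bF (tpart (c0 u * c0 w)%:P) 1 (s := (1 :: p) ++ [:: a; tA]).
  rewrite -!cats1 -!catA => ->; last by rewrite /= size_cat addn2 pn -ns.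
  have -> : (1 :: p) ++ [:: a; tA] ++ [:: 1] = 1 :: rcons (p ++ [:: a; tA]) 1.
    by rewrite -cats1 /= -catA.
  by rewrite -[F _]/(ft (p ++ [:: a; tA])) c3E -scalerAr mulr1.
rewrite dE -scalerAr mulr1 f1 => /(congr1 c0); rewrite !(c0D, c0Z) c00 c0_t !c0_posi.
case: (F2P c1) => -> /=; first by rewrite scale0r.
pose sp x := exists a b : bool, x = a%:R + c0 w *+ b.
have B2 (x : B) : x + x = 0 by apply: boolean_addxx.
have spD x y : sp x -> sp y -> sp (x + y).
  move=> [a [b ->]] [a' [b' ->]]; exists (a (+) a'), (b (+) b'); rewrite addrACA.
  by case: a a' b b' => [] [] [] [] /=; rewrite ?(mulr0n, mulr1n, B2, addr0, add0r).
have sp0 : sp 0 by exists false, false; rewrite addr0.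
have sp1 : sp 1 by exists true, false; rewrite addr0.
have spw : sp (c0 w) by exists false, true; rewrite add0r.
have spuw : sp (c0 u * c0 w) by case: uw => ->.
have spif (b : bool) x : sp x -> sp (if b then 0 else x) by case: b.
set X := (X in e + X = 0) => h.
have [a [b Xab]] : sp X.
  exact (spD _ _ (spD _ _ (spif _ _ sp1) (spD _ _ (spif _ _ sp1) (spif _ _ spuw))) (spif _ _ spw)).
have : e = a%:R + c0 w *+ b.
  by rewrite -Xab; apply: (addIr X); rewrite h B2.
case: a b {Xab} => [] [] /= eE; move: e0 e1 ew e1w; rewrite eE ?addr0 ?add0r ?eqxx //.
Qed.

Lemma ft_cat_add s a b r : (size s + (size r).+1)%N = n ->
  ft (s ++ (a + b) :: r) = ft (s ++ a :: r) + ft (s ++ b :: r).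
Proof.
move=> sn; rewrite /ft !rcons_cat !rcons_cons -!cat_cons.
by apply: (barD bF); rewrite /= size_rcons addnS addSn sn.
Qed.

Let homog_pair (x : B) (v : V) : homogA 1 (posi hB (x%:P, v)).
Proof. by apply/homog_posiP; split; [rewrite /= coefC eqxx expr0 alg_polyC | left]. Qed.

(** Split the B-coefficients x of [u] and y of [w] as xy + (x - xy) and xy + (y - xy). A part of x
    times a part of y is 0, except for xy times itself, which is xy; so [ft_core] applies to all
    four pairs. *)
Lemma ft_eq0_ge2 (hcard : exists f : 'I_8 -> B, injective f) s u w : n = (size s).+2 ->
  homogs1 s -> homogA 1 u -> homogA 1 w -> ft (s ++ [:: u; w]) = 0.
Proof.
move=> ns hs hu hw; have bb (x : B) : x * x = x by rewrite -expr2 hB.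
set x := c0 u; set y := c0 w.
have -> : u = tpart (x * y)%:P + posi hB ((x - x * y)%:P, (posp u).2).
  rewrite {1}(homog1_posi hu) -posiD; congr posi; congr pair; last by rewrite /= add0r.
  by rewrite /= -polyCD addrC subrK.
have -> : w = tpart (x * y)%:P + posi hB ((y - x * y)%:P, (posp w).2).
  rewrite {1}(homog1_posi hw) -posiD; congr posi; congr pair; last by rewrite /= add0r.
  by rewrite /= -polyCD addrC subrK.
have xyy : x * y * y = x * y by rewrite -mulrA bb.
have xxy : x * (x * y) = x * y by rewrite mulrA bb.
have co (a b : B) (v v' : V) : a * b = 0 \/ a * b = b ->
    ft (s ++ [:: posi hB (a%:P, v); posi hB (b%:P, v')]) = 0.
  by move=> ab; apply: ft_core; rewrite ?c0_posi //; apply: homog_pair.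
rewrite ft_cat_add; last by rewrite /= addn2 ns.
have add2 a b c : ft (s ++ [:: a; b + c]) = ft (s ++ [:: a; b]) + ft (s ++ [:: a; c]).
  have := @ft_cat_add (s ++ [:: a]) b c [::]; rewrite -!catA; apply.
  by rewrite size_cat /= !addn1 ns.
rewrite !add2 !co ?addr0 //; [left | left | left | right].
- by rewrite mulrBl mulrBr mulrBr xyy [x * y * (x * y)]mulrAC xxy xyy !subrr.
- by rewrite mulrBl xxy -mulrA [y * (x * y)]mulrC -mulrA bb xxy subrr.
- by rewrite mulrBr xyy bb subrr.
- by rewrite bb.
Qed.

(** For equal arguments t b the outer terms of the cocycle equation cancel, which leaves t ft (t b)
    = t b ft (t). Choosing b = e outside {0, 1} forces ft (t) = 0, hence ft (t b) = 0 for all b. The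
    equation for [u] and t then gives ft (u) = 0. *)
Lemma ft_eq0_1 (hcard : exists f : 'I_8 -> B, injective f) u : n = 1%N -> homogA 1 u ->
  ft [:: u] = 0.
Proof.
move=> n1 hu; have cF1 a b : homogA 1 a -> homogA 1 b ->
    a * ft [:: b] + (tA * ft [:: tpart (c0 a * c0 b)%:P] + tpart (c0 a * c0 b)%:P * ft [:: tA])
    + b * ft [:: a] = 0.
  move=> ha hb; have := cF (s := [:: 1; a; b; 1]); rewrite n1 => /(_ erefl).
  rewrite !mid_cons [amid _ [:: 1]]/= addr0 mul1r mulr1 mul_homog1 //.
  have -> := @balanced_last _ hB V n n.-1 F cF kF [::] 1 (c0 a * c0 b)%:P 1; rewrite ?n1 //.
  have hh c x y : F [:: c * x; y; 1] = c * F [:: x; y; 1].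
    by apply: (bar_head bF); rewrite n1.
  have hl c x y : F [:: x; y; c * 1] = c * F [:: x; y; 1].
    by have := bar_last bF c 1 (s := [:: x; y]); rewrite n1 => ->.
  have -> : F [:: a; b; 1] = a * F [:: 1; b; 1] by rewrite -hh mulr1.
  have -> : F [:: 1; a; b] = b * F [:: 1; a; 1] by rewrite -hl mulr1.
  by rewrite /ft !cat0s hh hl addrA.
have sc a : homogA 1 a -> exists c : 'F_2, ft [:: a] = c%:A.
  by move=> ha; apply: ft_scalar; rewrite ?n1.
have hC (b : B) : homogA 1 (tpart b%:P) by apply: homog_sc1.
have ht := homog_tA hB V; have bb (x : B) : x * x = x by rewrite -expr2 hB.
have [e] := avoid_span 0 hcard; rewrite !inE !negb_or addr0 => /and4P[e0 e1 _ _].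
have main b : tA * ft [:: tpart b%:P] + tpart b%:P * ft [:: tA] = 0.
  have := cF1 _ _ (hC b) (hC b); rewrite c0_posi bb [X in X + _]addrC -addrA.
  by rewrite (@algF2_addxx A) addr0.
have ftt : ft [:: tA] = 0.
  have [d dE] := sc _ ht; have [c cE] := sc _ (hC e).
  have := main e; rewrite dE cE -!scalerAr !mulr1 => /(congr1 c0).
  rewrite c0D !c0Z c0_t c0_posi c00; case: (F2P d) => -> /=; first by rewrite scale0r.
  case: (F2P c) => -> /=; rewrite ?add0r => h; first by rewrite h eqxx in e0.
  by case/negP: e1; apply/eqP/(addrI 1); rewrite h boolean_addxx.
have ftb b : ft [:: tpart b%:P] = 0.
  have := main b; rewrite ftt mulr0 addr0; have [c ->] := sc _ (hC b).
  rewrite -scalerAr mulr1 => /(congr1 c0); rewrite c0Z c0_t c00.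
  by case: (F2P c) => -> /=; rewrite ?scale0r // => /eqP; rewrite oner_eq0.
have := cF1 _ _ hu ht; rewrite ftb ftt !mulr0 !add0r; have [c ->] := sc _ hu.
rewrite -scalerAr mulr1 => /(congr1 c0); rewrite c0Z c0_t c00.
by case: (F2P c) => -> /=; rewrite ?scale0r // => /eqP; rewrite oner_eq0.
Qed.

End DegreeZero.

Theorem low_degree_vanishing n F (hcard : exists f : 'I_8 -> B, injective f) :
  bar_cochain m n.+1 F -> Posz n.+1 + m <= 0 ->
  (forall s, size s = n.+4 -> amid F s = 0) ->
  exists2 G, bar_cochain m n G & forall s, size s = n.+3 -> F s = amid G s.
Proof.
move=> bF nm cF; have [G bG nF1] := bar_normalise (@connsumC _ hB V) bF cF.
pose F1 s := F s - amid G s.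
have bF1 : bar_cochain m n.+1 F1 by apply: bar_sub bF _; apply: bar_mid bG; apply: connsumC.
have cF1 : forall s, size s = n.+4 -> amid F1 s = 0 := bar_cocycle_sub G cF.
have [H bH [nF2 kF2]] := slide_reduction bF1 nF1 cF1.
pose F2 s := F1 s - amid H s.
have bF2 : bar_cochain m n.+1 F2 by apply: bar_sub bF1 _; apply: bar_mid bH; apply: connsumC.
have cF2 : forall s, size s = n.+4 -> amid F2 s = 0 := bar_cocycle_sub H cF1.
suff F20 s : size s = n.+3 -> F2 s = 0.
  exists (fun s => G s + H s) => [|s sn].
    have -> : (fun s => G s + H s) = (fun s => G s - H s).
      by apply/funext => s; rewrite (@algF2_oppr A).
    exact: bar_sub.
  by apply/eqP; rewrite midD -subr_eq0 opprD addrA; apply/eqP; apply: F20.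
apply: (homogs1_vanish bF2 nF2 cF2) => [i i_n|{}s sn hs]; first exact: kF2.
have {}hs : homogs1 s by rewrite /homogs1 sn.
have := nm; rewrite Order.POrderTheory.le_eqVlt => /orP[/eqP nm0|nm0]; last first.
  have := bar_deg1 bF2 sn hs; move: nm0; case: (Posz n.+1 + m) => // i _; exact: homog_negP.
case/lastP: s sn hs => [//|s w]; case/lastP: s => [|s u].
  by move=> [n0] [hw _]; apply: (ft_eq0_1 bF2 nm0 cF2 kF2 hcard _ hw); rewrite n0.
rewrite !size_rcons -(cats1 _ w) -(cats1 s) -catA => sn /homogs1_cat[hs [hu [hw _]]].
exact: (ft_eq0_ge2 bF2 nm0 cF2 kF2 hcard (esym sn) hs hu hw).
Qed.

End LowDegreeVanishing.

(** * Total degree at least 2 *)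

Lemma mid_map (T U : Type) (mulT : T -> T -> T) (mulU : U -> U -> U) (W : zmodType)
    (h : T -> U) (F : seq U -> W) s : (forall x y, h (mulT x y) = mulU (h x) (h y)) ->
  mid mulU F (map h s) = mid mulT (fun q => F (map h q)) s.
Proof.
move=> hM; elim: s F => [|x [|y s] IHs] F //.
by rewrite !map_cons !mid_cons -hM; congr (_ + _); apply: (IHs (fun q => F (h x :: q))).
Qed.

Section GenericBar.
Variables (Q : gradedAlgebra) (m : int).
Hypothesis QC : commutative (@GRing.mul Q).
Local Notation homogQ := (homog (ga_grading Q)).
Implicit Types (F : seq Q -> Q) (s p : seq Q).

Lemma bar_homogs_eq0 n F : multiadd n F ->
  (forall es s, size s = n -> homogs es s -> F s = 0) -> forall s, size s = n -> F s = 0.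
Proof.
elim: n F => [|n IHn] F aF F0 [|x s] //= sn; first exact: (F0 [::] [::]).
have [r _ ->] := gcomp_sum (ga_grading Q) x.
rewrite (multiadd_sum _ _ _ aF (p := [::])) //; apply: big1 => i _; rewrite cat0s.
apply: (IHn (fun q => F (gcomp (ga_grading Q) i x :: q))); last by case: sn.
  exact: multiadd_cons aF.
move=> es q qn h; apply: (F0 (i :: es)); rewrite /= ?qn //; split=> //.
by rewrite /homog gcompK eqxx.
Qed.

Lemma bar_cochain_of n (h : seq Q -> Q) : multiadd n h -> bar_degree m n h ->
  bar_cochain m n (fun s => nth 0 s 0 * h (take n (behead s)) * nth 0 s n.+1).
Proof.
move=> ah dh; split.
- move=> [|a p] x y s ns.
    by rewrite /= mulrDl mulrDl.
  case/lastP: s ns => [|s b] ns.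
    have pn : size p = n by move: ns => [] /eqP; rewrite addn1 => /eqP [].
    by rewrite /= -pn !take_size_cat // !nth_cat ltnn subnn /= mulrDr.
  have pn : (size p + (size s).+1)%N = n.
    by move: ns; rewrite size_rcons /= !addSn !addnS => -[].
  have hE z : take n (behead ((a :: p) ++ z :: rcons s b)) = p ++ z :: s.
    by rewrite /= -rcons_cons -rcons_cat -cats1 takel_cat ?take_oversize // size_cat /= pn.
  have bE z : nth 0 ((a :: p) ++ z :: rcons s b) n.+1 = b.
    by rewrite -rcons_cons -rcons_cat nth_rcons /= size_cat /= pn ltnn eqxx.
  by rewrite !hE !bE ah // mulrDr mulrDl.
- by move=> c a s _; rewrite /= -!mulrA.
- move=> c b [|a s] // [sn].
  by rewrite !rcons_cons /= !nth_rcons sn ltnn eqxx -!cats1 !takel_cat ?sn // mulrA [_ * c]QC -mulrA.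
- move=> es s sn hh; have [en hn] := homogs_nth hh.
  case: es s en hh hn sn => [|e es] [|a s] //= [en] [ha hs] hn [sn].
  case/lastP: s en hs hn sn => [|s b] //; case/lastP: es => [|es e'];
    rewrite !size_rcons // => -[en] hs hn [sn].
  rewrite -(cats1 s) take_size_cat // nth_cat sn ltnn subnn /=.
  have he : homogQ e' b.
    by have := hn n.+1; rewrite /= !nth_rcons sn en sn ltnn eqxx.
  have hss : homogs es s.
    have := homogs_take n hs; rewrite -!cats1 !take_size_cat ?en ?sn //.
  rewrite big_cons -(cats1 es) big_cat big_seq1 /=.
  have := ga_homogM (ga_homogM ha (dh es s sn hss)) he.
  by congr (homog _ _ _); ring.
Qed.

End GenericBar.

(** * Evaluation at t = 1 and regrading of a primitive *)

Section HighDegree.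
Variables (B : comNzRingType) (hB : boolean B) (V : lmodType 'F_2) (m : int).
Local Notation A := (ca_alg (connsum (boolean_algebra hB) (dual_algebra V))).
Local Notation R := (aideal B V).
Local Notation homogA := (homog (ga_grading A)).
Local Notation amid := (@mid A *%R A).

(* Turns an ungraded cochain g into a homogeneous one: the value on monomials of
   degrees n_i + 1 is put in degree c + \sum_i n_i. *)
Fixpoint grade_cochain (c : nat) (g : seq R -> B^o) (s : seq R) : {poly B} :=
  if s is x :: s' then
    grade_cochain c (fun q => g ((0, x.2) :: q)) s'
    + \sum_(i < size x.1) grade_cochain (c + i) (fun q => g ((x.1`_i *: 'X^i, 0) :: q)) s'
  else (g [::] : B) *: 'X^c.

Lemma grade_cochain0 c g s : (forall q, size q = size s -> g q = 0) -> grade_cochain c g s = 0.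
Proof.
elim: s c g => [|x s IHs] c g g0; first by rewrite /= g0 // scale0r.
rewrite /= IHs ?add0r => [|q qs]; last by rewrite g0 //= qs.
by apply: big1 => i _; apply: IHs => q qs; rewrite g0 //= qs.
Qed.

Lemma grade_cochainD c g g' g'' s : (forall q, size q = size s -> g q = g' q + g'' q) ->
  grade_cochain c g s = grade_cochain c g' s + grade_cochain c g'' s.
Proof.
elim: s c g g' g'' => [|x s IHs] c g g' g'' gE; first by rewrite /= gE // scalerDl.
rewrite /= addrACA -big_split /=; congr (_ + _).
  by apply: IHs => q qs; apply: gE; rewrite /= qs.
by apply: eq_bigr => i _; apply: IHs => q qs; apply: gE; rewrite /= qs.
Qed.

Lemma multiadd_grade_cochain n c g : multiadd n g -> multiadd n (grade_cochain c g).
Proof.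
move=> ag p x y s; elim: p n c g ag => [|z p IHp] [|n] c g ag //= [ns].
  have a1 (u v w : R) q : u = v + w -> size q = size s -> g (u :: q) = g (v :: q) + g (w :: q).
    by move=> -> qs; apply: (ag [::]); rewrite /= qs ns.
  have g0 q : size q = size s -> g ((0 : R) :: q) = 0.
    by move=> qs; apply: (multiadd0 (p := [::]) ag); rewrite /= qs ns.
  pose N := maxn (size (x.1 + y.1)) (maxn (size x.1) (size y.1)).
  have bnd (u : {poly B}) : (size u <= N)%N ->
      \sum_(i < size u) grade_cochain (c + i) (fun q => g ((u`_i *: 'X^i, 0) :: q)) s =
      \sum_(i < N) grade_cochain (c + i) (fun q => g ((u`_i *: 'X^i, 0) :: q)) s.
    move=> uN; rewrite (big_ord_widen N (fun i =>
      grade_cochain (c + i) (fun q => g ((u`_i *: 'X^i, 0) :: q)) s)) // big_mkcond /=.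
    apply: eq_bigr => i _; case: ltnP => // ui; apply/esym/grade_cochain0 => q qs.
    by rewrite nth_default // scale0r g0.
  rewrite !bnd ?leq_max ?leqnn ?orbT // addrACA -big_split /=; congr (_ + _).
    by apply: grade_cochainD => q qs; apply: a1 => //; congr pair; rewrite /= addr0.
  apply: eq_bigr => i _; apply: grade_cochainD => q qs; apply: a1 => //.
  by congr pair; rewrite /= ?addr0 // coefD scalerDl.
rewrite addrACA -big_split /=; congr (_ + _); last (apply: eq_bigr => i _).
  by apply: (IHp n) => //; apply: multiadd_cons.
by apply: (IHp n) => //; apply: multiadd_cons.
Qed.

Fixpoint monos (ns : seq nat) (s : seq R) : Prop :=
  match ns, s with
  | [::], [::] => True
  | n :: ns', x :: s' => mono n x /\ monos ns' s'
  | _, _ => False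
  end.

Lemma mono_ev n (x : R) : mono n x -> x.1 = ev x *: 'X^n.
Proof.
move=> [xE _]; rewrite {1}xE; congr (_ *: _).
by rewrite /ev xE hornerZ hornerXn expr1n mulr1 coefZ coefXn eqxx mulr1.
Qed.

Lemma mono_mul n n' (x y : R) : mono n x -> mono n' y -> mono (n + n').+1 (rmul x y).
Proof.
move=> /mono_ev xE /mono_ev yE; split; last by right.
rewrite /= xE yE -scalerAl -scalerAr scalerA -exprD -scalerAl -exprSr.
by rewrite coefZ coefXn eqxx mulr1.
Qed.

Lemma grade_cochain_mono n c g ns s : multiadd n g -> size s = n -> monos ns s ->
  grade_cochain c g s = (g s : B) *: 'X^(c + sumn ns).
Proof.
elim: s n c g ns => [|x s IHs] n c g [|k ns] // ag; first by rewrite /= addn0.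
case: n ag => // n ag [sn] [xk hs].
have xE := mono_ev xk; have ac z : multiadd n (fun q => g (z :: q)) := multiadd_cons z ag.
have g0 : g ((0 : R) :: s) = 0 by apply: (multiadd0 (p := [::]) ag); rewrite /= sn.
have xi i : x.1`_i *: 'X^i = if i == k then x.1 else 0.
  rewrite {1}xE coefZ coefXn; case: eqP => [->|_]; first by rewrite mulr1 -xE.
  by rewrite mulr0 scale0r.
have zero i : i != k -> grade_cochain (c + i) (fun q => g ((x.1`_i *: 'X^i, 0) :: q)) s = 0.
  by move=> ik; rewrite xi (negPf ik) (IHs n _ _ ns (ac _) sn hs) g0 scale0r.
have xk1 : (size x.1 <= k.+1)%N.
  by rewrite xE (leq_trans (size_scale_leq _ _)) // size_polyXn.
rewrite /= (IHs n c _ ns (ac _) sn hs) (big_ord_widen k.+1 (fun i =>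
  grade_cochain (c + i) (fun q => g ((x.1`_i *: 'X^i, 0) :: q)) s)) // big_mkcond /=.
rewrite big_ord_recr /= big1 ?add0r => [|i _]; last first.
  by rewrite zero ?if_same // neq_ltn ltn_ord.
have -> : (if (k < size x.1)%N then
    grade_cochain (c + k) (fun q => g ((x.1`_k *: 'X^k, 0) :: q)) s else 0) =
    (g ((x.1, 0) :: s) : B) *: 'X^(c + k + sumn ns).
  case: ltnP => xk'; first by rewrite xi eqxx (IHs n _ _ ns (ac _) sn hs).
  suff -> : x.1 = 0 by rewrite g0 scale0r.
  by have := xi k; rewrite eqxx nth_default // scale0r => <-.
have xD : g (x :: s) = g ((0, x.2) :: s) + g ((x.1, 0) :: s).
  rewrite -(ag [::]) /= ?sn //; congr (g (_ :: _)).
  by rewrite [x in LHS]surjective_pairing; congr pair; rewrite /= ?addr0 ?add0r.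
rewrite xD addnA; have [k0|x2] := xk.2; first by rewrite k0 addn0 scalerDl.
by rewrite x2 g0 scale0r !add0r.
Qed.

Lemma monos_belast ns x s : monos ns (x :: s) ->
  exists k ks, [/\ mono k (last x s), monos ks (belast x s) & sumn ns = (k + sumn ks)%N].
Proof.
elim: s x ns => [|y s IHs] x [|k ns] //= [xk hs]; first by exists k, [::]; case: ns hs.
have [l [ls [lm bm ->]]] := IHs _ _ hs; exists l, (k :: ls); split=> //.
by rewrite /= addnCA.
Qed.

(** Monomials of exponents k and k' merge to exponent k + k' + 1, which accounts for the additional
    factor 'X. *)
Lemma mid_mono (E : seq R -> {poly B}) (g : seq R -> B^o) c ns s :
  (forall ks q, monos ks q -> (size q).+1 = size s -> E q = (g q : B) *: 'X^(c + sumn ks)) ->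
  monos ns s -> mid (@rmul B V) E s = (mid (@rmul B V) g s : B) *: 'X^((c + sumn ns).+1).
Proof.
elim: s E g c ns => [|x [|y s] IHs] E g c [|k [|k' ns]] //= Eg; rewrite ?scale0r //.
  by case=> _ [].
move=> [xk [yk hs]]; rewrite -/(mid _ (fun q => E (x :: q)) (y :: s)).
rewrite -/(mid _ (fun q => g (x :: q)) (y :: s)) scalerDl; congr (_ + _).
  rewrite (Eg ((k + k').+1 :: ns)) //=; last by split=> //; apply: mono_mul.
  by congr (_ *: 'X^_); lia.
have -> : (c + sumn [:: k, k' & ns] = c + k + sumn (k' :: ns))%N by rewrite /= !addnA.
apply: IHs => // ks q hq [qs].
by rewrite (Eg (k :: ks)) //= ?qs // addnA.
Qed.

Lemma mid_ft n (F : seq A -> A) x s : bar_cochain m n F -> size s = n ->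
  amid F (1 :: rcons (x :: s) 1) =
  x * ft F s + amid (ft F) (x :: s) + last x s * ft F (belast x s).
Proof.
move=> bF sn; rewrite rcons_cons mid_cons mul1r -addrA; congr (_ + _).
  rewrite -[in LHS](mulr1 x) (bar_head bF) ?size_rcons ?sn //.
rewrite -rcons_cons lastI mid_rcons mulr1; congr (_ + _).
rewrite -[X in rcons _ X]mulr1 -rcons_cons (bar_last bF) //=.
by rewrite size_belast sn.
Qed.

(* The ring morphism A -> B with t |-> 1 and V |-> 0. *)
Definition augB (a : A) : B := (unitp a : nat)%:R + ev (posp a).

Lemma augBD : {morph augB : x y / x + y}.
Proof.
move=> x y; rewrite /augB pospD evD unitpD [RHS]addrACA; congr (_ + _).
by case: (F2P (unitp x)) (F2P (unitp y)) => -> [] ->; rewrite /= ?addr0 ?add0r ?boolean_addxx.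
Qed.

Lemma augB_posi x : augB (posi hB x) = ev x.
Proof. by rewrite /augB posiK unitp_posi add0r. Qed.

Lemma augB_posiM x a : augB (posi hB x * a) = ev x * augB a.
Proof.
rewrite {1}[a]connsum_eta mulrDr -scalerAr mulr1 posiM augBD augB_posi evM [augB a]/augB mulrDr.
congr (_ + _); case: (F2P (unitp a)) => ->; last by rewrite scale1r augB_posi mulr1.
by rewrite scale0r /= mulr0 /augB posp0 /ev horner0 addr0.
Qed.

Section Vanish.
Variables (K c : nat) (F : seq A -> A).
Hypotheses (bF : bar_cochain m K.+2 F) (nF : normal_upto K.+2 K.+2 F).
Hypothesis cF : forall s, size s = K.+2.+3 -> amid F s = 0.
Hypothesis cE : Posz c = Posz K + m.

Local Notation ps := (@posi B hB V).

Let phi (s : seq R) : B^o := augB (ft F (map ps s)).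

Lemma multiadd_phi : multiadd K.+2 phi.
Proof.
move=> p x y s ns; rewrite /phi !map_cat !map_cons posiD -augBD /ft !rcons_cat !rcons_cons.
congr augB; rewrite -!cat_cons; apply: (barD bF).
by rewrite /= size_rcons !size_map addSn addnS ns.
Qed.

Lemma hd_phi s : size s = K.+3 -> hd phi s = 0.
Proof.
case: s => // x s [sn].
have := mid_ft (ps x) (s := map ps s) bF; rewrite size_map => /(_ sn).
rewrite cF; last by rewrite /= size_rcons size_map sn.
move/(congr1 augB); rewrite !augBD last_map belast_map !augB_posiM.
rewrite -map_cons (@mid_map _ _ (@rmul B V) _ _ ps); last by move=> a b; rewrite posiM.
by rewrite (mid_morph _ _ _ augBD) /augB posp0 /ev horner0 add0r => /esym h.
Qed.

(** Homogeneous entries of degree at most 0 are 0 or 1. A monomial of exponent n has degree n + 1,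
    hence the summand [size r]. *)
Lemma homogs_cases es s : homogs es s ->
  (exists p x q, s = p ++ x :: q /\ (x = 0 \/ x = 1)) \/
  (exists ns r, [/\ s = map ps r, monos ns r & \sum_(e <- es) e = Posz (sumn ns + size r)]).
Proof.
elim: es s => [|e es IHes] [|x s] //=; first by right; exists [::], [::]; rewrite big_nil.
move=> [hx /IHes[[p [y [q [-> hy]]]]|[ns [r [-> hr esE]]]]].
  by left; exists (x :: p), y, q.
case: e hx => [[|e]|e] hx.
- left; exists [::], x, (map ps r); split=> //; rewrite (homog_0P hx).
  by case: (F2P (unitp x)) => ->; rewrite ?scale0r ?scale1r; [left | right].
- have [-> xm] := homog_posP hx; right; exists (e :: ns), (posp x :: r); split=> //.
  by rewrite big_cons esE /=; lia.
- by left; exists [::], x, (map ps r); split=> //; left; apply: (@homog_negP _ hB V _ _ hx).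
Qed.

(** On monomials of positive degree [F] has values of degree at least 2, that is in B t^n, and these
    are recovered from [phi]. So the regraded primitive of [phi] works there, and normalisation of
    [F] and [G] covers unit arguments. *)
Lemma high_degree_normal : exists2 G, bar_cochain m K.+1 G &
  forall s, size s = K.+2.+2 -> F s = amid G s.
Proof.
have [g ag phiE] := HH_aideal_vanish hB multiadd_phi hd_phi.
pose h (s : seq A) := ps (grade_cochain c g (map (@posp B hB V) s), 0).
have ah : multiadd K.+1 h.
  move=> p x y s ns; rewrite /h !map_cat !map_cons pospD.
  rewrite (multiadd_grade_cochain c ag) ?size_map // -posiD; congr posi.
  by congr pair; rewrite addr0.
have h_unit p x q : (size p + (size q).+1)%N = K.+1 -> x = 0 \/ x = 1 -> h (p ++ x :: q) = 0.
  move=> ns x01; rewrite /h map_cat map_cons (_ : posp x = 0).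
    rewrite (multiadd0 (multiadd_grade_cochain c ag)) ?size_map //; exact: posi0.
  by case: x01 => ->.
have h_posi r : h (map ps r) = ps (grade_cochain c g r, 0).
  by rewrite /h (mapK (@posiK _ _ _)).
have dh : bar_degree m K.+1 h.
  move=> es s sn /homogs_cases[[p [x [q [sE x01]]]]|[ns [r [sE hr ->]]]].
    rewrite sE h_unit //; first exact: homog0.
    by rewrite -sn sE size_cat.
  have rn : size r = K.+1 by rewrite -sn sE size_map.
  rewrite sE h_posi (grade_cochain_mono c ag rn hr).
  (* The [K.+1] degrees n_i + 1 and m = c - K add up to c + sum n_i + 1, the degree encoded by the
     exponent c + sum n_i. *)
  rewrite (_ : _ + m = Posz (c + sumn ns).+1); last by rewrite rn; lia.
  apply/homog_posiP; split; last by right.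
  by rewrite /= coefZ coefXn eqxx mulr1.
have bG := bar_cochain_of (@connsumC _ hB V) ah dh; set G := fun s => _ in bG.
have ftG s : size s = K.+1 -> ft G s = h s.
  by move=> sn; rewrite /ft /G /= mul1r -cats1 -sn take_size_cat // nth_cat ltnn subnn mulr1.
exists G => //.
have nG : normal_upto K.+1 K.+1 G.
  move=> [|a p] q // _; case/lastP: q => [|q b] // _; rewrite size_rcons /= => ns.
  rewrite /G /= (_ : take _ _ = p ++ 1 :: q); last first.
    by rewrite -rcons_cons -rcons_cat -cats1 take_size_cat // size_cat /=; size_lia.
  by rewrite h_unit ?mulr0 ?mul0r //; [size_lia | right].
have bD := bar_sub bF (bar_mid (@connsumC _ hB V) bG).
set D := fun s => _ in bD.
suff D0 s : size s = K.+2 -> D (1 :: rcons s 1) = 0.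
  move=> s sn; apply: (@algF2_eq A); rewrite -[amid G s](@algF2_oppr A).
  rewrite -/(D s) (bar_ofK (@connsumC _ hB V) bD) // D0 ?mulr0 ?mul0r //.
  by rewrite size_takel // size_behead sn.
apply: (bar_homogs_eq0 (F := fun s => D (1 :: rcons s 1))).
  move=> p x y q ns; rewrite !rcons_cat !rcons_cons -!cat_cons.
  by apply: (bar_add bD); rewrite /= size_rcons addSn addnS ns.
move=> {}es {}s sn hs; have [[p [x [q [sE x01]]]]|[ns [r [sE hr esE]]]] := homogs_cases hs.
  have nq : (size (1%R :: p) + (size (rcons q 1%R)).+1)%N = K.+2.+2.
    by rewrite -sn sE size_cat size_rcons /= addSn addnS.
  rewrite sE rcons_cat rcons_cons -cat_cons; case: x01 => ->.
    exact: (multiadd0 (bar_add bD)).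
  rewrite /D nF ?(mid_normal nG) ?subr0 //; move: nq; rewrite ?size_rcons /=; size_lia.
have rn : size r = K.+2 by rewrite -sn sE size_map.
have hF : homogA (Posz (c + sumn ns).+2) (ft F s).
  have h1 : homogA 0 1 := ga_homog1 A.
  have := bar_deg bF (es := 0 :: rcons es 0) (s := 1 :: rcons s 1).
  rewrite /= size_rcons sn => /(_ erefl); rewrite big_cons add0r -!cats1 big_cat big_seq1 /= addr0 esE.
  rewrite (_ : _ + m = Posz (c + sumn ns).+2); last by rewrite rn; lia.
  rewrite /ft -cats1; apply; split; first exact: h1.
  exact: (@homogs_cat _ _ [:: 0] _ [:: 1] hs).
have [FE Fm] := homog_posP hF.
have F2 : (posp (ft F s)).2 = 0 by case: Fm => _ [].
have evF : ev (posp (ft F s)) = phi r by rewrite /phi -sE FE augB_posi posiK.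
rewrite /D -/(ft F s) FE [posp _]surjective_pairing F2 (mono_ev Fm) evF phiE //.
case: r sE hr rn esE {evF FE Fm F2 hF} => // x r sE hr [rn] esE; rewrite sE map_cons.
rewrite (mid_ft _ bG) ?size_map // last_map belast_map -map_cons.
rewrite (@mid_map _ _ (@rmul B V) _ _ ps); last by move=> a b; rewrite posiM.
have gE q : size q = K.+1 -> ft G (map ps q) = ps (grade_cochain c g q, 0).
  by move=> qn; rewrite ftG ?size_map // h_posi.
have psM k ks y q : mono k y -> monos ks q -> size q = K.+1 ->
    ps y * ft G (map ps q) = ps ((ev y * (g q : B)) *: 'X^((c + (k + sumn ks)).+1), 0).
  move=> ym qm qn; rewrite gE // (grade_cochain_mono c ag qn qm) posiM; congr posi.
  congr pair; rewrite /= (mono_ev ym) -scalerAl -scalerAr scalerA -scalerAl -exprD -exprSr.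
  by congr (_ *: 'X^_); lia.
have [k [ks [lm bm nsE]]] := monos_belast hr; rewrite (psM k ks _ _ lm bm) ?size_belast // -nsE.
case: ns hr {nsE esE} => // k' ks' hr; have [xm rm] := hr; rewrite (psM k' ks') //.
have -> : mid (@rmul B V) (fun q => ft G (map ps q)) (x :: r) =
    mid (@rmul B V) (fun q => ps (grade_cochain c g q, 0)) (x :: r).
  by apply: eq_mid => q [qn]; apply: gE; rewrite qn rn.
have psD : {morph (fun p => ps (p, 0)) : p q / p + q}.
  by move=> p q; rewrite -posiD; congr posi; congr pair; rewrite addr0.
rewrite -(mid_morph _ _ _ psD).
rewrite (@mid_mono _ g c (k' :: ks')) //; last first.
  by move=> ls q lq [qn]; apply: grade_cochain_mono ag _ lq; rewrite qn rn.
rewrite /= -!posiD (@algF2_oppr A) -posiD -posi0; congr posi; congr pair.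
  rewrite -[LHS]/(_ *: _ + (_ *: _ + _ *: _ + _ *: _)) -!scalerDl.
  by rewrite [X in X *: _](_ : _ = 0) ?scale0r //; apply: (boolean_addxx hB).
by rewrite -[LHS]/(0 + (0 + 0 + 0) : V) !addr0.
Qed.

End Vanish.

Theorem high_degree_vanishing K F : bar_cochain m K.+2 F -> 0 <= Posz K + m ->
  (forall s, size s = K.+2.+3 -> amid F s = 0) ->
  exists2 G, bar_cochain m K.+1 G & forall s, size s = K.+2.+2 -> F s = amid G s.
Proof.
move=> bF Km cF; have [G bG nF] := bar_normalise (@connsumC _ hB V) bF cF.
have cE : Posz (absz (Posz K + m)) = Posz K + m by lia.
have [H bH FH] := high_degree_normal (bar_sub bF (bar_mid (@connsumC _ hB V) bG)) nF
  (bar_cocycle_sub _ cF) cE.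
exists (fun s => G s - H s) => [|s sn]; first exact: bar_sub.
rewrite midB -FH // opprB addrA.
by rewrite (@algF2_addxx A) sub0r (@algF2_oppr A).
Qed.

End HighDegree.

Theorem theorem1p5 (B : comNzRingType) (hB : boolean B)
    (hcard : exists f : 'I_8 -> B, injective f)
    (V : lmodType 'F_2) (m : int) (k : nat) (hm : m < 0) (hk : k%:Z <> 1 - m) :
  HH_vanishes (regular_bimodule (connsum (boolean_algebra hB) (dual_algebra V))) k m.
Proof.
have QC := @connsumC _ hB V; apply: (bar_vanishes QC) => F bF cF.
case: k hk F bF cF => [|k] hk F bF cF.
  (* For k = 0 the value at (1, 1) has degree m < 0, so it is 0. *)
  move=> s sn; rewrite (bar_ofK QC bF) // take0.
  have := bar_deg bF (es := [:: 0; 0]) (s := [:: 1; 1]) erefl.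
  rewrite !big_cons big_nil !add0r; have h1 := @ga_homog1 (connsum (boolean_algebra hB) (dual_algebra V)).
  case: m hm {hk bF cF} => // j _ /(_ (conj h1 (conj h1 I))) h.
  by rewrite (@homog_negP _ hB V _ _ h) mulr0 mul0r.
have [km|km] : Posz k.+1 + m <= 0 \/ 1 < Posz k.+1 + m by lia.
  exact: (low_degree_vanishing hcard bF).
case: k hk F bF cF km => [|k] hk F bF cF km; first by lia.
by apply: high_degree_vanishing bF _ cF; lia.
Qed.
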